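(* Let $\mathcal{G}$ be a (labelled) subcritical block-stable graph class such that, for some $n_0$, $[z^n]\,\mathcal{C}^{\bullet}(z)>0$ for all $n\ge n_0$. Then there exist constants $\gamma\ge e\approx 2.71828$ and $c>0$ such that $$[z^n]\,\mathcal{G}(z)=c\,n^{-5/2}\,\gamma^n\,(1+o(1))\qquad\text{as } n\to\infty .$$
   Context: All graphs are finite and simple; labelled graphs on $n$ vertices have vertex set $\{1,\dots,n\}$. A graph class is a set of labelled graphs closed under isomorphism. The graph consisting of one edge and its two end vertices (the link-graph) is regarded as 2-connected; a block of a graph is a maximal 2-connected induced subgraph. A graph class $\mathcal{G}$ is block-stable if it contains the link-graph and a graph $G$ belongs to $\mathcal{G}$ if and only if all blocks of $G$ belong to $\mathcal{G}$. Let $\mathcal{C}$ and $\mathcal{B}$ be the subclasses of connected, respectively 2-connected, graphs in $\mathcal{G}$. For a class $\mathcal{A}=\bigcup_n\mathcal{A}_n$ (with $n$ the number of vertices), $\mathcal{A}(z)=\sum_n |\mathcal{A}_n| z^n/n!$ is its exponential generating function, $\mathcal{A}'(z)=\frac{d}{dz}\mathcal{A}(z)$, and $\mathcal{A}^{\bullet}(z)=z\mathcal{A}'(z)$ is the exponential generating function of vertex-rooted graphs from $\mathcal{A}$. One has $\mathcal{G}(z)=\exp(\mathcal{C}(z))$ and $\mathcal{C}^{\bullet}(z)=z\exp(\mathcal{B}'(\mathcal{C}^{\bullet}(z)))$. The block-stable class $\mathcal{G}$ is called subcritical (labelled sense) if $\mathcal{C}^{\bullet}(\rho)<\eta$, where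 $\rho$ is the radius of convergence of $\mathcal{C}^{\bullet}(z)$ and $\eta$ is the radius of convergence of $\mathcal{B}'(y)$. *)

(* Defs.v *)
From HB Require Import structures.
From mathcomp Require Import all_boot all_order perm all_algebra.
From mathcomp Require Import all_classical all_reals all_analysis.

Set Implicit Arguments.
Unset Strict Implicit.
Unset Printing Implicit Defensive.

Import Order.TTheory GRing.Theory Num.Theory.
Import numFieldNormedType.Exports.

(* A labelled graph on n vertices has vertex set 'I_n = {0, ..., n-1} (rather
   than {1, ..., n}) and is given by its set of edges, which are 2-element sets
   of vertices: loops and multiple edges are excluded by construction. *)
Record lgraph (n : nat) := LGraph {
  edges :> {set {set 'I_n}};
  edges_card2 : [forall e in edges, #|e| == 2] }.

HB.instance Definition _ n := [isSub for @edges n].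
HB.instance Definition _ n := [Finite of lgraph n by <:].

Definition adj n (g : lgraph n) : rel 'I_n := fun x y => [set x; y] \in edges g.

Definition isomorphic n (g h : lgraph n) : Prop :=
  exists s : {perm 'I_n}, forall x y, adj g x y = adj h (s x) (s y).

(* The subgraph induced by S, relabelled by 'I_#|S| along the increasing
   enumeration enum_val of S. *)
Definition induced_edges n (g : lgraph n) (S : {set 'I_n}) : {set {set 'I_#|S|}} :=
  [set e : {set _} | (@enum_val _ (mem S)) @: e \in edges g].

Lemma induced_edges_card2 n (g : lgraph n) (S : {set 'I_n}) :
  [forall e in induced_edges g S, #|e| == 2].
Proof.
apply/forall_inP => e; rewrite inE => eg.
by rewrite -(card_imset _ enum_val_inj); exact: (forall_inP (edges_card2 g)).
Qed.

Definition induced_graph n (g : lgraph n) (S : {set 'I_n}) : lgraph #|S| :=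
  LGraph (induced_edges_card2 g S).

Lemma link_card2 : [forall e in [set [set: 'I_2]], #|e| == 2].
Proof. by apply/forall_inP => e; rewrite inE => /eqP ->; rewrite cardsT card_ord. Qed.

Definition link_graph : lgraph 2 := LGraph link_card2.

(* The empty graph is not connected; the one-vertex graph is. *)
Definition connected_graph n (g : lgraph n) : bool :=
  (0 < n)%N && [forall x, forall y, connect (adj g) x y].

(* At least 3 vertices, connected, and without cut vertex; or the link-graph,
   which is the only connected graph on 2 vertices. *)
Definition two_connected_graph n (g : lgraph n) : bool :=
  connected_graph g &&
  ((n == 2) || (2 < n)%N && [forall v, connected_graph (induced_graph g [set~ v])]).

(* A block is represented by its vertex set. *)
Definition is_block n (g : lgraph n) (S : {set 'I_n}) : bool :=
  maxset (fun T => two_connected_graph (induced_graph g T)) S.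

Definition graph_family := forall n, {set lgraph n}.

Definition graph_class (G : graph_family) : Prop :=
  forall n (g h : lgraph n), isomorphic g h -> g \in G n -> h \in G n.

Definition block_stable (G : graph_family) : Prop :=
  link_graph \in G 2 /\
  forall n (g : lgraph n),
    g \in G n <-> (forall S, is_block g S -> induced_graph g S \in G #|S|).

Definition connected_subclass (G : graph_family) : graph_family :=
  fun n => [set g in G n | connected_graph g].

Definition two_connected_subclass (G : graph_family) : graph_family :=
  fun n => [set g in G n | two_connected_graph g].

Local Open Scope classical_set_scope.
Local Open Scope ring_scope.

(* Generating functions are represented by their sequences of coefficients;
   in particular pseries_diffs is the coefficient sequence of the derivative. *)
Section GeneratingFunctions.
Variable R : realType.

Definition egf (A : graph_family) : R^nat := fun n => #|A n|%:R / n`!%:R.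

Definition egf_pointed (A : graph_family) : R^nat := fun n => n%:R * egf A n.

Definition cvg_radius (a : R^nat) : \bar R :=
  ereal_sup [set `|x|%:E | x in [set x : R | cvgn (pseries a x)]].

(* Value in [0, +oo] of a power series with nonnegative coefficients at a
   point of [0, +oo]. *)
Definition epseries (a : R^nat) (x : \bar R) : \bar R :=
  (\sum_(0 <= n <oo) (a n)%:E * x ^+ n)%E.

Definition subcritical (G : graph_family) : Prop :=
  let Cdot := egf_pointed (connected_subclass G) in
  let B' := pseries_diffs (egf (two_connected_subclass G)) in
  (epseries Cdot (cvg_radius Cdot) < cvg_radius B')%E.

End GeneratingFunctions.

(* Main.v *)
Require Import Defs.
From mathcomp Require Import all_boot all_order perm all_algebra ring lra zify.
Set Implicit Arguments.
Unset Strict Implicit.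
Unset Printing Implicit Defensive.

(** Combinatorics. Cutting graphs at a component or at a vertex gives, for the
    generating functions C, G, B' of the class, the identities G' = C' G and
    E' = D' E, D = B'(zE), where E = C' and D counts the graphs in which an
    additional unlabelled root vertex is not a cut vertex. Hence G = exp(C) and
    y = z E = C^. satisfies y = z phi(y) with phi = exp(B').

    Critical point. Let rho be the radius of y and tau = y(rho). For s below the
    radius of B' the partial sums of y at s/phi(s) stay below s, so that
    s/phi(s) <= rho = tau/phi(tau): subcriticality makes tau an interior maximum
    of s/phi(s), i.e. tau phi'(tau) = phi(tau). As phi(u) >= exp(u) coefficientwise,
    rho <= tau exp(-tau) <= 1/e.

    Asymptotics. By Lagrange inversion n y_n = [u^(n-1)] phi(u)^n, and
    p_k = phi_k tau^k / phi(tau) is a probability distribution of mean 1 with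
    finite third moment and p_0, p_1 > 0. So y_n rho^n = (tau/n) P(S_n = n-1) for a
    sum S_n of n independent copies, and a local limit theorem, proved by Fourier
    inversion and dominated convergence, gives y_n rho^n ~ K n^(-3/2). Finally
    n g_n = sum_k y_k g_(n-k) transfers this to g_n rho^n ~ K G(rho) n^(-5/2). *)

(** * Connected and biconnected sets of vertices *)

Section EdgeSets.
Variable T : finType.
Implicit Types (e f : {set {set T}}) (x y z r s v : T).
Implicit Types (A B R S V W X Y : {set T}).

(** Graphs are edge sets over an ambient finite type with the vertex set as a parameter, because
    every decomposition passes to subsets of the vertices; relabelling enters only to compare the
    final counts with the class. Each cut removes just the piece through a marked vertex, so no set
    partitions appear: exponentials come out as linear differential equations, and uniqueness of
    their formal solutions yields the equation of y. Series are composed only modulo powers of the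
    variable. Analytic information on y and phi is drawn from inequalities between polynomials with
    nonnegative coefficients, evaluated at nonnegative points. In particular tau phi'(tau) =
    phi(tau) is obtained from s <= rho phi(s) on both sides of s = tau, not by differentiating the
    equation of y. Subcriticality is what makes points s > tau available, and it gives p exponential
    moments. Aperiodicity, without which the characteristic function would reach modulus 1 away from
    0, comes from the link-graph: it makes the linear coefficient of phi at least 1, so that p_0 and
    p_1 are both positive. *)

Definition edge_closed e V A :=
  [forall x in A, forall y in V, ([set x; y] \in e) ==> (y \in A)].

(* A graph with vertex set V is given by its edge set e, of which only the part
   inside V matters. Connectivity is expressed by cuts: no proper nonempty subset
   of V is closed under adjacency. *)
Definition conn_on e V :=
  (V != set0) && [forall A : {set T},
    [&& A \subset V, A != set0 & edge_closed e V A] ==> (A == V)].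

(** A union instead of reachability by paths: maximality is immediate, and connectedness is what has
    to be proved. For x outside V the union is empty. *)
Definition component e V x :=
  \bigcup_(X : {set T} | [&& X \subset V, conn_on e X & x \in X]) X.

(** Two adjacent vertices qualify because singletons are connected, so the convention on the
    link-graph needs no separate case. *)
Definition biconn e S :=
  [&& 1 < #|S|, conn_on e S & [forall v in S, conn_on e (S :\ v)]].

Definition block_on e V S := maxset (fun X => (X \subset V) && biconn e X) S.

Definition pairs V : {set {set T}} := [set a : {set T} | (a \subset V) && (#|a| == 2)].

Lemma edge_closedP e V A :
  reflect (forall x y, x \in A -> y \in V -> [set x; y] \in e -> y \in A)
          (edge_closed e V A).
Proof.
apply: (iffP idP) => [/forall_inP h x y xA yV xye|h].
  by move: (h x xA) => /forall_inP /(_ y yV) /implyP /(_ xye).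
apply/forall_inP => x xA; apply/forall_inP => y yV; apply/implyP; exact: h.
Qed.

Lemma conn_onP e V :
  reflect (V != set0 /\ forall A, A \subset V -> A != set0 ->
             edge_closed e V A -> A = V)
          (conn_on e V).
Proof.
apply: (iffP andP) => -[V0 h]; split => //.
  move=> A AV A0 cA; apply/eqP; move/forallP: h => /(_ A) /implyP; apply.
  by rewrite AV A0.
by apply/forallP => A; apply/implyP => /and3P[AV A0 cA]; apply/eqP; exact: h.
Qed.

Lemma conn_on1 e x : conn_on e [set x].
Proof.
apply/conn_onP; split; first by apply/set0Pn; exists x; rewrite inE.
move=> A; rewrite subset1 => /orP[/eqP ->//|/eqP ->]; by rewrite eqxx.
Qed.

Lemma edge_closedD e V A : edge_closed e V A -> edge_closed e V (V :\: A).
Proof.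
move=> /edge_closedP cA; apply/edge_closedP => x y; rewrite !inE.
move=> /andP[xA xV] yV xye; rewrite yV andbT; apply: contra xA => yA.
by apply: (cA y) => //; rewrite setUC.
Qed.

Lemma conn_on_closed e V A X x : conn_on e X -> X \subset V ->
  edge_closed e V A -> x \in X -> x \in A -> X \subset A.
Proof.
move=> /conn_onP[_ cX] XV /edge_closedP cA xX xA.
have <- : A :&: X = X.
  apply: cX; first exact: subsetIr.
    by apply/set0Pn; exists x; rewrite inE xA.
  apply/edge_closedP => a b; rewrite !inE => /andP[aA aX] bX abe.
  by rewrite bX andbT; apply: (cA a) => //; exact: subsetP XV b bX.
exact: subsetIl.
Qed.

(** Replaces induction along a path: A is the property propagated along the edges inside X, starting
    from x. *)
Lemma edge_closed_conn e A X x : conn_on e X ->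
  (forall a b, a \in A -> a \in X -> b \in X -> [set a; b] \in e -> b \in A) ->
  x \in X -> x \in A -> X \subset A.
Proof.
move=> cX h xX xA; suff: X \subset A :&: X by move/subset_trans; apply; exact: subsetIl.
apply: (conn_on_closed cX (subxx _) _ xX); last by rewrite inE xA.
apply/edge_closedP => a b; rewrite !inE => /andP[aA aX] bX abe.
by rewrite bX andbT; apply: (h a).
Qed.

(** The alternative [x == y] lets one lemma cover gluing at a common vertex and joining across an
    edge. A closed part of the union absorbs X or Y once it meets it, and passes from one to the
    other through x and y. *)
Lemma conn_on_edgeU e X Y x y : conn_on e X -> conn_on e Y ->
  x \in X -> y \in Y -> (x == y) || ([set x; y] \in e) -> conn_on e (X :|: Y).
Proof.
move=> cX cY xX yY xy; apply/conn_onP; split.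
  by apply/set0Pn; exists x; rewrite inE xX.
move=> A AXY /set0Pn[a aA] /[dup] cA /edge_closedP clA.
have hX z : z \in X -> z \in A -> X \subset A.
  by move=> zX zA; exact: (conn_on_closed cX (subsetUl _ _) cA zX zA).
have hY z : z \in Y -> z \in A -> Y \subset A.
  by move=> zY zA; exact: (conn_on_closed cY (subsetUr _ _) cA zY zA).
have xy1 : (x \in A) -> (y \in A).
  move=> xA; case/orP: xy => [/eqP <- //|xye].
  by apply: (clA x) => //; rewrite inE yY orbT.
have xy2 : (y \in A) -> (x \in A).
  move=> yA; case/orP: xy => [/eqP -> //|xye].
  by apply: (clA y) => //; rewrite ?inE ?xX // setUC.
apply/eqP; rewrite eqEsubset AXY subUset /=.
have := subsetP AXY a aA; rewrite inE => /orP[aX|aY].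
  have XA := hX a aX aA; rewrite XA /=; apply: (hY y yY); apply: xy1.
  exact: (subsetP XA).
have YA := hY a aY aA; rewrite YA andbT; apply: (hX x xX); apply: xy2.
exact: (subsetP YA).
Qed.

Lemma conn_onU e X Y x : conn_on e X -> conn_on e Y ->
  x \in X -> x \in Y -> conn_on e (X :|: Y).
Proof. by move=> cX cY xX xY; apply: (conn_on_edgeU cX cY xX xY); rewrite eqxx. Qed.

Lemma sub_conn_on e e' V :
  (forall x y, x \in V -> y \in V -> x != y -> [set x; y] \in e -> [set x; y] \in e') ->
  conn_on e V -> conn_on e' V.
Proof.
move=> h /conn_onP[V0 cV]; apply/conn_onP; split=> // A AV A0 /edge_closedP cA.
apply: cV => //; apply/edge_closedP => x y xA yV xye.
have [<- //|xy] := eqVneq x y.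
apply: (cA x) => //; apply: h => //; exact: (subsetP AV).
Qed.

Lemma eq_conn_on e e' V :
  (forall x y, x \in V -> y \in V -> x != y -> ([set x; y] \in e) = ([set x; y] \in e')) ->
  conn_on e V = conn_on e' V.
Proof. by move=> h; apply/idP/idP; apply: sub_conn_on => x y xV yV xy; rewrite h. Qed.

Lemma eq_biconn e e' V :
  (forall x y, x \in V -> y \in V -> x != y -> ([set x; y] \in e) = ([set x; y] \in e')) ->
  biconn e V = biconn e' V.
Proof.
move=> h; rewrite /biconn (eq_conn_on h); congr [&& _, _ & _].
apply: eq_forallb => v; congr (_ ==> _); apply: eq_conn_on => x y.
by rewrite !inE => /andP[_ xV] /andP[_ yV]; exact: h.
Qed.

Lemma set2_pairs V x y : ([set x; y] \in pairs V) = [&& x \in V, y \in V & x != y].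
Proof.
rewrite inE subUset !sub1set cards2 -andbA; by case: (x != y).
Qed.

Lemma pairsP V (a : {set T}) :
  reflect (exists x y, [/\ a = [set x; y], x \in V, y \in V & x != y]) (a \in pairs V).
Proof.
apply: (iffP idP) => [|[x [y [-> xV yV xy]]]]; last by rewrite set2_pairs xV yV.
rewrite inE => /andP[aV /cards2P[x [y [xy eqa]]]]; exists x, y.
by move: aV; rewrite eqa subUset !sub1set => /andP[xV yV].
Qed.

Lemma pairsS V W : V \subset W -> pairs V \subset pairs W.
Proof.
by move=> VW; apply/subsetP => a; rewrite !inE => /andP[/subset_trans->].
Qed.

Lemma component_sub e V x : component e V x \subset V.
Proof. by apply/bigcupsP => X /and3P[]. Qed.

Lemma mem_component e V x : x \in V -> x \in component e V x.
Proof.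
move=> xV; apply/bigcupP; exists [set x]; rewrite ?inE //.
by rewrite sub1set xV conn_on1 eqxx.
Qed.

Lemma component_max e V x X : X \subset V -> conn_on e X -> x \in X -> X \subset component e V x.
Proof. by move=> XV cX xX; apply: bigcup_sup; rewrite XV cX. Qed.

Lemma component_conn e V x : x \in V -> conn_on e (component e V x).
Proof.
move=> xV; apply/conn_onP; split; first by apply/set0Pn; exists x; exact: mem_component.
move=> A sAC /set0Pn[a aA] cA; apply/eqP; rewrite eqEsubset sAC /=.
have xA : x \in A.
  have /bigcupP[X /and3P[XV cX xX] aX] := subsetP sAC a aA.
  apply: (subsetP (conn_on_closed cX _ cA aX aA)) => //; exact: component_max.
apply/bigcupsP => X /and3P[XV cX xX].
apply: (conn_on_closed cX _ cA xX xA); exact: component_max.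
Qed.

Lemma component_closed e V x : x \in V -> edge_closed e V (component e V x).
Proof.
move=> xV; apply/edge_closedP => a b aC bV abe.
have cC := component_conn e xV.
have: [set b] :|: component e V x \subset component e V x.
  apply: component_max; first by rewrite subUset sub1set bV component_sub.
    apply: (conn_on_edgeU (conn_on1 _ _) cC (set11 b) aC).
    by rewrite setUC abe orbT.
  by rewrite inE mem_component // orbT.
by rewrite subUset sub1set => /andP[].
Qed.

Lemma component_eq e V x X : X \subset V -> conn_on e X -> edge_closed e V X ->
  x \in X -> component e V x = X.
Proof.
move=> XV cX clX xX; have xV := subsetP XV x xX.
apply/eqP; rewrite eqEsubset component_max // andbT.
apply: (conn_on_closed (component_conn e xV) (component_sub _ _ _) clX _ xX).
exact: mem_component.
Qed.

Lemma component_same e V x y : x \in V -> y \in component e V x -> component e V y = component e V x.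
Proof.
move=> xV yC; apply: component_eq => //.
- exact: component_sub. - exact: component_conn. - exact: component_closed.
Qed.

Lemma biconn_gt1 e S : biconn e S -> 1 < #|S|. Proof. by case/and3P. Qed.
Lemma biconn_conn e S : biconn e S -> conn_on e S. Proof. by case/and3P. Qed.
Lemma biconnD1 e S v : biconn e S -> conn_on e (S :\ v).
Proof.
case/and3P=> _ cS /forall_inP h; have [|vS] := boolP (v \in S); first exact: h.
suff -> : S :\ v = S by [].
by apply/setP => x; rewrite !inE; case: eqP => // ->; rewrite (negbTE vS).
Qed.

Lemma biconnI e S : 1 < #|S| -> conn_on e S ->
  (forall v, v \in S -> conn_on e (S :\ v)) -> biconn e S.
Proof. by move=> S1 cS h; rewrite /biconn S1 cS; apply/forall_inP. Qed.

Lemma biconn_edge e x y : x != y -> [set x; y] \in e -> biconn e [set x; y].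
Proof.
move=> xy xye; apply: biconnI; first by rewrite cards2 xy.
  apply: (conn_on_edgeU (conn_on1 e x) (conn_on1 e y)); rewrite ?inE ?xye ?orbT //.
move=> v; rewrite !inE => /orP[] /eqP ->.
  rewrite setU1K ?inE //; exact: conn_on1.
rewrite setUC setU1K ?inE; [exact: conn_on1|by rewrite eq_sym].
Qed.

Lemma other_elem S v : 1 < #|S| -> exists2 x, x \in S & x != v.
Proof.
move=> S1; have : 0 < #|S :\ v|.
  by rewrite -ltnS (leq_trans S1) // (cardsD1 v S); case: (v \in S).
by case/card_gt0P => x; rewrite !inE => /andP[xv xS]; exists x.
Qed.

(* A minimal connected set attached to two vertices of a biconnected set S
   plays the role of a path (an ear) joining them. *)
Lemma ear e S X s1 s2 x1 x2 : biconn e S -> conn_on e X -> [disjoint S & X] ->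
  s1 \in S -> s2 \in S -> s1 != s2 -> x1 \in X -> x2 \in X ->
  [set s1; x1] \in e -> [set s2; x2] \in e ->
  exists2 Y : {set T}, (S \proper Y) && (Y \subset S :|: X) & biconn e Y.
Proof.
move=> bS cX dSX s1S s2S s12 x1X x2X e1 e2.
pose ok Y := [&& conn_on e Y, [exists x in Y, [set s1; x] \in e] &
                 [exists x in Y, [set s2; x] \in e]].
have okX : ok X.
  apply/and3P; split=> //; apply/exists_inP; [by exists x1|by exists x2].
have [Y /minsetP[okY minY] YX] := minset_exists (P := ok) okX.
have dSY : [disjoint S & Y] by apply: disjointWr dSX.
have cY : conn_on e Y by case/and3P: okY.
have /exists_inP[y1 y1Y ey1] : [exists x in Y, [set s1; x] \in e] by case/and3P: okY.
have /exists_inP[y2 y2Y ey2] : [exists x in Y, [set s2; x] \in e] by case/and3P: okY.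
have SnY z : z \in S -> z \notin Y.
  by move=> zS; move/disjoint_setI0/setP: dSY => /(_ z); rewrite !inE zS /= => ->.
have YnS z : z \in Y -> z \notin S by apply: contraL; exact: SnY.
exists (S :|: Y).
  rewrite setUS // andbT properE subsetUl /=.
  by apply/subsetPn; exists y1; rewrite ?inE ?y1Y ?orbT // YnS.
apply: biconnI.
- by apply: leq_trans (biconn_gt1 bS) _; exact: subset_leq_card (subsetUl _ _).
- by apply: (conn_on_edgeU (biconn_conn bS) cY s1S y1Y); rewrite ey1 orbT.
(* Deleting v in S leaves the rest of S connected, and s1 or s2 still ties it to Y. Deleting v in Y
   is the case that uses minimality. *)
move=> v; rewrite inE => /orP[vS|vY].
  have -> : (S :|: Y) :\ v = (S :\ v) :|: Y.
    rewrite setDUl; congr (_ :|: _); apply/setP => z; rewrite !inE.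
    by case: eqP => // ->; rewrite (negbTE (SnY _ vS)).
  have [s1v|s1v] := eqVneq s1 v.
    apply: (conn_on_edgeU (biconnD1 v bS) cY (x := s2) (y := y2)) => //.
      by rewrite !inE -s1v eq_sym s12.
    by rewrite ey2 orbT.
  apply: (conn_on_edgeU (biconnD1 v bS) cY (x := s1) (y := y1)) => //.
    by rewrite !inE s1v.
  by rewrite ey1 orbT.
have -> : (S :|: Y) :\ v = S :|: (Y :\ v).
  rewrite setDUl; congr (_ :|: _); apply/setP => z; rewrite !inE.
  by case: eqP => // ->; rewrite (negbTE (YnS _ vY)).
set Z := S :|: Y :\ v.
(* [A] is a side of a cut of Z that misses S, so it touches Y only at v *)
suff key A : A \subset Y :\ v -> edge_closed e Z A -> A = set0.
  apply/conn_onP; split; first by apply/set0Pn; exists s1; rewrite inE s1S.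
  move=> A AZ A0 cA; have [AS|/pred0Pn[a /= /andP[aA aS]]] := boolP [disjoint A & S].
    suff A0' : A = set0 by rewrite A0' eqxx in A0.
    apply: key => //; apply/subsetP => a aA; have := subsetP AZ a aA.
    by rewrite inE => /orP[aS|//]; move/disjoint_setI0/setP: AS => /(_ a); rewrite !inE aA aS.
  have SA : S \subset A.
    exact: (conn_on_closed (biconn_conn bS) (subsetUl _ _) cA aS aA).
  apply/eqP; rewrite eqEsubset AZ /= -setD_eq0; apply/eqP; apply: key.
    rewrite subDset; apply: (subset_trans (subxx Z)); rewrite /Z subUset.
    by rewrite (subset_trans SA (subsetUl _ _)) subsetUr.
  exact: edge_closedD.
move=> AY /edge_closedP cA; apply/eqP; apply/negPn/negP => /set0Pn[a aA].
have AvY z : z \in A -> z \in Y by move=> /(subsetP AY); rewrite inE => /andP[].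
have Anv z : z \in A -> z != v by move=> /(subsetP AY); rewrite !inE => /andP[].
have ZY z : z \in Y -> z != v -> z \in Z by rewrite !inE => -> ->; rewrite orbT.
have ZS z : z \in S -> z \in Z by rewrite !inE => ->.
(* A nonempty A could be removed from Y: the neighbours of s1 and s2 lie outside A, and what is left
   is connected through v. This contradicts minimality. *)
suff okYA : ok (Y :\: A).
  have := minY _ okYA (subsetDl _ _) => /setP /(_ a); rewrite !inE aA /= => /esym.
  by rewrite AvY.
have nbr s y : s \in S -> y \in Y -> [set s; y] \in e -> y \in Y :\: A.
  move=> sS yY sye; rewrite inE yY andbT; apply/negP => yA.
  have : s \in A by apply: (cA y) => //; [exact: ZS|rewrite setUC].
  by move/AvY; rewrite (negbTE (SnY _ sS)).
apply/and3P; split; last 2 first.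
- by apply/exists_inP; exists y1 => //; exact: (nbr s1).
- by apply/exists_inP; exists y2 => //; exact: (nbr s2).
(* An edge of Y leaving B would have to end in A; but A is closed in Z, so only v can be adjacent to
   A from outside, and v is not in B. *)
have key2 B : B \subset Y :\: A -> v \notin B -> edge_closed e (Y :\: A) B -> B = set0.
  move=> BY vB /edge_closedP cB; apply/eqP/negPn/negP => /set0Pn[b bB].
  have : Y \subset B.
    apply: (edge_closed_conn cY _ (_ : b \in Y)) => //; last first.
      by have := subsetP BY b bB; rewrite inE => /andP[].
    move=> p q pB pY qY pqe; have [qA|qA] := boolP (q \in A); last first.
      by apply: (cB p) => //; rewrite inE qA.
    have : p \in A.
      apply: (cA q) => //; last by rewrite setUC.
      by apply: ZY => //; apply: contraNneq vB => <-.
    by have := subsetP BY p pB; rewrite inE => /andP[/negbTE->].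
  by move/subsetP => /(_ v vY); rewrite (negbTE vB).
apply/conn_onP; split.
  by apply/set0Pn; exists y1; exact: (nbr s1).
move=> B BY B0 cB; have [vB|vB] := boolP (v \in B); last first.
  by rewrite (key2 B) // eqxx in B0.
apply/eqP; rewrite eqEsubset BY /= -setD_eq0; apply/eqP; apply: key2.
- exact: subsetDl.
- by rewrite inE vB.
- exact: edge_closedD.
Qed.

End EdgeSets.

(** * Decompositions of graphs with prescribed blocks *)

(** The map from e to (e :&: P, e :&: Q) is a bijection. All decompositions are counted through this
    product, with P and Q the possible edges of two pieces of a graph. *)
Lemma card_glue (U : finType) (P Q : {set U}) (p q : pred {set U}) : [disjoint P & Q] ->
  #|[set e : {set U} | [&& e \subset P :|: Q, p (e :&: P) & q (e :&: Q)]]| =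
  #|[set e : {set U} | (e \subset P) && p e]| * #|[set e : {set U} | (e \subset Q) && q e]|.
Proof.
move=> /disjoint_setI0 dPQ; rewrite -cardsX.
have capU (a b : {set U}) : a \subset P -> b \subset Q ->
    (a :|: b) :&: P = a /\ (a :|: b) :&: Q = b.
  move=> aP bQ; split; rewrite setIUl.
    rewrite (setIidPl aP); apply/setUidPl; apply: (subset_trans _ (sub0set a)).
    by rewrite -dPQ setIC setIS.
  rewrite (setIidPl bQ); apply/setUidPr; apply: (subset_trans _ (sub0set b)).
  by rewrite -dPQ setSI.
rewrite -(@card_in_imset _ _ (fun e : {set U} => (e :&: P, e :&: Q))).
  apply: eq_card => -[a b]; rewrite in_setX !inE /=; apply/imsetP/idP.
    by move=> [e]; rewrite inE => /and3P[_ pe qe] [-> ->]; rewrite !subsetIr pe qe.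
  move=> /andP[/andP[aP pa] /andP[bQ qb]]; have [eP eQ] := capU a b aP bQ.
  by exists (a :|: b); rewrite ?inE eP eQ // setUSS // pa qb.
move=> a b; rewrite !inE => /and3P[aPQ _ _] /and3P[bPQ _ _] [eP eQ].
by rewrite -(setIidPl aPQ) -(setIidPl bPQ) !setIUr eP eQ.
Qed.

Lemma card_fibers (U I : finType) (h : U -> I) (E : {set U}) (J : pred I) :
  (forall e, e \in E -> J (h e)) ->
  #|E| = \sum_(i | J i) #|[set e in E | h e == i]|.
Proof.
move=> hJ; rewrite -sum1_card (partition_big h J) //; apply: eq_bigr => i _.
by rewrite -sum1_card; apply: eq_bigl => e; rewrite inE.
Qed.

Section Counting.
Variables (T : finType) (K : {set {set T}} -> {set T} -> bool).
Hypothesis KI : forall (e e' : {set {set T}}) (S : {set T}),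
  (forall x y, x \in S -> y \in S -> x != y -> ([set x; y] \in e) = ([set x; y] \in e')) ->
  K e S = K e' S.
Implicit Types (e f : {set {set T}}) (x y z r s v : T).
Implicit Types (A B R S V W X Y : {set T}).

(** [K e S] stands for membership in the class of the graph induced on S; only the locality [KI] is
    used of it here. By block-stability, [all_blocks] will express membership of the whole graph. *)
Definition all_blocks e V := [forall S : {set T}, block_on e V S ==> K e S].

(* Every component contains exactly one vertex of R. *)
Definition rooted e V R := [forall x in V, #|component e V x :&: R| == 1].

Definition count_connected V :=
  #|[set e : {set {set T}} | (e \subset pairs V) && (all_blocks e V && conn_on e V)]|.
Definition count_family V := #|[set e : {set {set T}} | (e \subset pairs V) && all_blocks e V]|.
(* Connected graphs on W in which s is not a cut vertex. *)
Definition count_noncut_root s W :=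
  #|[set e : {set {set T}} | (e \subset pairs W) &&
      [&& all_blocks e W, conn_on e W & conn_on e (W :\ s)]]|.
Definition count_biconn S :=
  #|[set e : {set {set T}} | (e \subset pairs S) && (all_blocks e S && biconn e S)]|.
Definition count_forest V R :=
  #|[set e : {set {set T}} | (e \subset pairs V) && (all_blocks e V && rooted e V R)]|.

Lemma block_onP e V S :
  reflect [/\ S \subset V, biconn e S &
             forall X, X \subset V -> biconn e X -> S \subset X -> X = S]
          (block_on e V S).
Proof.
apply: (iffP maxsetP) => [[/andP[SV bS] h]|[SV bS h]]; split=> //.
- by move=> X XV bX; apply: h; rewrite XV.
- by rewrite SV.
- by move=> X /andP[XV bX]; apply: h.
Qed.

Lemma all_blocksP e V :
  reflect (forall S, block_on e V S -> K e S) (all_blocks e V).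
Proof. by apply: (iffP forallP) => h S; apply/implyP; exact: h. Qed.

(** Source of the restriction lemmas, which bring conditions on e into the form that [card_glue]
    expects, namely conditions on the part of e inside each piece. *)
Lemma in_restrict e V x y : x \in V -> y \in V -> x != y ->
  ([set x; y] \in e :&: pairs V) = ([set x; y] \in e).
Proof. by move=> xV yV xy; rewrite in_setI set2_pairs xV yV xy !andbT. Qed.

Lemma eq_block_on e e' V S :
  (forall x y, x \in V -> y \in V -> x != y -> ([set x; y] \in e) = ([set x; y] \in e')) ->
  block_on e V S = block_on e' V S.
Proof.
move=> h; rewrite /block_on; apply: maxset_eq => X.
have [XV|//] := boolP (X \subset V).
by apply: eq_biconn => x y xX yX; apply: h; apply: (subsetP XV).
Qed.

Lemma eq_all_blocks e e' V :
  (forall x y, x \in V -> y \in V -> x != y -> ([set x; y] \in e) = ([set x; y] \in e')) ->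
  all_blocks e V = all_blocks e' V.
Proof.
move=> h; apply: eq_forallb => S; rewrite (eq_block_on S h).
have [/block_onP[SV _ _]|//] := boolP (block_on e' V S).
by congr (_ ==> _); apply: KI => x y xS yS; apply: h; apply: (subsetP SV).
Qed.

Lemma all_blocks_restrict e V : all_blocks (e :&: pairs V) V = all_blocks e V.
Proof. by apply: eq_all_blocks; exact: in_restrict. Qed.

Lemma conn_on_restrict e V : conn_on (e :&: pairs V) V = conn_on e V.
Proof. by apply: eq_conn_on; exact: in_restrict. Qed.

Lemma conn_on_restrictS e V A : A \subset V -> conn_on (e :&: pairs V) A = conn_on e A.
Proof.
by move=> /subsetP AV; apply: eq_conn_on => x y xA yA; apply: in_restrict; exact: AV.
Qed.

Lemma biconn_restrict e V : biconn (e :&: pairs V) V = biconn e V.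
Proof. by apply: eq_biconn; exact: in_restrict. Qed.

Lemma eq_component e e' V x :
  (forall x y, x \in V -> y \in V -> x != y -> ([set x; y] \in e) = ([set x; y] \in e')) ->
  component e V x = component e' V x.
Proof.
move=> h; apply: eq_bigl => X; have [XV|//] := boolP (X \subset V).
rewrite /=; congr (_ && _); apply: eq_conn_on => a b aX bX; apply: h; exact: (subsetP XV).
Qed.

(** After deletion of the vertex that A and B may share, S would still be connected but would have
    to pass from A to B without an edge. *)
Lemma biconn_separated e A B S : #|A :&: B| <= 1 ->
  (forall a b, a \in A -> a \notin B -> b \in B -> b \notin A -> [set a; b] \notin e) ->
  biconn e S -> S \subset A :|: B -> (S \subset A) || (S \subset B).
Proof.
move=> AB1 sep bS SAB; apply/orP.
have [|/subsetPn[b bS' bA]] := boolP (S \subset A); first by left.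
have [|/subsetPn[a aS aB]] := boolP (S \subset B); first by right.
exfalso.
have bB : b \in B by have := subsetP SAB b bS'; rewrite inE (negbTE bA).
have aA : a \in A by have := subsetP SAB a aS; rewrite inE (negbTE aB) orbF.
have [X cX [aX bX XS dX]] : exists2 X, conn_on e X &
    [/\ a \in X, b \in X, X \subset S & forall z, z \in X -> z \in A -> z \notin B].
  have [AB0|/set0Pn[w wAB]] := eqVneq (A :&: B) set0.
    exists S; first exact: biconn_conn; split=> // z _ zA; apply/negP => zB.
    by move/setP: AB0 => /(_ z); rewrite !inE zA zB.
  exists (S :\ w); first exact: biconnD1; split.
  - by rewrite !inE aS andbT; apply: contraNneq aB => ->; move: wAB; rewrite inE => /andP[].
  - by rewrite !inE bS' andbT; apply: contraNneq bA => ->; move: wAB; rewrite inE => /andP[].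
  - exact: subsetDl.
  - move=> z; rewrite !inE => /andP[zw _] zA; apply: contra zw => zB.
    apply/eqP; move/card_le1P: AB1 => /(_ w wAB z); rewrite inE zA zB inE => /esym/eqP.
    done.
have : X \subset A.
  apply: (edge_closed_conn cX _ aX aA) => p q pA pX qX pqe; apply/negPn/negP => qA.
  have qB : q \in B by have := subsetP SAB q (subsetP XS q qX); rewrite inE (negbTE qA).
  by have := sep p q pA (dX p pX pA) qB qA; rewrite pqe.
by move/subsetP => /(_ b bX); rewrite (negbTE bA).
Qed.

(** A biconnected set lies in A or in B, and never in both, as it has two vertices; so the blocks of
    the union are those of A and those of B. *)
Lemma all_blocks_split e A B : #|A :&: B| <= 1 ->
  (forall a b, a \in A -> a \notin B -> b \in B -> b \notin A -> [set a; b] \notin e) ->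
  all_blocks e (A :|: B) = all_blocks e A && all_blocks e B.
Proof.
move=> AB1 sep; have sep' := biconn_separated AB1 sep.
apply/all_blocksP/andP => [h|[/all_blocksP hA /all_blocksP hB] S].
  split; apply/all_blocksP => S /block_onP[SX bS mS]; apply: h; apply/block_onP; split=> //.
  - exact: (subset_trans SX (subsetUl _ _)).
  - move=> X XAB bX SsX; case/orP: (sep' X bX XAB) => XX; first exact: mS.
    have : #|S| <= 1 by apply: leq_trans AB1; apply: subset_leq_card;
      rewrite subsetI SX (subset_trans SsX).
    by rewrite leqNgt (biconn_gt1 bS).
  - exact: (subset_trans SX (subsetUr _ _)).
  - move=> X XAB bX SsX; case/orP: (sep' X bX XAB) => XX; last exact: mS.
    have : #|S| <= 1 by apply: leq_trans AB1; apply: subset_leq_card;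
      rewrite subsetI SX (subset_trans SsX).
    by rewrite leqNgt (biconn_gt1 bS).
move=> /block_onP[SAB bS mS]; case/orP: (sep' S bS SAB) => SX.
  apply: hA; apply/block_onP; split=> // X XA bX; apply: mS => //.
  exact: (subset_trans XA (subsetUl _ _)).
apply: hB; apply/block_onP; split=> // X XA bX; apply: mS => //.
exact: (subset_trans XA (subsetUr _ _)).
Qed.

Lemma pairsU_separated e A B : e \subset pairs A :|: pairs B ->
  forall a b, a \in A -> a \notin B -> b \in B -> b \notin A -> [set a; b] \notin e.
Proof.
move=> eAB a b aA aB bB bA; apply/negP => /(subsetP eAB).
by rewrite in_setU !set2_pairs (negbTE aB) (negbTE bA) andbF.
Qed.

Lemma pairs_disjoint A B : #|A :&: B| <= 1 -> [disjoint pairs A & pairs B].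
Proof.
move=> AB1; rewrite -setI_eq0; apply/eqP/setP => a; rewrite !inE.
apply/negP => /andP[/andP[aA a2] /andP[aB _]].
have : #|a| <= 1 by apply: leq_trans AB1; apply: subset_leq_card; rewrite subsetI aA.
by rewrite (eqP a2).
Qed.

Lemma setDC_cap1 V A : #|A :&: (V :\: A)| <= 1.
Proof.
suff -> : A :&: (V :\: A) = set0 by rewrite cards0.
by apply/setP => z; rewrite !inE; case: (z \in A).
Qed.

(** Puts the fibre over A into the product form needed for [card_glue]. *)
Lemma component_split e V A x : e \subset pairs V -> A \subset V -> x \in A ->
  (component e V x == A) =
  (e \subset pairs A :|: pairs (V :\: A)) && conn_on e A.
Proof.
move=> eV AV xA; have xV := subsetP AV x xA; apply/eqP/andP => [<-|[es cA]].
  split; last exact: component_conn.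
  have /edge_closedP cl := component_closed e xV.
  apply/subsetP => a ae; have /pairsP[p [q [eqa pV qV pq]]] := subsetP eV a ae.
  rewrite eqa in_setU !set2_pairs pq !andbT !in_setD pV qV !andbT.
  have [pC|pC] /= := boolP (p \in component e V x).
    by rewrite (cl p) // -eqa.
  by apply: contra pC => qC; apply: (cl q) => //; rewrite setUC -eqa.
apply: component_eq => //; apply/edge_closedP => a b aA bV abe.
have := subsetP es _ abe; rewrite in_setU !set2_pairs !inE aA /=.
by rewrite orbF => /andP[].
Qed.

(** The component of the marked vertex x is split off; with x not counted as a label this is G' = C'
    G. *)
Lemma count_family_rec V x : x \in V ->
  count_family V = \sum_(A : {set T} | (A \subset V) && (x \in A)) count_connected A * count_family (V :\: A).
Proof.
move=> xV; rewrite /count_family (card_fibers (h := fun e => component e V x)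
  (J := fun A => (A \subset V) && (x \in A))); last first.
  by move=> e _ /=; rewrite component_sub mem_component.
apply: eq_bigr => A /andP[AV xA].
have dAB := pairs_disjoint (setDC_cap1 V A).
rewrite /count_connected -(card_glue (fun e => all_blocks e A && conn_on e A)
  (fun e => all_blocks e (V :\: A)) dAB); apply: eq_card => e; rewrite !inE.
rewrite !all_blocks_restrict conn_on_restrict.
have PV : pairs A :|: pairs (V :\: A) \subset pairs V.
  by rewrite subUset !pairsS // subsetDl.
have [eV|eV] := boolP (e \subset pairs V); last first.
  symmetry; apply/negbTE; apply: contra eV => /andP[eAB _].
  exact: subset_trans eAB PV.
rewrite component_split //.
have [eAB|] /= := boolP (e \subset pairs A :|: pairs (V :\: A)); last by rewrite andbF.
have VAB : V = A :|: (V :\: A) by rewrite -[LHS](setID V A) (setIidPr AV).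
rewrite [in LHS]VAB (all_blocks_split (setDC_cap1 V A) (pairsU_separated eAB)).
by rewrite andbAC.
Qed.

(** A is the component of x after deletion of s. In the graph on A and s the vertex s is no cut
    vertex, and the rest, which keeps s, is connected. With s unlabelled and x marked this is E' =
    D' E. *)
Lemma count_connected_rec W s x : s \in W -> x \in W -> x != s ->
  count_connected W = \sum_(A : {set T} | (A \subset W :\ s) && (x \in A)) count_noncut_root s (s |: A) * count_connected (W :\: A).
Proof.
move=> sW xW xs; have xV : x \in W :\ s by rewrite !inE xs.
rewrite {1}/count_connected (card_fibers (h := fun e => component e (W :\ s) x)
  (J := fun A => (A \subset W :\ s) && (x \in A))); last first.
  by move=> e _ /=; rewrite component_sub mem_component.
apply: eq_bigr => A /andP[AV xA].
have AW : A \subset W by apply: subset_trans AV (subsetDl _ _).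
have sA : s \notin A by apply/negP => /(subsetP AV); rewrite !inE eqxx.
have sB : s \in W :\: A by rewrite inE sA.
have cap1 : #|(s |: A) :&: (W :\: A)| <= 1.
  rewrite setIUl [A :&: _](_ : _ = set0) ?setU0; last first.
    by apply/setP => z; rewrite !inE; case: (z \in A).
  by apply: leq_trans (subset_leq_card (subsetIl _ _)) _; rewrite cards1.
have VAB : W = (s |: A) :|: (W :\: A).
  apply/setP => z; rewrite !inE; have [->|] := eqVneq z s; first by rewrite sW.
  by have [/(subsetP AW)|] := boolP (z \in A).
have dAB := pairs_disjoint cap1.
have PV : pairs (s |: A) :|: pairs (W :\: A) \subset pairs W.
  by rewrite subUset !pairsS ?subsetDl // subUset sub1set sW.
rewrite /count_noncut_root {1}/count_connected setU1K //.
rewrite -(card_glue (fun e => [&& all_blocks e (s |: A), conn_on e (s |: A) & conn_on e A])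
  (fun e => all_blocks e (W :\: A) && conn_on e (W :\: A)) dAB).
apply: eq_card => e; rewrite !inE.
rewrite !all_blocks_restrict !conn_on_restrict conn_on_restrictS ?subsetUr //.
have [eW|eW] := boolP (e \subset pairs W); last first.
  symmetry; apply/negbTE; apply: contra eW => /andP[eAB _].
  exact: subset_trans eAB PV.
have inW z y : [set z; y] \in e -> (z \in W) && (y \in W).
  by move=> /(subsetP eW); rewrite set2_pairs => /and3P[-> ->].
apply/idP/idP.
  move=> /andP[/andP[_ /andP[abW cW]] /eqP compA].
  have cA : conn_on e A by rewrite -compA component_conn.
  (* Edges from A lead to A or to s, since A is a component of the graph without s. *)
  have clA : forall a b, a \in A -> [set a; b] \in e -> b \in s |: A.
    move=> a b aA abe; rewrite !inE; have [//|bs /=] := eqVneq b s.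
    have /edge_closedP := component_closed e xV; rewrite compA => /(_ a b aA).
    by apply => //; rewrite !inE bs; case/andP: (inW _ _ abe).
  have eAB : e \subset pairs (s |: A) :|: pairs (W :\: A).
    apply/subsetP => a ae; have /pairsP[p [q [eqa pV qV pq]]] := subsetP eW a ae.
    rewrite eqa in_setU !set2_pairs pq !andbT !in_setD pV qV !andbT.
    have [pA|pA] := boolP (p \in A).
      by rewrite (clA p q) // -?eqa // inE pA orbT.
    have [qA|qA] := boolP (q \in A); last by rewrite orbT.
    by rewrite (clA q p) // -?eqa // ?[[set q; p]]setUC -?eqa // !inE qA orbT.
  have sep := pairsU_separated eAB.
  have : all_blocks e ((s |: A) :|: (W :\: A)) by rewrite -VAB.
  rewrite (all_blocks_split cap1 sep) => /andP[-> ->].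
  rewrite eAB cA andbT /=; apply/andP; split.
    (* Without an edge from A to s, the set A would be closed in the connected set W and yet miss
       s. *)
    have [p pA spe] : exists2 p, p \in A & [set p; s] \in e.
      have [/exists_inP //|] := boolP [exists p in A, [set p; s] \in e].
      rewrite negb_exists_in => /forall_inP nos; exfalso.
      case/conn_onP: cW => _ /(_ A AW) AeW.
      have := sA; rewrite AeW ?sW //; first by apply/set0Pn; exists x.
      apply/edge_closedP => a b aA _ abe.
      have := clA a b aA abe; rewrite !inE => /orP[/eqP bs|//].
      by have := nos a aA; rewrite -bs abe.
    apply: (conn_on_edgeU (conn_on1 e s) cA (set11 s) pA).
    by rewrite setUC spe orbT.
  have nox a b : a \in W :\: A -> a != s -> b \in W -> [set a; b] \in e -> b \in W :\: A.
    rewrite !inE => /andP[aA aW] as_ bW abe; rewrite bW andbT.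
    apply/negP => bA; have := clA b a bA; rewrite setUC => /(_ abe).
    by rewrite !inE (negbTE as_) (negbTE aA).
  (* A closed part of the rest that misses s is closed in W, since in the rest only s can have
     neighbours in A. *)
  have key X : X \subset W :\: A -> s \notin X -> edge_closed e (W :\: A) X -> X = set0.
    move=> XB sX /edge_closedP clX; apply/eqP/negPn/negP => X0.
    case/conn_onP: cW => _ /(_ X (subset_trans XB (subsetDl _ _)) X0) XW.
    have := sX; rewrite XW ?sW //; apply/edge_closedP => a b aX bW abe.
    apply: (clX a) => //; apply: (nox a) => //; first exact: (subsetP XB).
    by apply: contraNneq sX => <-.
  apply/conn_onP; split; first by apply/set0Pn; exists s.
  move=> X XB X0 clX; have [sX|sX] := boolP (s \in X); last first.
    by rewrite (key X) // eqxx in X0.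
  apply/eqP; rewrite eqEsubset XB /= -setD_eq0; apply/eqP; apply: key.
  - exact: subsetDl. - by rewrite inE sX. - exact: edge_closedD.
move=> /andP[eAB /andP[/and3P[abA cA' cA] /andP[abB cB]]].
have sep := pairsU_separated eAB.
rewrite /= [in all_blocks e W]VAB (all_blocks_split cap1 sep) abA abB /=.
have -> : conn_on e W.
  by rewrite VAB; apply: (conn_onU cA' cB (x := s)); rewrite ?inE ?eqxx // sA.
apply/eqP; apply: component_eq => //; apply/edge_closedP => a b aA.
rewrite !inE => /andP[bs bW] /(subsetP eAB); rewrite in_setU !set2_pairs !inE aA (negbTE bs).
by rewrite orbT orbF /= => /andP[].
Qed.

(** Removes the component A of one root r; iterated over m roots this produces the power E^m. *)
Lemma count_forest_rec V R r : r \in R -> R \subset V ->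
  count_forest V R = \sum_(A : {set T} | (A \subset V) && (A :&: R == [set r]))
              count_connected A * count_forest (V :\: A) (R :\ r).
Proof.
move=> rR RV; have rV := subsetP RV r rR.
rewrite {1}/count_forest (card_fibers (h := fun e => component e V r)
  (J := fun A => (A \subset V) && (A :&: R == [set r]))); last first.
  move=> e; rewrite inE => /and3P[_ _ /forall_inP /(_ r rV) /cards1P[z zE]] /=.
  rewrite component_sub /=.
  have : r \in component e V r :&: R by rewrite inE rR mem_component.
  by rewrite zE inE => /eqP ->.
apply: eq_bigr => A /andP[AV /eqP AR].
have rA : r \in A by have := set11 r; rewrite -AR inE => /andP[].
have dAB := pairs_disjoint (setDC_cap1 V A).
rewrite /count_connected /count_forest -(card_glue (fun e => all_blocks e A && conn_on e A)
  (fun e => all_blocks e (V :\: A) && rooted e (V :\: A) (R :\ r)) dAB).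
apply: eq_card => e; rewrite !inE.
rewrite !all_blocks_restrict conn_on_restrict.
have -> : rooted (e :&: pairs (V :\: A)) (V :\: A) (R :\ r) =
          rooted e (V :\: A) (R :\ r).
  by apply: eq_forallb => x; rewrite (eq_component (e' := e)) //; exact: in_restrict.
have PV : pairs A :|: pairs (V :\: A) \subset pairs V.
  by rewrite subUset !pairsS // subsetDl.
have [eV|eV] := boolP (e \subset pairs V); last first.
  symmetry; apply/negbTE; apply: contra eV => /andP[eAB _].
  exact: subset_trans eAB PV.
have csplit := component_split eV AV rA; rewrite csplit.
have [eAB|] /= := boolP (e \subset pairs A :|: pairs (V :\: A)); last by rewrite andbF.
have VAB : V = A :|: (V :\: A) by rewrite -[LHS](setID V A) (setIidPr AV).
rewrite [in all_blocks e V]VAB (all_blocks_split (setDC_cap1 V A) (pairsU_separated eAB)).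
have [cA|] := boolP (conn_on e A); last by rewrite !andbF.
rewrite !andbT -!andbA; congr [&& _, _ & _].
move: csplit; rewrite eAB cA /= => /eqP compA.
(* Removing one component leaves the others unchanged, so the remaining forest is rooted at R
   without r. *)
have compB x : x \in V :\: A -> component e (V :\: A) x = component e V x.
  rewrite inE => /andP[xA xV]; apply: component_eq.
  - rewrite subsetD component_sub /= -setI_eq0; apply/eqP/setP => z; rewrite !inE.
    apply/negP => /andP[zC]; rewrite -compA => zr.
    have := component_same xV zC; rewrite (component_same rV zr) compA => AE.
    by have := mem_component e xV; rewrite -AE (negbTE xA).
  - exact: component_conn.
  - apply/edge_closedP => a b aC; rewrite inE => /andP[_ bV].
    by move/edge_closedP: (component_closed e xV); apply.
  - exact: mem_component.
have rC x : x \in V -> x \notin A -> r \notin component e V x.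
  move=> xV; apply: contra => rC; rewrite -compA (component_same xV rC).
  exact: mem_component.
have RD x : x \in V -> x \notin A ->
    component e V x :&: (R :\ r) = component e V x :&: R.
  move=> xV xA; rewrite setIDA; apply/setDidPl; rewrite disjoint_sym disjoints1.
  by rewrite inE (negbTE (rC x xV xA)).
apply/forall_inP/forall_inP => h x.
  by move=> xB; rewrite compB //; move: xB; rewrite inE => /andP[xA xV]; rewrite RD // h.
move=> xV; have [xA|xA] := boolP (x \in A).
  by rewrite (component_same rV) ?compA // AR cards1.
by rewrite -RD // -compB ?inE ?xA //; apply: h; rewrite inE xA.
Qed.

Lemma count_forest0 V : count_forest V set0 = (V == set0).
Proof.
have [->|/set0Pn[x xV]] := eqVneq V set0; last first.
  apply/eqP; rewrite cards_eq0; apply/eqP/setP => e; rewrite !inE.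
  apply/negP => /and3P[_ _ /forall_inP /(_ x xV)]; by rewrite setI0 cards0.
rewrite /count_forest (_ : [set e | _] = [set set0]) ?cards1 //; apply/setP => e; rewrite !inE.
have P0 : pairs (set0 : {set T}) = set0.
  apply/setP => a; rewrite !inE subset0; apply/negP => /andP[/eqP ->].
  by rewrite cards0.
rewrite P0 subset0; have [->|//] := eqVneq e set0; rewrite /=; apply/andP; split.
  apply/all_blocksP => S /block_onP[]; rewrite subset0 => /eqP ->.
  by move/biconn_gt1; rewrite cards0.
by apply/forall_inP => x; rewrite inE.
Qed.


Lemma conn_on_full e V A x : conn_on e V -> A \subset V -> x \in A ->
  (forall a b, a \in A -> b \in V -> [set a; b] \in e -> b \in A) -> A = V.
Proof.
move=> /conn_onP[_ cV] AV xA h; apply: cV => //; first by apply/set0Pn; exists x.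
by apply/edge_closedP.
Qed.

(** * The block of a root that is not a cut vertex *)

Section RootBlock.
Variables (e : {set {set T}}) (W S : {set T}) (s : T).
Let V := W :\ s.
Let R := S :\ s.
(** The possible edges of the hanging forest. When s is not a cut vertex, no edge at s leaves its
    block S, so these edges can stay inside V. *)
Let Q := pairs V :\: pairs S.
Let f := e :&: Q.
Hypotheses (sS : s \in S) (SW : S \subset W).

Let RV : R \subset V. Proof. exact: setSD. Qed.
Let RS : R \subset S. Proof. exact: subsetDl. Qed.
Let VW : V \subset W. Proof. exact: subsetDl. Qed.
Let in_R x : x \in V -> (x \in R) = (x \in S).
Proof. by rewrite !inE => /andP[-> _]. Qed.

Let in_f x y : ([set x; y] \in f) =
  [&& [set x; y] \in e, x \in V, y \in V, x != y & ~~ ((x \in S) && (y \in S))].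
Proof.
rewrite /f /Q in_setI in_setD !set2_pairs.
by case: (x != y); case: (x \in V); case: (y \in V); case: (x \in S);
  case: (y \in S); rewrite ?andbT ?andbF.
Qed.

Let f_e x y : [set x; y] \in f -> [set x; y] \in e.
Proof. by rewrite in_f => /and5P[]. Qed.

(* Let S be the block of the root s in a graph on W in which s is not a cut
   vertex. Deleting the edges inside S leaves a forest of graphs hanging from the
   vertices of S other than s; conversely every such forest can be glued to S. *)
Lemma maximal_block_rooted : e \subset pairs W -> conn_on e W -> conn_on e V ->
  block_on e W S -> e \subset pairs S :|: Q /\ rooted f V R.
Proof.
move=> eW cW cV /block_onP[_ bS mS].
pose U := W :\: S.
have UW : U \subset W by exact: subsetDl.
have UV : U \subset V.
  by apply/subsetP => x; rewrite !inE => /andP[xS ->]; rewrite andbT; apply: contraNneq xS => ->.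
(* Two different attachments of one component of U would provide an ear extending the maximal
   biconnected set S. *)
have nbr x p q a b : x \in U -> p \in component e U x -> q \in component e U x ->
    a \in S -> b \in S -> [set a; p] \in e -> [set b; q] \in e -> a = b.
  move=> xU pC qC aS bS' ape bqe; apply/eqP/negPn/negP => ab.
  have dSC : [disjoint S & component e U x].
    rewrite disjoint_sym; apply: (disjointWl (component_sub _ _ _)).
    by rewrite -setI_eq0; apply/eqP/setP => z; rewrite /U !inE; case: (z \in S); rewrite ?andbF.
  have [Y /andP[SY YSC] bY] :=
    ear bS (component_conn e xU) dSC aS bS' ab pC qC ape bqe.
  have YW : Y \subset W.
    by apply: (subset_trans YSC); rewrite subUset SW (subset_trans (component_sub _ _ _)).
  by have SsY := proper_sub SY; move: SY; rewrite (mS Y YW bY) ?properxx.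
(* If s had a neighbour x outside S, then s would be the only attachment of the component of x; this
   component would fill the connected set V, leaving no room for the other vertices of S. *)
have nos x : x \in U -> [set s; x] \notin e.
  move=> xU; apply/negP => sxe.
  have xC := mem_component e xU.
  have CU := component_sub e U x.
  have CV : component e U x = V.
    apply: (conn_on_full cV (subset_trans CU UV) xC) => a b aC bV abe; have [bS'|bS'] := boolP (b \in S).
      have : s = b by apply: (nbr x x a) => //; rewrite setUC.
      by move=> sb; move: bV; rewrite -sb !inE eqxx.
    have /edge_closedP := component_closed e xU; move=> /(_ a b aC); apply=> //.
    by rewrite inE bS'; exact: (subsetP VW).
  have [r rS rs] := other_elem s (biconn_gt1 bS).
  have : r \in component e U x by rewrite CV !inE rs (subsetP SW).
  by move/(subsetP CU); rewrite inE rS.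
have eSQ x y : [set x; y] \in e -> (x \in S) && (y \in S) || ([set x; y] \in f).
  move=> xye; rewrite in_f xye /=.
  have := subsetP eW _ xye; rewrite set2_pairs => /and3P[xW yW xy].
  have [//|nS] := boolP ((x \in S) && (y \in S)); rewrite xy !inE xW yW /= !andbT.
  have [xs|_] := eqVneq x s.
    move: xye nS; rewrite xs sS /= => sye yS.
    by have /nos : y \in U; [rewrite /U inE yS|rewrite sye].
  have [ys|//] := eqVneq y s.
  move: xye nS; rewrite ys sS andbT setUC => sxe xS.
  by have /nos : x \in U; [rewrite /U inE xS|rewrite sxe].
split.
  apply/subsetP => a ae; have /pairsP[x [y [eqa xW yW xy]]] := subsetP eW a ae.
  have := ae; rewrite eqa => /eSQ /orP[/andP[xS yS]|].
    by rewrite in_setU set2_pairs xS yS xy.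
  by rewrite !in_setU in_setI => /andP[_ ->]; rewrite orbT.
apply/forall_inP => x xV; pose Y := component f V x.
have YV : Y \subset V by exact: component_sub.
have clY : edge_closed f V Y by exact: component_closed.
(* A component without root would be closed in W and miss s, against connectedness of W. *)
have [|/set0Pn[r]] := eqVneq (Y :&: R) set0.
  move=> YR; exfalso; have YW : Y = W.
    apply: (conn_on_full cW (subset_trans YV VW) (mem_component f xV)) => a b aY bW abe.
    have aS : a \notin S.
      rewrite -in_R; last exact: (subsetP YV); apply/negP => aR.
      by move/setP: YR => /(_ a); rewrite in_setI aY aR inE.
    have := eSQ _ _ abe; rewrite (negbTE aS) /= => abf.
    move/edge_closedP: clY => /(_ a b aY); apply => //.
    by have := abf; rewrite in_f => /and5P[].
  have : s \in Y by rewrite YW (subsetP SW).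
  by move/(subsetP YV); rewrite !inE eqxx.
rewrite in_setI => /andP[rY rR]; apply/cards1P; exists r.
apply/eqP; rewrite eqEsubset sub1set in_setI rY rR /= andbT; apply/subsetP => r2.
rewrite in_setI in_set1 => /andP[r2Y r2R].
(* Z consists of r and the components of U attached to r: edges of f do not leave it, and it
   contains no second root. *)
pose Z := r |: [set y in U | [exists z in component e U y, [set r; z] \in e]].
have : Y \subset Z.
  apply: (edge_closed_conn (component_conn f xV) _ rY); last by rewrite !inE eqxx.
  move=> p q; rewrite in_setU1 => pZ pY qY pqf.
  have := pqf; rewrite in_f => /and5P[pqe pV qV pq npqS].
  have inU z : z \in V -> z \notin S -> z \in U by rewrite !inE => /andP[_ ->] ->.
  case/orP: pZ => [/eqP pr|].
    have rS := subsetP RS r rR.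
    have qU : q \in U by apply: inU => //; move: npqS; rewrite pr rS.
    rewrite in_setU1 inE qU /=; apply/orP; right; apply/exists_inP; exists q.
      exact: mem_component.
    by rewrite -pr.
  rewrite inE => /andP[pU /exists_inP[z zC rze]]; rewrite in_setU1 inE.
  have [qS|qS] := boolP (q \in S).
    have -> : q = r; last by rewrite eqxx.
    apply: (nbr p p z) => //; [exact: mem_component|exact: (subsetP RS)|by rewrite setUC].
  have qU := inU q qV qS; rewrite qU /=; apply/orP; right; apply/exists_inP; exists z => //.
  rewrite (component_same pU) //; have /edge_closedP := component_closed e pU.
  by move=> /(_ p q (mem_component e pU) qU pqe).
move/subsetP => /(_ r2 r2Y); rewrite in_setU1 => /orP[//|]; rewrite inE => /andP[].
by rewrite inE (subsetP RS).
Qed.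

Hypotheses (eSQ : e \subset pairs S :|: Q) (bS : biconn e S) (rf : rooted f V R).

Let e_cases x y : [set x; y] \in e -> (x \in S) && (y \in S) || ([set x; y] \in f).
Proof.
move=> xye; have := subsetP eSQ _ xye; rewrite in_setU set2_pairs => /orP[/and3P[-> -> //]|h].
by rewrite /f in_setI xye h orbT.
Qed.

Let root_of x : x \in V -> exists2 r, r \in R & component f V x :&: R = [set r].
Proof.
move=> xV; have /forall_inP /(_ x xV) /cards1P[r rE] := rf.
by exists r => //; have := set11 r; rewrite -rE in_setI => /andP[].
Qed.

(** Every vertex of V is joined to a root, and the roots are joined through S without s, which is
    connected because S is biconnected; s itself is reached inside S. *)
Lemma rooted_conn : conn_on e V /\ conn_on e W.
Proof.
have [r rS rs] := other_elem s (biconn_gt1 bS).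
have rR : r \in R by rewrite !inE rs.
have rV : r \in V by exact: (subsetP RV).
have cR : conn_on e R by exact: biconnD1.
have cV : conn_on e V.
  apply/conn_onP; split; first by apply/set0Pn; exists r.
  move=> A AV /set0Pn[a aA] cA.
  have cC x : x \in V -> conn_on e (component f V x).
    move=> xV; apply: (sub_conn_on _ (component_conn f xV)) => p q _ _ _; exact: f_e.
  have CA x z : x \in V -> z \in component f V x -> z \in A -> component f V x \subset A.
    by move=> xV; apply: (conn_on_closed (cC x xV) (component_sub _ _ _) cA).
  have RA : R \subset A.
    have aV := subsetP AV a aA; have [r' r'R rE] := root_of aV.
    have r'C : r' \in component f V a.
      by have := set11 r'; rewrite -rE in_setI => /andP[].
    apply: (conn_on_closed cR RV cA r'R); apply: subsetP r'C.
    exact: (CA a a aV (mem_component _ aV)).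
  apply/eqP; rewrite eqEsubset AV; apply/subsetP => x xV.
  have [r' r'R rE] := root_of xV.
  have r'C : r' \in component f V x.
    by have := set11 r'; rewrite -rE in_setI => /andP[].
  apply: (subsetP (CA x r' xV r'C (subsetP RA r' r'R))); exact: mem_component.
split => //; have -> : W = V :|: S.
  apply/setP => z; rewrite !inE; have [->|] := eqVneq z s; first by rewrite sS (subsetP SW).
  by have [/(subsetP SW)->|] := boolP (z \in S); rewrite ?orbF.
exact: (conn_onU cV (biconn_conn bS) rV rS).
Qed.

(** Let t be a vertex of X outside S and r its root. Deleting r from X leaves a connected set, which
    cannot leave the component of t because r is the only way out. *)
Lemma rooted_biconn X : X \subset W -> biconn e X ->
  (X \subset S) || (X \subset V) && (#|X :&: S| <= 1).
Proof.
move=> XW bX; have [//|/subsetPn[t tX tS]] := boolP (X \subset S).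
have tV : t \in V by rewrite !inE (subsetP XW) // andbT; apply: contraNneq tS => ->.
have [r rR rE] := root_of tV; have rS := subsetP RS r rR.
have CV := component_sub f V t.
have : X :\ r \subset component f V t.
  apply: (edge_closed_conn (biconnD1 r bX) _ (_ : t \in _)); last exact: mem_component.
    move=> a b aC aX bX' /e_cases /orP[/andP[aS bS']|abf].
      have : a \in component f V t :&: R by rewrite in_setI aC in_R // (subsetP CV).
      by rewrite rE inE => ar; move: aX; rewrite !inE ar.
    have /edge_closedP := component_closed f tV; move=> /(_ a b aC); apply=> //.
    by move: abf; rewrite in_f => /and5P[].
  by rewrite !inE tX andbT; apply: contraNneq tS => ->.
have rC : r \in component f V t by have := set11 r; rewrite -rE in_setI => /andP[].
move=> XrC; have XC : X \subset component f V t.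
  apply/subsetP => z zX; have [->//|zr] := eqVneq z r.
  by apply: (subsetP XrC); rewrite !inE zr.
rewrite (subset_trans XC CV) /= -(cards1 r) -rE; apply: subset_leq_card.
apply/subsetP => z; rewrite !in_setI => /andP[/(subsetP XC) zC zS].
by rewrite zC in_R // (subsetP CV).
Qed.

Lemma rooted_block : block_on e W S.
Proof.
apply/block_onP; split=> // X XW bX SX; apply/eqP; rewrite eqEsubset SX andbT.
case/orP: (rooted_biconn XW bX) => // /andP[_]; rewrite (setIidPr SX).
by rewrite leqNgt (biconn_gt1 bS).
Qed.

Lemma rooted_block_uniq X : block_on e W X -> s \in X -> X = S.
Proof.
move=> /block_onP[XW bX mX] sX; case/orP: (rooted_biconn XW bX) => [XS|/andP[XV _]].
  by rewrite (mX S).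
by have := subsetP XV s sX; rewrite !inE eqxx.
Qed.

(** By [rooted_biconn] the blocks are S and the blocks of the hanging forest; e and f agree on the
    subsets of V that meet S in at most one vertex. *)
Lemma rooted_all_blocks : all_blocks e W = all_blocks e S && all_blocks f V.
Proof.
have agree X : X \subset V -> #|X :&: S| <= 1 -> forall x y, x \in X -> y \in X -> x != y ->
    ([set x; y] \in f) = ([set x; y] \in e).
  move=> XV XS x y xX yX xy; rewrite in_f (subsetP XV x) // (subsetP XV y) // xy.
  rewrite [~~ _](_ : _ = true) ?andbT //; apply/negP => /andP[xS yS].
  have : [set x; y] \subset X :&: S by rewrite subUset !sub1set !in_setI xX yX xS yS.
  by move/subset_leq_card; rewrite cards2 xy => /leq_trans /(_ XS).
have bf X : X \subset V -> biconn f X -> #|X :&: S| <= 1.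
  move=> XV bX; have : 0 < #|X| by apply: leq_trans (biconn_gt1 bX).
  case/card_gt0P => x xX; have xV := subsetP XV x xX; have [r rR rE] := root_of xV.
  rewrite -(cards1 r) -rE; apply: subset_leq_card; apply/subsetP => z.
  rewrite !in_setI => /andP[zX zS]; rewrite in_R ?zS ?(subsetP XV) // andbT.
  by apply: subsetP zX; apply: component_max => //; exact: biconn_conn.
apply/all_blocksP/andP => [h|[/all_blocksP hS /all_blocksP hV] X].
  split; apply/all_blocksP => X /block_onP[XX bX mX].
    by rewrite -(mX S) //; apply: h; exact: rooted_block.
  rewrite (KI (agree X XX (bf X XX bX))); apply: h; apply/block_onP; split.
  - exact: subset_trans XX VW.
  - by rewrite -(eq_biconn (agree X XX (bf X XX bX))).
  - move=> Y YW bY XY; have X1 := biconn_gt1 bX.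
    case/orP: (rooted_biconn YW bY) => [YS|/andP[YV Y1]].
      by have := bf X XX bX; rewrite (setIidPl (subset_trans XY YS)) leqNgt X1.
    by apply: (mX Y YV _ XY); rewrite (eq_biconn (agree Y YV Y1)).
move=> /block_onP[XW bX mX]; case/orP: (rooted_biconn XW bX) => [XS|/andP[XV X1]].
  have SX : S = X by apply: mX.
  rewrite -SX; apply: hS; apply/block_onP; split=> // Y YS _ SY.
  by apply/eqP; rewrite eqEsubset YS.
rewrite -(KI (agree X XV X1)); apply: hV; apply/block_onP.
split; [exact: XV|by rewrite (eq_biconn (agree X XV X1))|].
move=> Y YV bY XY; apply: (mX Y (subset_trans YV VW) _ XY).
by rewrite -(eq_biconn (agree Y YV (bf Y YV bY))).
Qed.

End RootBlock.

(** Graphs are sorted by the block S of the root s, which is unique. Each other vertex of S is the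
    root of one connected graph, whence D = B'(zE). The size of W gives s a neighbour, hence a
    block. *)
Lemma count_noncut_root_rec W s : s \in W -> 1 < #|W| ->
  count_noncut_root s W = \sum_(S : {set T} | (S \subset W) && (s \in S)) count_biconn S * count_forest (W :\ s) (S :\ s).
Proof.
move=> sW W1; pose h e := odflt set0 [pick S : {set T} | block_on e W S && (s \in S)].
have hP e : e \subset pairs W -> conn_on e W -> block_on e W (h e) && (s \in h e).
  move=> eW cW; rewrite /h; case: pickP => [//|nob].
  have [x xs xe] : exists2 x, x != s & [set s; x] \in e.
    have [/exists_inP[x xW /andP[xs xe]]|] := boolP [exists x in W, (x != s) && ([set s; x] \in e)].
      by exists x.
    rewrite negb_exists_in => /forall_inP nos; exfalso.
    have WE : [set s] = W.
      apply: (conn_on_full cW _ (set11 s)); first by rewrite sub1set.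
      move=> a b; rewrite !inE => /eqP -> bW sbe.
      by have := nos b bW; rewrite sbe andbT negbK.
    by move: W1; rewrite -WE cards1.
  have := subsetP eW _ xe; rewrite set2_pairs => /and3P[_ xW sx].
  have okx : ([set s; x] \subset W) && biconn e [set s; x].
    by rewrite subUset !sub1set sW xW biconn_edge.
  have [S mS sxS] := maxset_exists (P := fun X => (X \subset W) && biconn e X) okx.
  have /= := nob S; rewrite /block_on mS /=.
  by move: sxS; rewrite subUset !sub1set => /andP[->].
rewrite {1}/count_noncut_root (card_fibers (h := h) (J := fun S => (S \subset W) && (s \in S))); last first.
  move=> e; rewrite inE => /and4P[eW _ cW _].
  by have /andP[/block_onP[-> _ _] ->] := hP e eW cW.
apply: eq_bigr => S /andP[SW sS].
set V := W :\ s; set R := S :\ s; set Q := pairs V :\: pairs S.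
have QV : Q \subset pairs V by exact: subsetDl.
have RV : R \subset V by exact: setSD.
have RS : R \subset S by exact: subsetDl.
(* A forest with exactly one root per component has no edge inside S, since its ends would be two
   roots of one component. *)
have -> : count_forest V R = #|[set f : {set {set T}} | (f \subset Q) && (all_blocks f V && rooted f V R)]|.
  apply: eq_card => f; rewrite !inE.
  have [/and3P[fV abf rf]|] := boolP [&& f \subset pairs V, all_blocks f V & rooted f V R].
    rewrite abf rf !andbT; apply/esym/subsetP => a af.
    have aV := subsetP fV a af; have /pairsP[x [y [aE xV yV xy]]] := aV.
    rewrite in_setD aV andbT aE set2_pairs; apply/negP => /and3P[xS yS _].
    move/forall_inP: rf => /(_ x xV) /cards1P[r rE].
    have xC := mem_component f xV.
    have yC : y \in component f V x.
      have /edge_closedP /(_ x y xC yV) := component_closed f xV.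
      by rewrite -aE af; apply.
    have : x \in component f V x :&: R by move: xV; rewrite !inE xC xS => /andP[->].
    have : y \in component f V x :&: R by move: yV; rewrite !inE yC yS => /andP[->].
    by rewrite rE !inE => /eqP yr /eqP xr; rewrite xr yr eqxx in xy.
  move=> nh; apply/esym/negbTE; apply: contra nh => /and3P[fQ -> ->].
  by rewrite (subset_trans fQ QV).
have dSQ : [disjoint pairs S & Q].
  by rewrite disjoint_sym; rewrite -setI_eq0 /Q setIDAC setDE -setIA setICr setI0.
rewrite /count_biconn -(card_glue (fun e => all_blocks e S && biconn e S)
  (fun e => all_blocks e V && rooted e V R) dSQ).
apply: eq_card => e; rewrite !inE all_blocks_restrict biconn_restrict.
apply/idP/idP.
  move=> /andP[/and4P[eW ab cW cV] /eqP hE].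
  have := hP e eW cW; rewrite hE sS andbT => bl.
  have bS : biconn e S by case/block_onP: bl.
  have [eSQ rf] := maximal_block_rooted sS SW eW cW cV bl.
  by have := ab; rewrite (rooted_all_blocks sS SW eSQ bS rf) eSQ bS rf => /andP[-> ->].
move=> /and3P[eSQ /andP[abS bS] /andP[abf rf]].
have eW : e \subset pairs W.
  apply: (subset_trans eSQ); rewrite subUset pairsS //=.
  by apply: (subset_trans QV); apply: pairsS; exact: subsetDl.
have [cV cW] := rooted_conn sS SW bS rf.
rewrite eW (rooted_all_blocks sS SW eSQ bS rf) abS abf cV cW /=.
have /andP[bl sh] := hP e eW cW.
by rewrite (rooted_block_uniq sS SW eSQ bS rf bl sh).
Qed.

End Counting.

(** * Relabelling and counting *)

Section Transfer.
Variables (T T' : finType) (h : T -> T').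
Hypothesis h_inj : injective h.

Lemma eq_conn_on_imset (e : {set {set T}}) (e' : {set {set T'}}) (X : {set T}) :
  (forall x y, x \in X -> y \in X -> x != y -> ([set x; y] \in e) = ([set h x; h y] \in e')) ->
  conn_on e X = conn_on e' (h @: X).
Proof.
move=> he; apply/conn_onP/conn_onP => -[X0 cX]; split.
- by rewrite imset_eq0.
- move=> B BX /set0Pn[b bB] /edge_closedP clB.
  have AE : X :&: h @^-1: B = X.
    apply: cX; first exact: subsetIl.
      have /imsetP[x xX bE] := subsetP BX b bB.
      by apply/set0Pn; exists x; rewrite !inE xX -bE.
    apply/edge_closedP => x y; rewrite !inE => /andP[xX xB] yX xye; rewrite yX.
    have [<- //|xy] := eqVneq x y.
    by apply: (clB (h x)) => //; [exact: imset_f|rewrite -he].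
  apply/eqP; rewrite eqEsubset BX; apply/subsetP => _ /imsetP[x xX ->].
  by move: xX; rewrite -AE !inE => /andP[].
- by move: X0; rewrite imset_eq0.
- move=> A AX A0 /edge_closedP clA; apply: (imset_inj h_inj); apply: cX.
  + exact: imsetS.
  + by apply: contra A0; rewrite imset_eq0.
  apply/edge_closedP => _ _ /imsetP[x xA ->] /imsetP[y yX ->] xye; apply: imset_f.
  have [<- //|xy] := eqVneq x y.
  by apply: (clA x) => //; rewrite he // (subsetP AX).
Qed.

Lemma eq_biconn_imset (e : {set {set T}}) (e' : {set {set T'}}) (X : {set T}) :
  (forall x y, x \in X -> y \in X -> x != y -> ([set x; y] \in e) = ([set h x; h y] \in e')) ->
  biconn e X = biconn e' (h @: X).
Proof.
move=> he; rewrite /biconn card_imset // (eq_conn_on_imset he).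
have D1 v : h @: (X :\ v) = h @: X :\ h v.
  apply/setP => y; rewrite !inE; apply/imsetP/andP => [[x]|[yv /imsetP[x xX yE]]].
    by rewrite !inE => /andP[xv xX] ->; rewrite (inj_eq h_inj) imset_f.
  by exists x; rewrite // !inE xX andbT; apply: contraNneq yv => <-; rewrite yE.
have heD v : conn_on e (X :\ v) = conn_on e' (h @: X :\ h v).
  rewrite -D1; apply: eq_conn_on_imset => x y; rewrite !inE.
  by move=> /andP[_ xX] /andP[_ yX]; exact: he.
congr [&& _, _ & _]; apply/forall_inP/forall_inP => cD.
  by move=> _ /imsetP[v vX ->]; rewrite -heD; exact: cD.
by move=> v vX; rewrite heD; apply: cD; exact: imset_f.
Qed.

End Transfer.

(** The cardinality test is there because e is an arbitrary family of sets, not only of pairs. *)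
Definition relabelled_edges (T : finType) (V : {set T}) (e : {set {set T}}) :
    {set {set 'I_#|V|}} :=
  [set a : {set 'I_#|V|} | (#|a| == 2) && ((@enum_val _ (mem V)) @: a \in e)].

Lemma relabelled_edges_card2 (T : finType) (V : {set T}) (e : {set {set T}}) :
  [forall a in relabelled_edges V e, #|a| == 2].
Proof. by apply/forall_inP => a; rewrite inE => /andP[]. Qed.

Definition relabel (T : finType) (V : {set T}) (e : {set {set T}}) : lgraph #|V| :=
  LGraph (relabelled_edges_card2 V e).

Lemma edges_pairs n (g : lgraph n) : edges g \subset pairs [set: 'I_n].
Proof.
by apply/subsetP => a ag; rewrite inE subsetT; move/forall_inP: (edges_card2 g); apply.
Qed.

Lemma lgraph_eq n (g g' : lgraph n) :
  (forall i j, i != j -> adj g i j = adj g' i j) -> g = g'.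
Proof.
move=> h; apply: val_inj => /=; apply/setP => a.
have [/pairsP[i [j [-> _ _ ij]]]|aP] := boolP (a \in pairs [set: 'I_n]); first exact: h.
transitivity false; [apply/negbTE|apply/esym/negbTE]; apply: contra aP;
  exact: (subsetP (edges_pairs _)).
Qed.

Lemma adj_irrefl n (g : lgraph n) i : adj g i i = false.
Proof.
apply/negP => /(subsetP (edges_pairs g)); by rewrite set2_pairs eqxx !andbF.
Qed.

Section Relabel.
Variables (T : finType) (V : {set T}).
Local Notation ev := (@enum_val _ (mem V)).

Lemma adj_relabel (e : {set {set T}}) i j : i != j ->
  adj (relabel V e) i j = ([set ev i; ev j] \in e).
Proof. by move=> ij; rewrite /adj inE cards2 ij imsetU !imset_set1. Qed.

Lemma enum_val_setT : ev @: [set: 'I_#|V|] = V.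
Proof.
apply/setP => x; apply/imsetP/idP => [[i _ ->]|xV]; first exact: enum_valP.
by exists (enum_rank_in xV x); rewrite ?inE // enum_rankK_in.
Qed.

Lemma enum_val_sub (Y : {set 'I_#|V|}) : ev @: Y \subset V.
Proof. by apply/subsetP => _ /imsetP[i _ ->]; exact: enum_valP. Qed.

Lemma enum_val_preim (S : {set T}) : S \subset V -> ev @: (ev @^-1: S) = S.
Proof.
move=> SV; apply/setP => x; apply/imsetP/idP => [[i]|xS]; first by rewrite inE => iS ->.
have xV := subsetP SV x xS.
by exists (enum_rank_in xV x); rewrite ?inE enum_rankK_in.
Qed.

Lemma conn_on_relabel e (X : {set 'I_#|V|}) :
  conn_on (relabel V e) X = conn_on e (ev @: X).
Proof.
by apply: eq_conn_on_imset => [|x y _ _ xy]; [exact: enum_val_inj|exact: adj_relabel].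
Qed.

Lemma biconn_relabel e (X : {set 'I_#|V|}) :
  biconn (relabel V e) X = biconn e (ev @: X).
Proof.
by apply: eq_biconn_imset => [|x y _ _ xy]; [exact: enum_val_inj|exact: adj_relabel].
Qed.

Lemma block_on_relabel e (X : {set 'I_#|V|}) :
  block_on (relabel V e) [set: 'I_#|V|] X = block_on e V (ev @: X).
Proof.
apply/block_onP/block_onP => -[XT bX mX]; split.
- exact: enum_val_sub.
- by rewrite -biconn_relabel.
- move=> Y YV bY XY; suff <- : ev @^-1: Y = X by rewrite enum_val_preim.
  apply: mX; [exact: subsetT|by rewrite biconn_relabel enum_val_preim|].
  by apply/subsetP => i iX; rewrite inE; apply: (subsetP XY); exact: imset_f.
- exact: subsetT.
- by rewrite biconn_relabel.
- move=> Y _ bY XY; apply: (imset_inj enum_val_inj); apply: mX; first exact: enum_val_sub.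
    by rewrite -biconn_relabel.
  exact: imsetS.
Qed.

(** Relabelling is a bijection from the subsets of [pairs V] onto the labelled graphs; restricting
    to [pairs V] picks one edge set among all those with the same relabelling. *)
Lemma card_relabel (P : pred (lgraph #|V|)) :
  #|[set e : {set {set T}} | (e \subset pairs V) && P (relabel V e)]| =
  #|[set g : lgraph #|V| | P g]|.
Proof.
have ev_inj := @enum_val_inj T (mem V).
rewrite -(card_in_imset (f := relabel V)); last first.
  move=> e e'; rewrite !inE => /andP[eV _] /andP[e'V _] ee'.
  have adjE i j : i != j -> ([set ev i; ev j] \in e) = ([set ev i; ev j] \in e').
    by move=> ij; rewrite -!adj_relabel // ee'.
  apply/setP => a; have [/pairsP[x [y [-> xV yV xy]]]|aP] := boolP (a \in pairs V).
    move: (adjE (enum_rank_in xV x) (enum_rank_in xV y)); rewrite !enum_rankK_in //; apply.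
    by apply: contra xy => /eqP /(congr1 ev); rewrite !enum_rankK_in // => ->.
  transitivity false; [apply/negbTE|apply/esym/negbTE]; apply: contra aP;
    exact: subsetP.
apply: eq_card => g; rewrite [in RHS]inE; apply/imsetP/idP => [[e]|Pg].
  by rewrite inE => /andP[_ Pe] ->.
pose e := (fun a : {set 'I_#|V|} => ev @: a) @: edges g.
have eg : relabel V e = g.
  apply: lgraph_eq => i j ij; rewrite adj_relabel //.
  have -> : [set ev i; ev j] = ev @: [set i; j] by rewrite imsetU !imset_set1.
  by rewrite mem_imset //; exact: imset_inj.
exists e; rewrite // inE eg Pg andbT; apply/subsetP => _ /imsetP[a ag ->].
rewrite inE card_imset // enum_val_sub /=.
by move/forall_inP: (edges_card2 g); apply.
Qed.

End Relabel.

Lemma induced_relabel n (g : lgraph n) S : induced_graph g S = relabel S g.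
Proof.
apply: lgraph_eq => i j ij; rewrite adj_relabel // /adj inE.
by rewrite imsetU !imset_set1.
Qed.

(** The vertices reachable from a given one form a closed set, and a closed set contains whatever is
    reachable from it; this matches the path form and the cut form of connectedness. *)
Lemma connected_conn_on n (g : lgraph n) : connected_graph g = conn_on g [set: 'I_n].
Proof.
apply/andP/conn_onP => [[n0 /forallP cg]|[V0 cV]].
  split; first by apply/set0Pn; exists (Ordinal n0); rewrite inE.
  move=> A _ /set0Pn[a aA] /edge_closedP clA.
  apply/eqP; rewrite eqEsubset subsetT; apply/subsetP => x _.
  have cl : fingraph.closed (adj g) (mem A).
    move=> u v uv; apply/idP/idP => [uA|vA]; first by apply: (clA u); rewrite ?inE.
    by apply: (clA v); rewrite ?inE // setUC.
  by have /forallP /(_ x) /(closed_connect cl) <- := cg a.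
have /set0Pn[i _] := V0; split; first exact: leq_ltn_trans (ltn_ord i).
apply/forallP => x; apply/forallP => y.
have cx : [set z | connect (adj g) x z] = [set: 'I_n].
  apply: cV; first exact: subsetT.
    by apply/set0Pn; exists x; rewrite inE connect0.
  apply/edge_closedP => a b; rewrite !inE => xa _ ab; apply: connect_trans xa _.
  exact: connect1.
by have := in_setT y; rewrite -cx inE.
Qed.

Lemma connected_relabel (T : finType) (V : {set T}) e :
  connected_graph (relabel V e) = conn_on e V.
Proof. by rewrite connected_conn_on conn_on_relabel enum_val_setT. Qed.

Lemma two_connected_biconn n (g : lgraph n) : two_connected_graph g = biconn g [set: 'I_n].
Proof.
rewrite /two_connected_graph /biconn connected_conn_on cardsT card_ord.
have E v : connected_graph (induced_graph g [set~ v]) = conn_on g ([set: 'I_n] :\ v).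
  by rewrite induced_relabel connected_relabel setTD.
have -> : [forall v, connected_graph (induced_graph g [set~ v])] =
          [forall v in [set: 'I_n], conn_on g ([set: 'I_n] :\ v)].
  by apply: eq_forallb => v; rewrite E inE.
have [n2|n2|n2] := ltngtP n 2.
- by rewrite /= andbF ?leqNgt ?n2.
- by rewrite /= ?(ltn_trans _ n2) ?(ltnW n2).
- rewrite andbT /=; case: conn_on => //=; apply/esym/forall_inP => v _.
  have /cards1P[w ->] : #|[set: 'I_n] :\ v| == 1.
    by have := cardsD1 v [set: 'I_n]; rewrite in_setT cardsT card_ord [X in X = _]n2 add1n => -[] <-.
  exact: conn_on1.
Qed.

Lemma two_connected_relabel (T : finType) (V : {set T}) e :
  two_connected_graph (relabel V e) = biconn e V.
Proof. by rewrite two_connected_biconn biconn_relabel enum_val_setT. Qed.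

Lemma is_block_block_on n (g : lgraph n) S : is_block g S = block_on g [set: 'I_n] S.
Proof.
apply: maxset_eq => X; rewrite subsetT induced_relabel two_connected_relabel.
by [].
Qed.

(** The bijection forces n = m, but the two sizes are kept apart so that graphs on sets of provably
    equal cardinality can be compared without casts. *)
Lemma graph_class_bij (G : graph_family) n m (g : lgraph n) (g' : lgraph m)
    (k : 'I_n -> 'I_m) : graph_class G -> bijective k ->
  (forall i j, i != j -> adj g i j = adj g' (k i) (k j)) ->
  (g \in G n) = (g' \in G m).
Proof.
move=> G_class kb kadj; have nm : n = m by have := bij_eq_card kb; rewrite !card_ord.
subst m; have kadj' i j : adj g i j = adj g' (k i) (k j).
  by have [->|/kadj //] := eqVneq i j; rewrite !adj_irrefl.
have kinj := bij_inj kb.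
apply/idP/idP; apply: G_class.
  by exists (perm kinj) => i j; rewrite !permE.
by exists (perm kinj)^-1%g => i j; rewrite kadj' -!(permE kinj) !permKV.
Qed.

Section Family.
Variable G : graph_family.
Hypotheses (G_class : graph_class G) (G_stable : block_stable G).

Definition in_family (T : finType) (e : {set {set T}}) (S : {set T}) : bool :=
  relabel S e \in G #|S|.

Lemma eq_in_family (T : finType) (e e' : {set {set T}}) (S : {set T}) :
  (forall x y, x \in S -> y \in S -> x != y -> ([set x; y] \in e) = ([set x; y] \in e')) ->
  in_family e S = in_family e' S.
Proof.
move=> ee'; rewrite /in_family; suff -> : relabel S e = relabel S e' by [].
apply: lgraph_eq => i j ij; by rewrite !adj_relabel // ee' ?enum_valP // (inj_eq enum_val_inj).
Qed.

Lemma in_family_imset (T T' : finType) (h : T -> T')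
    (e : {set {set T}}) (e' : {set {set T'}}) (S : {set T}) : injective h ->
  (forall x y, x \in S -> y \in S -> x != y -> ([set x; y] \in e) = ([set h x; h y] \in e')) ->
  in_family e S = in_family e' (h @: S).
Proof.
move=> h_inj he.
pose k (i : 'I_#|S|) := enum_rank_in (imset_f h (enum_valP i)) (h (enum_val i)).
have kE i : enum_val (k i) = h (enum_val i).
  exact: (enum_rankK_in (imset_f h (enum_valP i)) (imset_f h (enum_valP i))).
have k_inj : injective k.
  by move=> i j /(congr1 enum_val); rewrite !kE => /h_inj /enum_val_inj.
have kb : bijective k by apply: inj_card_bij => //; rewrite !card_ord card_imset.
apply: (graph_class_bij G_class kb) => i j ij.
rewrite !adj_relabel ?(inj_eq k_inj) // !kE he ?enum_valP //.
by rewrite (inj_eq enum_val_inj).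
Qed.

(** The enumeration of V matches the blocks of e with those of the relabelled graph, and [G_class]
    makes membership insensitive to the two successive relabellings. *)
Lemma in_family_blocks (T : finType) (e : {set {set T}}) (V : {set T}) :
  in_family e V = all_blocks (@in_family T) e V.
Proof.
have iso (X : {set 'I_#|V|}) :
    (induced_graph (relabel V e) X \in G #|X|) = in_family e (enum_val @: X).
  rewrite induced_relabel; apply: in_family_imset; first exact: enum_val_inj.
  by move=> x y _ _ xy; exact: adj_relabel.
apply/idP/all_blocksP => [/(proj1 (proj2 G_stable _ _)) h S bS|h].
  have SV : S \subset V by case/block_onP: bS.
  rewrite -(enum_val_preim SV) -iso; apply: h.
  by rewrite is_block_block_on block_on_relabel enum_val_preim.
apply: (proj2 (proj2 G_stable _ _)) => X; rewrite is_block_block_on block_on_relabel.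
by move=> /h; rewrite iso.
Qed.

Lemma count_family_card (T : finType) (V : {set T}) : count_family (@in_family T) V = #|G #|V| |.
Proof.
rewrite /count_family -[RHS](_ : #|[set g in G #|V|]| = _); last by apply: eq_card => g; rewrite inE.
rewrite -card_relabel; apply: eq_card => e; rewrite !inE -in_family_blocks.
by [].
Qed.

Lemma count_connected_card (T : finType) (V : {set T}) :
  count_connected (@in_family T) V = #|connected_subclass G #|V| |.
Proof.
rewrite /count_connected /connected_subclass -card_relabel.
by apply: eq_card => e; rewrite !inE -in_family_blocks connected_relabel.
Qed.

Lemma count_biconn_card (T : finType) (V : {set T}) :
  count_biconn (@in_family T) V = #|two_connected_subclass G #|V| |.
Proof.
rewrite /count_biconn /two_connected_subclass -card_relabel.
by apply: eq_card => e; rewrite !inE -in_family_blocks two_connected_relabel.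
Qed.

End Family.

Lemma sum_subsets_card (T : finType) (U : {set T}) (h : nat -> nat) :
  \sum_(A : {set T} | A \subset U) h #|A| = \sum_(k < #|U|.+1) 'C(#|U|, k) * h k.
Proof.
rewrite (partition_big (fun A : {set T} => inord #|A| : 'I_#|U|.+1) predT) //=.
apply: eq_bigr => k _.
transitivity (#|[set A : {set T} | A \subset U & #|A| == k]| * h k); last by rewrite cards_draws.
rewrite -[in RHS]sum1_card big_distrl /=.
rewrite (eq_bigl (fun A => A \in [set A : {set T} | A \subset U & #|A| == k])).
  by apply: eq_bigr => A; rewrite inE mul1n => /andP[_ /eqP ->].
move=> A; rewrite inE; have [AU|//] := boolP (A \subset U).
by rewrite -val_eqE /= inordK // ltnS subset_leq_card.
Qed.

Lemma sum_subsets_trace (T : finType) (V R : {set T}) r (F : {set T} -> nat) :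
  r \in R -> R \subset V ->
  \sum_(A : {set T} | (A \subset V) && (A :&: R == [set r])) F A =
  \sum_(A : {set T} | A \subset V :\: R) F (r |: A).
Proof.
move=> rR RV; rewrite (reindex_onto (fun A => r |: A) (fun A => A :\ r)) /=.
  apply: eq_bigl => A; apply/andP/idP => [[/andP[AV /eqP AR] /eqP Ar]|].
    apply/subsetP => z zA; rewrite inE (subsetP AV) ?inE ?zA ?orbT // andbT.
    apply/negP => zR; have : z \in [set r] by rewrite -AR !inE zA orbT zR.
    by rewrite inE => /eqP zr; move: zA; rewrite -Ar zr !inE eqxx.
  rewrite subsetD => /andP[AV AR].
  have rA : r \notin A.
    by apply/negP => rA; move/disjoint_setI0/setP: AR => /(_ r); rewrite !inE rA rR.
  rewrite subUset sub1set AV (subsetP RV) // setIUl (disjoint_setI0 AR) setU0.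
  by rewrite (setIidPl _) ?sub1set // eqxx setU1K.
move=> A /andP[_ /eqP AR]; apply: setD1K.
by have := set11 r; rewrite -AR inE => /andP[].
Qed.

Lemma sum_subsets_mem (T : finType) (V : {set T}) x (F : {set T} -> nat) : x \in V ->
  \sum_(A : {set T} | (A \subset V) && (x \in A)) F A =
  \sum_(A : {set T} | A \subset V :\ x) F (x |: A).
Proof.
move=> xV; rewrite -sum_subsets_trace ?inE ?sub1set //; apply: eq_bigl => A.
by congr (_ && _); apply/idP/eqP => [xA|/setP /(_ x)];
  [apply/setIidPr; rewrite sub1set|rewrite !inE eqxx andbT].
Qed.

(** * Recurrences for the numbers of graphs *)

Section Recurrences.
Variable G : graph_family.
Hypotheses (G_class : graph_class G) (G_stable : block_stable G).

Local Notation gn n := #|G n|.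
Local Notation cn n := #|connected_subclass G n|.
Local Notation bn n := #|two_connected_subclass G n|.

(* The number of graphs on j + m vertices whose components contain exactly one of
   m given vertices: j! [z^j] C'(z)^m. *)
Fixpoint forest_count (m j : nat) : nat :=
  if m is m'.+1 then \sum_(k < j.+1) 'C(j, k) * (cn k.+1 * forest_count m' (j - k))
  else j == 0.

(** n! times the coefficient of z^n in D = B'(zE): the root carries no label, m is the number of
    other vertices in its block, and the graphs hanging from these use the remaining n - m
    labels. *)
Definition root_block_count n : nat :=
  \sum_(m < n.+1) 'C(n, m) * (bn m.+1 * forest_count m (n - m)).

Lemma count_forestE m (T : finType) (V R : {set T}) : R \subset V -> #|R| = m ->
  count_forest (@in_family G T) V R = forest_count m (#|V| - m).
Proof.
elim: m V R => [|m IH] V R RV Rm.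
  have -> : R = set0 by apply/eqP; rewrite -cards_eq0 Rm.
  by rewrite count_forest0 subn0 /= cards_eq0.
have [r rR] : exists r, r \in R by apply/card_gt0P; rewrite Rm.
rewrite (count_forest_rec (@eq_in_family G T) rR RV) sum_subsets_trace //=.
have VR : #|V :\: R| = #|V| - m.+1 by rewrite cardsD (setIidPr RV) Rm.
rewrite -VR -(sum_subsets_card _
  (fun k => cn k.+1 * forest_count m (#|V :\: R| - k))).
apply: eq_bigr => A; rewrite subsetD => /andP[AV dAR].
have rA : r \notin A.
  by apply/negP => rA; move/disjoint_setI0/setP: dAR => /(_ r); rewrite !inE rA rR.
have R1 : #|R :\ r| = m by have := cardsD1 r R; rewrite rR Rm add1n => -[].
have cA : #|r |: A| = #|A|.+1 by rewrite cardsU1 rA.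
have rAV : r |: A \subset V by rewrite subUset sub1set (subsetP RV).
rewrite (count_connected_card G_class G_stable) cA; congr (_ * _); rewrite IH //.
  by rewrite cardsD (setIidPr rAV) cA VR; congr forest_count; lia.
apply/subsetP => z; rewrite !inE => /andP[zr zR]; rewrite (negbTE zr) (subsetP RV) // andbT /=.
by apply/negP => zA; move/disjoint_setI0/setP: dAR => /(_ z); rewrite !inE zA zR.
Qed.

Lemma count_noncut_rootE (T : finType) (W : {set T}) s : s \in W -> 1 < #|W| ->
  count_noncut_root (@in_family G T) s W = root_block_count #|W|.-1.
Proof.
move=> sW W1; rewrite (count_noncut_root_rec (@eq_in_family G T) sW W1) sum_subsets_mem //.
have V1 : #|W :\ s| = #|W|.-1 by rewrite (cardsD1 s W) sW.
rewrite /root_block_count -V1 -(sum_subsets_card _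
  (fun k => bn k.+1 * forest_count k (#|W :\ s| - k))).
apply: eq_bigr => A AV; have sA : s \notin A.
  by apply/negP => /(subsetP AV); rewrite !inE eqxx.
rewrite (count_biconn_card G_class G_stable) cardsU1 sA setU1K //.
by rewrite (count_forestE AV erefl).
Qed.

Lemma card_family_rec n :
  gn n.+1 = \sum_(k < n.+1) 'C(n, k) * (cn k.+1 * gn (n - k)).
Proof.
have := count_family_card G_class G_stable [set: 'I_n.+1]; rewrite cardsT card_ord => <-.
rewrite (count_family_rec (@eq_in_family G _) (in_setT ord0)) sum_subsets_mem ?inE //.
have V1 : #|[set: 'I_n.+1] :\ ord0| = n.
  by have := cardsD1 ord0 [set: 'I_n.+1]; rewrite in_setT cardsT card_ord add1n => -[].
rewrite -[in RHS]V1 -(sum_subsets_card _ (fun k => cn k.+1 * gn (#|[set: 'I_n.+1] :\ ord0| - k))).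
apply: eq_bigr => A AV; have sA : ord0 \notin A.
  by apply/negP => /(subsetP AV); rewrite !inE eqxx.
rewrite (count_connected_card G_class G_stable) (count_family_card G_class G_stable).
rewrite cardsU1 sA; congr (_ * #|G _|).
by rewrite cardsD setTI cardsT card_ord cardsU1 sA V1 add1n subSS.
Qed.

(** The root is [ord0] and the marked vertex [ord_max]; k counts the other vertices in the component
    of [ord_max], hence the shifts by one. *)
Lemma card_connected_rec n : cn n.+2 =
  \sum_(k < n.+1) 'C(n, k) * (root_block_count k.+1 * cn (n - k).+1).
Proof.
have := count_connected_card G_class G_stable [set: 'I_n.+2]; rewrite cardsT card_ord => <-.
have x0 : (ord_max : 'I_n.+2) != ord0 by [].
rewrite (count_connected_rec (@eq_in_family G _) (in_setT ord0) (in_setT ord_max) x0).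
set V := _ :\ ord0.
have xV : ord_max \in V by rewrite !inE.
rewrite sum_subsets_mem //.
have V1 : #|V| = n.+1.
  by have := cardsD1 ord0 [set: 'I_n.+2]; rewrite in_setT cardsT card_ord add1n => -[].
have V2 : #|V :\ ord_max| = n.
  by have := cardsD1 ord_max V; rewrite xV V1 add1n => -[].
rewrite -[in RHS]V2 -(sum_subsets_card _
  (fun k => root_block_count k.+1 * cn (#|V :\ ord_max| - k).+1)).
apply: eq_bigr => A AV; have sA : ord_max \notin A.
  by apply/negP => /(subsetP AV); rewrite !inE eqxx.
have tA : ord0 \notin ord_max |: A.
  rewrite !inE negb_or; apply/andP; split=> //.
  by apply/negP => /(subsetP AV); rewrite !inE eqxx.
have cA : #|ord_max |: A| = #|A|.+1 by rewrite cardsU1 sA.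
rewrite count_noncut_rootE ?inE ?eqxx //; last by rewrite cardsU1 tA cA.
rewrite cardsU1 tA cA add1n /= (count_connected_card G_class G_stable).
congr (_ * #|connected_subclass G _|).
have := subset_leq_card AV; rewrite V2.
by rewrite cardsD setTI cardsT card_ord cA subSS => /subSn ->.
Qed.

(** The empty graph has no block, so block-stability puts it in the class. *)
Lemma card_family0 : gn 0 = 1.
Proof.
have := count_family_card G_class G_stable (set0 : {set 'I_1}); rewrite cards0 => <-.
have := count_forest0 (@in_family G 'I_1) set0; rewrite eqxx => F1.
rewrite -[RHS]F1; apply: eq_card => e; rewrite !inE; congr (_ && _); rewrite [rooted _ _ _](_ : _ = true) ?andbT //.
by apply/forall_inP => x; rewrite inE.
Qed.

Lemma card_connected1 : cn 1 = 1.
Proof.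
have := count_connected_card G_class G_stable [set (ord0 : 'I_1)]; rewrite cards1 => <-.
rewrite /count_connected (_ : [set e | _] = [set set0]) ?cards1 //; apply/setP => e; rewrite !inE.
have P0 : pairs [set (ord0 : 'I_1)] = set0.
  apply/setP => a; rewrite !inE; apply/negP => /andP[/subset_leq_card].
  by rewrite cards1 => + /eqP a2; rewrite a2.
rewrite P0 subset0; have [->|//] := eqVneq e set0; rewrite /= conn_on1 andbT.
apply/all_blocksP => S /block_onP[/subset_leq_card]; rewrite cards1 => S1.
by move/biconn_gt1; rewrite ltnNge S1.
Qed.

Lemma card_two_connected2 : 0 < bn 2.
Proof.
apply/card_gt0P; exists link_graph; rewrite inE (proj1 G_stable) /=.
rewrite two_connected_biconn.
have -> : [set: 'I_2] = [set ord0; ord_max].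
  by apply/setP => i; rewrite !inE; case: i => -[|[|[]]].
apply: biconn_edge => //; rewrite /= inE; apply/eqP/setP => i.
by rewrite !inE; case: i => -[|[|[]]].
Qed.

End Recurrences.

Import Order.TTheory GRing.Theory Num.Theory.
Local Open Scope ring_scope.

(** * Formal power series modulo a power of the variable *)

Section FormalSeries.
Variable F : numFieldType.
Implicit Types (p q r h : {poly F}) (a b e phi : nat -> F) (n N : nat).

Lemma exp_comp_poly p q k : (p \Po q) ^+ k = (p ^+ k) \Po q.
Proof.
elim: k => [|k IH]; first by rewrite !expr0 comp_polyC.
by rewrite !exprS IH comp_polyM.
Qed.

Lemma comp_trunc_poly a n q : (\poly_(i < n) a i) \Po q = \sum_(i < n) a i *: q ^+ i.
Proof.
rewrite poly_def (big_morph (fun p => p \Po q) (fun p r => comp_polyD p r q) (comp_poly0 q)).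
by apply: eq_bigr => i _; rewrite comp_polyZ comp_Xn_poly.
Qed.

Definition eqmodX n p q := exists r, p = q + r * 'X^n.

Lemma eqmodXP n p q : eqmodX n p q <-> forall i, (i < n)%N -> p`_i = q`_i.
Proof.
split=> [[r ->] i lin|h]; first by rewrite coefD coefMXn lin addr0.
exists (drop_poly n p - drop_poly n q).
have tE : take_poly n p = take_poly n q.
  by apply/polyP => i; rewrite !coef_take_poly; case: ifP => // /h.
rewrite -[X in X = _](poly_take_drop n) -[X in _ = X + _](poly_take_drop n) tE; ring.
Qed.

Lemma eqmodX_refl n p : eqmodX n p p. Proof. exact/eqmodXP. Qed.

Lemma eqmodX_sym n p q : eqmodX n p q -> eqmodX n q p.
Proof. by move=> /eqmodXP h; apply/eqmodXP => i /h. Qed.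

Lemma eqmodX_trans n p q r : eqmodX n p q -> eqmodX n q r -> eqmodX n p r.
Proof. by move=> /eqmodXP h1 /eqmodXP h2; apply/eqmodXP => i lin; rewrite h1 ?h2. Qed.

Lemma eqmodXM n p p' q q' : eqmodX n p p' -> eqmodX n q q' -> eqmodX n (p * q) (p' * q').
Proof.
by move=> [r ->] [s ->]; exists (p' * s + r * q' + r * s * 'X^n); ring.
Qed.

Lemma eqmodXX n p q k : eqmodX n p q -> eqmodX n (p ^+ k) (q ^+ k).
Proof.
move=> pq; elim: k => [|k IH]; first exact: eqmodX_refl.
by rewrite !exprS; exact: eqmodXM.
Qed.

Lemma eqmodX_mulX n p q : eqmodX n p q -> eqmodX n.+1 ('X * p) ('X * q).
Proof. by move=> [r ->]; exists r; rewrite exprS; ring. Qed.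

Lemma eqmodX_comp n p q r : eqmodX n p q -> r`_0 = 0 -> eqmodX n (p \Po r) (q \Po r).
Proof.
move=> [s ->] r0; have [t rE] : eqmodX 1 r 0.
  by apply/eqmodXP => -[|//] _; rewrite coef0.
exists ((s \Po r) * t ^+ n).
rewrite comp_polyD comp_polyM comp_Xn_poly {3}rE add0r expr1 exprMn; ring.
Qed.

(** As i+1 is invertible in F, the equation determines coefficient i+1 of a solution from the lower
    ones. *)
Lemma eqmodX_ode n d p q : p`_0 = q`_0 ->
  eqmodX n p^`() (d * p) -> eqmodX n q^`() (d * q) -> eqmodX n.+1 p q.
Proof.
move=> pq0 /eqmodXP hp /eqmodXP hq; apply/eqmodXP => i.
elim/ltn_ind: i => -[//|i] IH; rewrite ltnS => lin.
have := hp i lin; have := hq i lin; rewrite !coef_deriv !coefM => hqi hpi.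
apply: (mulIf (_ : i.+1%:R != 0 :> F)); first by rewrite pnatr_eq0.
rewrite !mulr_natr hpi hqi; apply: eq_bigr => j _; congr (_ * _).
by apply: IH; lia.
Qed.

(** phi is exp(b - b_0), characterized by phi' = b' phi. Each coefficient depends on all previous
    ones, so the series is built as a sequence of polynomials, each adding one term to the one
    before. *)
Lemma formal_exp_exists b : exists2 phi : nat -> F, phi 0%N = 1 &
  forall n, n.+1%:R * phi n.+1 = \sum_(k < n.+1) k.+1%:R * b k.+1 * phi (n - k)%N.
Proof.
pose step (p : {poly F}) (n : nat) := p + ((\sum_(k < n.+1) k.+1%:R * b k.+1 * p`_(n - k)) / n.+1%:R) *: 'X^(n.+1).
pose fix P (n : nat) : {poly F} := if n is m.+1 then step (P m) m else 1.
have PS n : P n.+1 = step (P n) n by [].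
have stab n i : (i <= n)%N -> (P n)`_i = (P i)`_i.
  elim: n => [|n IH]; first by rewrite leqn0 => /eqP ->.
  rewrite leq_eqVlt ltnS => /orP[/eqP -> //|lin].
  rewrite PS coefD coefZ coefXn; have -> : (i == n.+1) = false by lia.
  by rewrite mulr0 addr0 IH.
have vanish n i : (n < i)%N -> (P n)`_i = 0.
  elim: n => [|n IH] lni; first by rewrite coef1 eqn0Ngt lni.
  rewrite PS coefD coefZ coefXn IH ?add0r; last by lia.
  by rewrite gtn_eqF // mulr0.
exists (fun n => (P n)`_n); first by rewrite coef1.
move=> n; rewrite PS coefD coefZ coefXn eqxx mulr1 vanish // add0r.
rewrite mulrC divfK ?pnatr_eq0 //; apply: eq_bigr => k _; congr (_ * _).
by apply: stab; exact: leq_subr.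
Qed.

Section Composition.
Variables (e b phi : nat -> F).
Hypotheses (e0 : e 0%N = 1) (phi0 : phi 0%N = 1).
Hypothesis phi_rec : forall n,
  n.+1%:R * phi n.+1 = \sum_(k < n.+1) k.+1%:R * b k.+1 * phi (n - k)%N.

Let E N := \poly_(i < N) e i.
Let Y N := 'X * E N.
Let B N := \poly_(i < N) b i.
Let P N := \poly_(i < N) phi i.

Hypothesis e_rec : forall n, n.+1%:R * e n.+1 =
  \sum_(k < n.+1) k.+1%:R * (B n.+2 \Po Y n.+2)`_k.+1 * e (n - k)%N.

Let Y0 N : (Y N)`_0 = 0. Proof. by rewrite /Y coefXM. Qed.

Lemma trunc_eqmodX a N M : (N <= M)%N -> eqmodX N (\poly_(i < M) a i) (\poly_(i < N) a i).
Proof.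
by move=> NM; apply/eqmodXP => i iN; rewrite !coef_poly iN (leq_trans iN).
Qed.

Lemma eqmodX_compr n p q q' : eqmodX n q q' -> eqmodX n (p \Po q) (p \Po q').
Proof.
move=> qq'; rewrite !comp_polyE; elim/big_ind2: _ => [|x1 x2 y1 y2 [r ->] [s ->]|i _].
- exact: eqmodX_refl.
- by exists (r + s); ring.
- by have [r ->] := eqmodXX i qq'; exists (p`_i *: r); rewrite scalerDr -scalerAl.
Qed.

(* Both sides satisfy the linear differential equation Q' = B(Y)' Q. *)
Lemma trunc_comp N : eqmodX N (E N) (P N \Po Y N).
Proof.
case: N => [|N]; first by apply/eqmodXP.
(* The equation for e uses truncations of varying order; they agree on the coefficients concerned
   because Y has no constant term. *)
have BY M : (M <= N.+1)%N -> eqmodX M (B M \Po Y M) (B N.+1 \Po Y N.+1).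
  move=> MN; apply: eqmodX_trans (eqmodX_comp _ (Y0 _)); last first.
    by apply: eqmodX_sym; exact: trunc_eqmodX.
  apply: eqmodX_compr; apply: eqmodXM; first exact: eqmodX_refl.
  by apply: eqmodX_sym; exact: trunc_eqmodX.
apply: (@eqmodX_ode _ (B N.+1 \Po Y N.+1)^`()).
- rewrite coef_poly e0 -horner_coef0 horner_comp !horner_coef0 Y0.
  by rewrite horner_coef0 coef_poly phi0.
- apply/eqmodXP => n lnN; rewrite coef_deriv coef_poly ltnS lnN -mulr_natl e_rec coefM.
  apply: eq_bigr => k _; rewrite coef_deriv coef_poly.
  have kn : (k <= n)%N by rewrite -ltnS.
  have -> : (n - k < N.+1)%N by lia.
  rewrite mulr_natl; congr (_ *+ _ * _).
  have /eqmodXP := BY n.+2 lnN; apply; lia.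
- rewrite !deriv_comp.
  have PB : eqmodX N (P N.+1)^`() ((B N.+1)^`() * P N.+1).
    apply/eqmodXP => n lnN; rewrite coef_deriv coef_poly ltnS lnN -mulr_natl phi_rec coefM.
    apply: eq_bigr => k _; rewrite coef_deriv !coef_poly mulr_natl.
    have kn : (k <= n)%N by rewrite -ltnS.
    have k1 : (k.+1 < N.+1)%N by lia.
    have k2 : (n - k < N.+1)%N by lia.
    by rewrite k1 k2.
  rewrite [_ * (P N.+1 \Po _)](_ : _ = ((B N.+1)^`() * P N.+1 \Po Y N.+1) * (Y N.+1)^`()).
    by apply: eqmodXM; [exact: eqmodX_comp|exact: eqmodX_refl].
  by rewrite comp_polyM; ring.
Qed.

(* Since Y^k = X^k Phi(Y)^k, the coefficient of X^n in Y^k is that of X^(n-k) in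
   Phi^k(Y), to which the induction hypothesis applies. *)
Lemma lagrange N n h : (0 < n <= N)%N ->
  n%:R * (h \Po Y N)`_n = (h^`() * P N ^+ n)`_n.-1.
Proof.
elim/ltn_ind: n h => n IH h /andP[n0 nN].
have YE k : eqmodX N.+1 (Y N ^+ k) ('X^k * (P N ^+ k \Po Y N)).
  have := eqmodXX k (eqmodX_mulX (trunc_comp N)).
  by rewrite [X in eqmodX _ _ X]exprMn exp_comp_poly.
have mono k : n%:R * (Y N ^+ k)`_n = k%:R * ('X^(k.-1) * P N ^+ n)`_n.-1.
  have /eqmodXP /(_ n nN) -> := YE k.
  case: k => [|k]; first by rewrite !expr0 comp_polyC mulr1 coef1 mul0r gtn_eqF // mulr0.
  rewrite coefXnM coefXnM /=.
  have -> : (n.-1 < k)%N = (n < k.+1)%N by lia.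
  case: ltnP => [_|kn]; first by rewrite !mulr0.
  have -> : (n.-1 - k = n - k.+1)%N by lia.
  (* For exponent n only the constant coefficient 1 of Phi is involved, and the induction hypothesis
     would have to be used at order 0. *)
  move: kn; rewrite leq_eqVlt => /orP[/eqP kn|kn].
    rewrite -kn subnn -!horner_coef0 horner_comp !horner_exp.
    rewrite -[0]/(0%:R) !horner_coef0 Y0 horner_coef0 /P coef_poly.
    by rewrite (leq_trans n0 nN) phi0 !expr1n.
  set m := (n - k.+1)%N.
  have mn : (m < n)%N by rewrite /m; lia.
  have m0 : (0 < m <= N)%N by rewrite /m; lia.
  have := IH m mn (P N ^+ k.+1) m0; rewrite deriv_exp /= => IHm.
  (* n Phi' Phi^(n-1) is the derivative of Phi^n; the induction hypothesis for h = Phi^(k+1) at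
     order m produces the same product Phi' Phi^(n-1). *)
  have DP : n%:R * ((P N)^`() * P N ^+ n.-1)`_m.-1 = m%:R * (P N ^+ n)`_m.
    have := coef_deriv (P N ^+ n) m.-1; rewrite (_ : m.-1.+1 = m) ?deriv_exp; last by rewrite /m; lia.
    by rewrite coefMn !mulr_natl.
  apply: (mulfI (_ : m%:R != 0 :> F)); first by rewrite pnatr_eq0; rewrite /m; lia.
  rewrite mulrCA IHm [RHS]mulrCA -DP.
  have -> : (P N)^`() * P N ^+ k *+ k.+1 * P N ^+ m =
            (P N)^`() * P N ^+ n.-1 *+ k.+1.
    by rewrite mulrnAl -mulrA -exprD; congr (_ * _ ^+ _ *+ _); rewrite /m; lia.
  by rewrite coefMn -mulr_natl; ring.
rewrite comp_polyE coef_sum big_distrr /= [in RHS](_ : h^`() = \sum_(i < size h) (h`_i * i%:R) *: 'X^(i.-1)).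
  rewrite mulr_suml coef_sum; apply: eq_bigr => i _.
  by rewrite -scalerAl !coefZ mulrCA mono; ring.
rewrite -[in LHS](coefK h) poly_def raddf_sum /=; apply: eq_bigr => i _.
by rewrite derivZ derivXn -scaler_nat scalerA.
Qed.

Lemma lagrange_coef n : (0 < n)%N -> n%:R * e n.-1 = (P n ^+ n)`_n.-1.
Proof.
move=> n0; have := @lagrange n n 'X; rewrite n0 leqnn => /(_ isT).
rewrite comp_polyX derivX mul1r /Y coefXM.
by case: n n0 => //= n _; rewrite coef_poly leqnn.
Qed.

End Composition.
End FormalSeries.

From mathcomp Require Import complex.
From mathcomp Require Import all_classical all_reals all_analysis measurable_realfun.
Import numFieldNormedType.Exports.
Local Open Scope classical_set_scope.
Local Open Scope ring_scope.

(** * Exponential generating functions of the graph classes *)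

Lemma binomial_div_fact (F : numFieldType) n k : (k <= n)%N ->
  'C(n, k)%:R / n`!%:R = k`!%:R^-1 / (n - k)`!%:R :> F.
Proof.
move=> kn; have fne j : j`!%:R != 0 :> F by rewrite pnatr_eq0 -lt0n fact_gt0.
rewrite -(bin_fact kn) !natrM; field.
by rewrite !fne pnatr_eq0 -lt0n bin_gt0 kn.
Qed.

Section GraphSeries.
Variables (R : realType) (G : graph_family).
Hypotheses (G_class : graph_class G) (G_stable : block_stable G).

Local Notation gn n := #|G n|.
Local Notation cn n := #|connected_subclass G n|.
Local Notation bn n := #|two_connected_subclass G n|.

(** Coefficients of E = C', that is of C^. shifted by one; [block_coef] gives likewise those of
    B'. *)
Definition conn_coef (n : nat) : R := (cn n.+1)%:R / n`!%:R.
Definition block_coef (n : nat) : R := (bn n.+1)%:R / n`!%:R.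

Let fne j : j`!%:R != 0 :> R. Proof. by rewrite pnatr_eq0 -lt0n fact_gt0. Qed.

Let ne1 j : j.+1%:R != 0 :> R. Proof. by rewrite pnatr_eq0. Qed.
Let ne2 j : j%:R + 1 != 0 :> R. Proof. by rewrite natr1. Qed.
Let ne3 j : 1 + j%:R != 0 :> R. Proof. by rewrite addrC natr1. Qed.

Lemma egf_pointed_connected n : egf_pointed R (connected_subclass G) n.+1 = conn_coef n.
Proof.
rewrite /egf_pointed /egf /conn_coef factS natrM; field.
by rewrite ?fne ?ne1 ?ne2 ?ne3.
Qed.

Lemma egf_pointed0 : egf_pointed R (connected_subclass G) 0 = 0.
Proof. by rewrite /egf_pointed mul0r. Qed.

Lemma pseries_diffs_blocks n :
  pseries_diffs (egf R (two_connected_subclass G)) n = block_coef n.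
Proof.
rewrite /pseries_diffs /egf /block_coef factS natrM; field.
by rewrite ?fne ?ne1 ?ne2 ?ne3.
Qed.

Lemma forest_count_coef m j N : (j < N)%N ->
  (forest_count G m j)%:R / j`!%:R = ((\poly_(i < N) conn_coef i) ^+ m)`_j.
Proof.
elim: m j => [|m IH] j jN /=.
  by rewrite expr0 coef1; case: j jN => [|j] _; rewrite ?mul0r // fact0 divr1.
rewrite exprS coefM natr_sum mulr_suml; apply: eq_bigr => k _.
have kj : (k <= j)%N by rewrite -ltnS.
rewrite coef_poly (leq_ltn_trans kj jN) -IH; last exact: leq_ltn_trans (leq_subr _ _) jN.
rewrite !natrM mulrAC binomial_div_fact // /conn_coef; ring.
Qed.

Lemma root_block_count_coef k N : (k < N)%N ->
  (root_block_count G k)%:R / k`!%:R =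
  ((\poly_(i < N) block_coef i) \Po ('X * \poly_(i < N) conn_coef i))`_k.
Proof.
move=> kN; rewrite comp_trunc_poly coef_sum natr_sum mulr_suml.
rewrite -(big_mkord xpredT (fun m => ('C(k, m) * (bn m.+1 * forest_count G m (k - m)))%:R / k`!%:R)).
rewrite -(big_mkord xpredT (fun i => (block_coef i *: ('X * \poly_(i < N) conn_coef i) ^+ i)`_k)).
(* Powers of X E with exponent above k do not reach degree k. *)
rewrite [RHS](big_cat_nat _ (n := k.+1)) //= [X in _ + X]big1_seq ?addr0; last first.
  move=> i; rewrite mem_index_iota => /= /andP[ki _].
  by rewrite exprMn coefZ coefXnM ki mulr0.
apply: eq_big_nat => m; rewrite ltnS => /= mk.
rewrite exprMn coefZ coefXnM ltnNge mk /=.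
rewrite -(forest_count_coef m (leq_ltn_trans (leq_subr m k) kN)).
rewrite !natrM mulrAC binomial_div_fact // /block_coef; ring.
Qed.

Lemma conn_coef_rec n : n.+1%:R * conn_coef n.+1 = \sum_(k < n.+1) k.+1%:R *
  ((\poly_(i < n.+2) block_coef i) \Po ('X * \poly_(i < n.+2) conn_coef i))`_k.+1 *
  conn_coef (n - k).
Proof.
rewrite {1}/conn_coef (card_connected_rec G_class G_stable) natr_sum mulr_suml mulr_sumr.
apply: eq_bigr => k _; have kn : (k <= n)%N by rewrite -ltnS.
rewrite -root_block_count_coef; last by rewrite !ltnS.
rewrite !factS !natrM.
have n1 : n.+1%:R != 0 :> R by rewrite pnatr_eq0.
have k1 : k.+1%:R != 0 :> R by rewrite pnatr_eq0.
transitivity ('C(n, k)%:R / n`!%:R * ((root_block_count G k.+1)%:R * (cn (n - k).+1)%:R) : R).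
  by field; rewrite ?fne ?ne1 ?ne2 ?ne3.
rewrite binomial_div_fact // /conn_coef; field.
by rewrite ?fne ?ne1 ?ne2 ?ne3.
Qed.

Lemma conn_coef0 : conn_coef 0 = 1.
Proof. by rewrite /conn_coef (card_connected1 G_class G_stable) fact0 divr1. Qed.

Lemma conn_coef_ge0 n : 0 <= conn_coef n.
Proof. by rewrite /conn_coef divr_ge0. Qed.

Lemma block_coef_ge0 n : 0 <= block_coef n.
Proof. by rewrite /block_coef divr_ge0. Qed.

Lemma block_coef1 : 1 <= block_coef 1.
Proof. by rewrite /block_coef divr1 ler1n (card_two_connected2 G_stable). Qed.

Lemma egf_family0 : egf R G 0 = 1.
Proof. by rewrite /egf (card_family0 G_class G_stable) divr1. Qed.

Lemma egf_ge0 n : 0 <= egf R G n.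
Proof. by rewrite /egf divr_ge0. Qed.

Lemma egf_family_rec n : n.+1%:R * egf R G n.+1 =
  \sum_(k < n.+1) conn_coef k * egf R G (n - k)%N.
Proof.
rewrite {1}/egf (card_family_rec G_class G_stable) natr_sum mulr_suml mulr_sumr.
apply: eq_bigr => k _; have kn : (k <= n)%N by rewrite -ltnS.
have n1 : n.+1%:R != 0 :> R by rewrite pnatr_eq0.
rewrite !factS !natrM.
transitivity ('C(n, k)%:R / n`!%:R * ((cn k.+1)%:R * (gn (n - k)%N)%:R) : R).
  by field; rewrite ?fne ?ne1 ?ne2 ?ne3.
by rewrite binomial_div_fact // /conn_coef /egf; field; rewrite !fne.
Qed.

End GraphSeries.

(** * Limits and elementary inequalities *)

Section Limits.
Variable R : realType.
Implicit Types (u v a : R^nat) (l b L : R).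

Lemma cvgn_dominated u v l n0 : (forall n, (n0 <= n)%N -> `|u n - l| <= v n) ->
  v @ \oo --> 0 -> u @ \oo --> l.
Proof.
move=> uv v0; apply/subr_cvg0/norm_cvg0P.
apply: (@squeeze_cvgr _ _ _ _ (cst 0) v) => //; last exact: cvg_cst.
by exists n0 => // n /= /uv; rewrite normr_ge0.
Qed.

Lemma eq_cvgn u v l n0 : (forall n, (n0 <= n)%N -> u n = v n) ->
  u @ \oo --> l -> v @ \oo --> l.
Proof.
move=> uv; apply: cvg_trans; apply: near_eq_cvg; by exists n0 => // n /= /uv ->.
Qed.

Lemma cvgn_sum (f : nat -> R^nat) (h : R^nat) J : (forall j, f j @ \oo --> h j) ->
  (fun n => \sum_(j < J) f j n) @ \oo --> \sum_(j < J) h j.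
Proof.
move=> fh; elim: J => [|J IH].
  by under eq_fun do rewrite big_ord0; rewrite big_ord0; exact: cvg_cst.
by under eq_fun do rewrite big_ord_recr; rewrite big_ord_recr; exact: cvgD.
Qed.

Lemma cvgn_le u l b n0 : u @ \oo --> l -> (forall n, (n0 <= n)%N -> u n <= b) -> l <= b.
Proof.
move=> ul ub; rewrite -(cvg_lim _ ul) //; apply: limr_le; first exact: cvgP ul.
by exists n0 => // n /= /ub.
Qed.

Lemma cvgn_ge u l b n0 : u @ \oo --> l -> (forall n, (n0 <= n)%N -> b <= u n) -> b <= l.
Proof.
move=> ul ub; rewrite -(cvg_lim _ ul) //; apply: limr_ge; first exact: cvgP ul.
by exists n0 => // n /= /ub.
Qed.

Lemma psum_le a L n : (forall k, 0 <= a k) ->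
  (fun n => \sum_(k < n) a k) @ \oo --> L -> \sum_(k < n) a k <= L.
Proof.
move=> a0 aL; apply: (cvgn_ge (n0 := n) aL) => m nm.
by rewrite -!(big_mkord xpredT) (big_cat_nat (n := n) (p := m)) //= lerDl sumr_ge0.
Qed.

Lemma psum_cvg a b : (forall k, 0 <= a k) -> (forall n, \sum_(k < n) a k <= b) ->
  exists L, (fun n => \sum_(k < n) a k) @ \oo --> L.
Proof.
move=> a0 ab; apply/cvg_ex; apply: nondecreasing_is_cvgn.
  by apply/nondecreasing_seqP => n; rewrite big_ord_recr /= lerDl.
by exists b => _ [n _ <-]; exact: ab.
Qed.

Lemma cvgn_sqrtV : (fun n => (Num.sqrt (n.+1%:R : R))^-1) @ \oo --> 0.
Proof.
have := cvg_comp _ _ (@cvg_harmonic R) (@sqrt_continuous R 0).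
rewrite sqrtr0; apply: cvg_trans; apply: near_eq_cvg.
by near=> n; rewrite /= sqrtrV.
Unshelve. all: by end_near. Qed.

End Limits.

Section Inequalities.
Variable R : realType.
Implicit Types (x y : R) (f df : R -> R).

(** Drives a ladder of Taylor bounds: most inequalities below apply it to a difference whose
    derivative is nonnegative by an earlier one. *)
Lemma ge0_deriv_ge f df x : (forall t : R, is_derive t (1 : R) f (df t)) ->
  (forall t, 0 <= t -> 0 <= df t) -> 0 <= x -> f 0 <= f x.
Proof.
move=> fd df0 x0; have [|c c0x fE] := @MVT_segment R f df 0 x x0 (fun t _ => fd t).
  apply: continuous_subspaceT => t; apply: differentiable_continuous.
  by apply/derivable1_diffP; exact: ex_derive.
rewrite -subr_ge0 fE subr0 mulr_ge0 // df0 //.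
by move: c0x; rewrite in_itv /= => /andP[].
Qed.

Lemma sin_le x : 0 <= x -> sin x <= x.
Proof.
move=> x0; have := @ge0_deriv_ge (fun t => t - sin t) (fun t => 1 - cos t) x.
by rewrite sin0 subr0 subr_ge0 => h; apply: h.
Qed.

Lemma cos_ge x : 0 <= x -> 1 - x ^+ 2 / 2 <= cos x.
Proof.
move=> x0; have := @ge0_deriv_ge (fun t => cos t - 1 + t ^+ 2 / 2) (fun t => - sin t + t) x.
rewrite cos0 expr0n /= mul0r addr0 subrr => h.
suff : 0 <= cos x - 1 + x ^+ 2 / 2 by lra.
apply: h => // t.
  apply: is_derive_eq; rewrite /GRing.scale /=; lra.
by move=> t0; have := sin_le t0; lra.
Qed.

Lemma cos_ge_lin x : 0 <= x -> 1 - x <= cos x.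
Proof.
move=> x0; have := @ge0_deriv_ge (fun t => cos t - 1 + t) (fun t => - sin t + 1) x.
rewrite cos0 addr0 subrr => h.
suff : 0 <= cos x - 1 + x by lra.
apply: h => // t.
  by apply: is_derive_eq; rewrite /GRing.scale /=; lra.
Qed.

Lemma sin_ge_quad x : 0 <= x -> x - x ^+ 2 / 2 <= sin x.
Proof.
move=> x0; have := @ge0_deriv_ge (fun t => sin t - t + t ^+ 2 / 2) (fun t => cos t - 1 + t) x.
rewrite sin0 expr0n /= mul0r addr0 subrr => h.
suff : 0 <= sin x - x + x ^+ 2 / 2 by lra.
apply: h => // t.
  apply: is_derive_eq; rewrite /GRing.scale /=; lra.
by move=> t0; have := cos_ge_lin t0; lra.
Qed.

Lemma cos_le_cub x : 0 <= x -> cos x <= 1 - x ^+ 2 / 2 + x ^+ 3 / 6.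
Proof.
move=> x0; have := @ge0_deriv_ge (fun t => 1 - t ^+ 2 / 2 + t ^+ 3 / 6 - cos t)
  (fun t => - t + t ^+ 2 / 2 + sin t) x.
rewrite cos0 !expr0n /= !mul0r addr0 subr0 subrr => h.
suff : 0 <= 1 - x ^+ 2 / 2 + x ^+ 3 / 6 - cos x by lra.
apply: h => // t.
  by apply: is_derive_eq; rewrite /GRing.scale /=; lra.
by move=> t0; have := sin_ge_quad t0; lra.
Qed.

Lemma sin_ge_cub x : 0 <= x -> x - x ^+ 3 / 6 <= sin x.
Proof.
move=> x0; have := @ge0_deriv_ge (fun t => sin t - t + t ^+ 3 / 6) (fun t => cos t - 1 + t ^+ 2 / 2) x.
rewrite sin0 expr0n /= mul0r addr0 subrr => h.
suff : 0 <= sin x - x + x ^+ 3 / 6 by lra.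
apply: h => // t.
  by apply: is_derive_eq; rewrite /GRing.scale /=; lra.
by move=> t0; have := cos_ge t0; lra.
Qed.

Lemma norm_cos_taylor x : `|cos x - 1 + x ^+ 2 / 2| <= `|x| ^+ 3.
Proof.
have h y : 0 <= y -> `|cos y - 1 + y ^+ 2 / 2| <= y ^+ 3.
  move=> y0; have := cos_ge y0; have := cos_le_cub y0.
  have y3 : 0 <= y ^+ 3 by rewrite exprn_ge0.
  by rewrite ler_norml; lra.
rewrite -[cos x]cos_norm -[x ^+ 2]real_normK ?num_real //; exact: h.
Qed.

Lemma norm_sin_taylor x : `|sin x - x| <= `|x| ^+ 3.
Proof.
have h y : 0 <= y -> `|sin y - y| <= y ^+ 3.
  move=> y0; have := sin_le y0; have := sin_ge_cub y0.
  have y3 : 0 <= y ^+ 3 by rewrite exprn_ge0.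
  by rewrite ler_norml; lra.
have [x0|x0] := leP 0 x; first by rewrite (ger0_norm x0) h.
rewrite (ltr0_norm x0); have := h (- x); rewrite oppr_ge0 (ltW x0) sinN => /(_ isT).
by rewrite (_ : - sin x - - x = - (sin x - x)) ?normrN //; ring.
Qed.

(** For |x| <= 1 the cubic bound suffices. Beyond 1, cos decreases up to pi, so 1 - cos x >= 1 - cos
    1 >= 1/3, while x^2 <= 16; hence 48 = 3 * 16. *)
Lemma cos_gap x : `|x| <= pi -> x ^+ 2 / 48 <= 1 - cos x.
Proof.
rewrite -[cos x]cos_norm -[x ^+ 2]real_normK ?num_real //.
move: (normr_ge0 x); set y := `|x| => y0 ypi.
have [y1|y1] := leP y 1.
  have := cos_le_cub y0; have : y ^+ 3 <= y ^+ 2.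
    by rewrite exprS ler_piMl // exprn_ge0.
  have : 0 <= y ^+ 2 by rewrite exprn_ge0.
  lra.
have : cos y <= cos 1.
  have [->//|ny1] := eqVneq y 1; apply/ltW; rewrite ltr_cos ?in_itv /= ?y0 ?ypi //.
  by have := @pi_ge2 R; lra.
have := @cos_le_cub 1 ler01; rewrite !expr1n.
have : y ^+ 2 <= 4 ^+ 2.
  rewrite ler_pXn2r ?nnegrE //; have := @pihalf_lt2 R; lra.
lra.
Qed.

End Inequalities.

(** * A local limit theorem *)

Section Cis.
Variable R : realType.
Implicit Types (x y t : R) (z w : R[i]).
Local Notation toC := (real_complex R).

Definition cis x : R[i] := Complex (cos x) (sin x).

Lemma cisD x y : cis (x + y) = cis x * cis y.
Proof. by apply/eqP; rewrite eq_complex /= cosD sinD [sin x * _ + _]addrC !eqxx. Qed.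

Lemma cis0 : cis 0 = 1.
Proof. by rewrite /cis cos0 sin0. Qed.

Lemma cisX x n : cis x ^+ n = cis (n%:R * x).
Proof.
elim: n => [|n IH]; first by rewrite expr0 mul0r cis0.
by rewrite exprS IH -cisD -natr1 mulrDl mul1r addrC.
Qed.

Lemma normc_cis x : Normc.normc (cis x) = 1.
Proof. by rewrite /Normc.normc /= cos2Dsin2 sqrtr1. Qed.

Lemma normc_real x : Normc.normc (toC x) = `|x|.
Proof. by rewrite /Normc.normc /= expr0n /= addr0 sqrtr_sqr. Qed.

Lemma normcX z n : Normc.normc (z ^+ n) = Normc.normc z ^+ n.
Proof.
elim: n => [|n IH]; first by rewrite !expr0 Normc.normc1.
by rewrite !exprS Normc.normcM IH.
Qed.

Lemma normc_ge0 z : 0 <= Normc.normc z.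
Proof. by case: z => a b; exact: sqrtr_ge0. Qed.

Lemma normc_le z : Normc.normc z <= `|complex.Re z| + `|complex.Im z|.
Proof.
case: z => a b /=; rewrite -[leRHS]ger0_norm ?addr_ge0 // -sqrtr_sqr ler_wsqrtr //.
rewrite sqrrD !real_normK ?num_real // addrAC lerDl mulrn_wge0 // mulr_ge0 //.
Qed.

Lemma norm_Re_le z : `|complex.Re z| <= Normc.normc z.
Proof.
by case: z => a b /=; rewrite -sqrtr_sqr ler_wsqrtr // lerDl sqr_ge0.
Qed.

Lemma Re_sub z w : complex.Re (z - w) = complex.Re z - complex.Re w. Proof. by case: z; case: w. Qed.

Lemma normc_sum (I : Type) (r : seq I) (P : pred I) (F : I -> R[i]) :
  Normc.normc (\sum_(i <- r | P i) F i) <= \sum_(i <- r | P i) Normc.normc (F i).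
Proof.
elim/big_ind2: _ => [|u a v b ua vb|//]; first by rewrite Normc.normc0.
exact: le_trans (le_normcD _ _) (lerD ua vb).
Qed.

Lemma normc_expB z w n : Normc.normc z <= 1 -> Normc.normc w <= 1 ->
  Normc.normc (z ^+ n - w ^+ n) <= n%:R * Normc.normc (z - w).
Proof.
move=> z1 w1; elim: n => [|n IH]; first by rewrite !expr0 subrr Normc.normc0 mul0r.
have -> : z ^+ n.+1 - w ^+ n.+1 = z * (z ^+ n - w ^+ n) + (z - w) * w ^+ n by rewrite !exprS; ring.
apply: le_trans (le_normcD _ _) _; rewrite !Normc.normcM normcX -natr1 mulrDl mul1r.
apply: lerD.
  by apply: le_trans IH; rewrite ler_piMl ?normc_ge0.
by rewrite ler_piMr ?normc_ge0 // exprn_ile1 ?normc_ge0.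
Qed.

Lemma Re_sum (I : Type) (r : seq I) (P : pred I) (F : I -> R[i]) :
  complex.Re (\sum_(i <- r | P i) F i) = \sum_(i <- r | P i) complex.Re (F i).
Proof. by apply: (big_morph (@complex.Re R)) => // -[a b] [c d]. Qed.

Lemma Im_sum (I : Type) (r : seq I) (P : pred I) (F : I -> R[i]) :
  complex.Im (\sum_(i <- r | P i) F i) = \sum_(i <- r | P i) complex.Im (F i).
Proof. by apply: (big_morph (@complex.Im R)) => // -[a b] [c d]. Qed.

Lemma Re_toCM x z : complex.Re (toC x * z) = x * complex.Re z.
Proof. by case: z => a b /=; rewrite mul0r subr0. Qed.

Lemma Im_toCM x z : complex.Im (toC x * z) = x * complex.Im z.
Proof. by case: z => a b /=; rewrite mul0r addr0. Qed.

Lemma horner_cis (q : {poly R}) x y :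
  (map_poly toC q).[cis x] * cis y = \sum_(j < size q) toC q`_j * cis (j%:R * x + y).
Proof.
rewrite (horner_coef_wide _ (n := size q)); last by rewrite size_map_poly.
rewrite mulr_suml; apply: eq_bigr => j _.
by rewrite coef_map /= cisX cisD mulrA.
Qed.

Lemma horner_cis_poly n (a : nat -> R) x y :
  (map_poly toC (\poly_(i < n) a i)).[cis x] * cis y =
  \sum_(j < n) toC (a j) * cis (j%:R * x + y).
Proof.
rewrite (horner_coef_wide _ (n := n)); last first.
  by rewrite size_map_poly; exact: size_poly.
rewrite mulr_suml; apply: eq_bigr => j _.
by rewrite coef_map /= coef_poly ltn_ord cisX cisD mulrA.
Qed.

Lemma expRN_taylor x : 0 <= x -> `|expR (- x) - 1 + x| <= x ^+ 2.
Proof.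
move=> x0.
have := @ge0_deriv_ge R (fun t => 1 - t + t ^+ 2 - expR (- t)) (fun t => - 1 + t *+ 2 + expR (- t)) x.
rewrite oppr0 expR0 expr0n /= !addr0 subrr => h.
suff h2 : 0 <= 1 - x + x ^+ 2 - expR (- x).
  have := expR_ge1Dx (- x); have : 0 <= x ^+ 2 by rewrite sqr_ge0.
  by rewrite ler_norml; lra.
apply: h => // t.
  by apply: is_derive_eq; rewrite /GRing.scale /=; lra.
by move=> t0; have := expR_ge1Dx (- t); lra.
Qed.

Lemma cis_sub1 x : Normc.normc (cis x - 1) <= 2 * `|x|.
Proof.
apply: le_trans (normc_le _) _ => /=; rewrite oppr0 addr0.
wlog x0 : x / 0 <= x => [hw|].
  have [/hw //|x0] := leP 0 x.
  have := hw (- x); rewrite oppr_ge0 (ltW x0) cosN sinN !normrN; exact.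
have := cos_ge_lin x0; have := sin_le x0; have := sin_ge_quad x0.
have := cos_le1 x; have := sin_geN1 x => h1 h2 h3 h4 h5.
rewrite (ger0_norm x0) (_ : `|cos x - 1| = 1 - cos x); last by rewrite ler0_norm; lra.
have h6 : `|sin x| <= x.
  rewrite ler_norml h4 andbT; have [x1|x1] := leP x 1; last by lra.
  have : x ^+ 2 <= x by rewrite expr2 ler_piMl.
  lra.
lra.
Qed.

End Cis.

(** * The characteristic function of p *)

Section Pointwise.
Variables (R : realType) (p : R^nat) (M : R).
Hypothesis p_ge0 : forall k, 0 <= p k.
Hypothesis p_sum : (fun n => \sum_(k < n) p k) @ \oo --> (1 : R).
Hypothesis p_mean : (fun n => \sum_(k < n) k%:R * p k) @ \oo --> (1 : R).
Hypothesis p_third : forall n, \sum_(k < n) k%:R ^+ 3 * p k <= M.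
Hypotheses (p0_gt0 : 0 < p 0) (p1_gt0 : 0 < p 1).
Local Notation toC := (real_complex R).

Let M_ge0 : 0 <= M.
Proof. by have := p_third 0; rewrite big_ord0. Qed.

Lemma psum_le1 n : \sum_(k < n) p k <= 1.
Proof. exact: psum_le. Qed.

(** Markov's inequality for the third moment. It controls what is lost when p is truncated at n. *)
Lemma tail_le (a : R^nat) L c n : (fun n => \sum_(k < n) a k) @ \oo --> L ->
  (forall k, (n <= k)%N -> c * a k <= k%:R ^+ 3 * p k) ->
  c * (L - \sum_(k < n) a k) <= M.
Proof.
move=> aL ca; rewrite mulrBr lerBlDr.
have cL : (fun n => c * \sum_(k < n) a k) @ \oo --> c * L by apply: cvgMr.
apply: (cvgn_le (n0 := n) cL) => m nm.
rewrite -!(big_mkord xpredT) (big_cat_nat (n := n) (p := m)) //= mulrDr addrC lerD2r.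
rewrite mulr_sumr; apply: le_trans (p_third m).
rewrite -(big_mkord xpredT (fun k => k%:R ^+ 3 * p k)).
rewrite [leRHS](big_cat_nat (n := n) (p := m)) //=.
rewrite -[leLHS]add0r; apply: lerD.
  by apply: sumr_ge0 => k _; rewrite mulr_ge0 // exprn_ge0.
by apply: ler_sum_nat => k /andP[nk _]; exact: ca.
Qed.

Let A n := \sum_(k < n) p k.
Let B n := \sum_(k < n) p k * (k%:R - 1) ^+ 2.

Lemma psum_tail n : n%:R ^+ 3 * (1 - A n) <= M.
Proof.
apply: (@tail_le p 1 (n%:R ^+ 3) n p_sum) => k nk; rewrite ler_wpM2r //.
by rewrite lerXn2r ?nnegrE ?ler_nat.
Qed.

Lemma mean_tail n : n%:R ^+ 2 * (1 - \sum_(k < n) k%:R * p k) <= M.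
Proof.
apply: (@tail_le (fun k => k%:R * p k) 1 (n%:R ^+ 2) n p_mean) => k nk; rewrite mulrA ler_wpM2r // [k%:R ^+ 3]exprSr ler_wpM2r //.
by rewrite lerXn2r ?nnegrE ?ler_nat.
Qed.

Let cube_ge k : (k%:R - 1) ^+ 2 <= 1 + k%:R ^+ 3 :> R.
Proof.
case: k => [|k]; first by rewrite expr0n /= addr0 sub0r sqrrN expr1n.
rewrite -natr1 addrK; have : (0 : R) <= k%:R by [].
move: (k%:R) => x x0; have : 0 <= x ^+ 2 by rewrite exprn_ge0.
have : 0 <= x ^+ 3 by rewrite exprn_ge0.
lra.
Qed.

Let cube_ge3 k : `|k%:R - 1| ^+ 3 <= 1 + k%:R ^+ 3 :> R.
Proof.
case: k => [|k]; first by rewrite expr0n /= addr0 sub0r normrN normr1 expr1n.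
rewrite -natr1 addrK ger0_norm //; have : (0 : R) <= k%:R by [].
move: (k%:R) => x x0; have : 0 <= x ^+ 2 by rewrite exprn_ge0.
have : 0 <= x ^+ 3 by rewrite exprn_ge0.
lra.
Qed.

Lemma abs_third_moment n : \sum_(k < n) p k * `|k%:R - 1| ^+ 3 <= 1 + M.
Proof.
apply: le_trans (lerD (psum_le1 n) (p_third n)); rewrite -big_split /=.
apply: ler_sum => k _; rewrite (_ : p k + _ = p k * (1 + k%:R ^+ 3)) ?ler_wpM2l //; ring.
Qed.

(** Positive because the value 0, at distance 1 from the mean, has probability p_0 > 0. *)
Lemma variance_exists : exists2 s2 : R, 0 < s2 & B @ \oo --> s2.
Proof.
have B0 k : 0 <= p k * (k%:R - 1) ^+ 2 by rewrite mulr_ge0 ?sqr_ge0.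
have [|s2 Bs2] := @psum_cvg R (fun k => p k * (k%:R - 1) ^+ 2) (1 + M) B0.
  move=> n; apply: le_trans (lerD (psum_le1 n) (p_third n)); rewrite -big_split /=.
  apply: ler_sum => k _; rewrite (_ : p k + _ = p k * (1 + k%:R ^+ 3)) ?ler_wpM2l //; ring.
exists s2 => //; apply: (lt_le_trans p0_gt0); apply: (cvgn_ge (n0 := 1) Bs2) => -[//|n] _.
by rewrite big_ord_recl /= sub0r sqrrN expr1n mulr1 lerDl sumr_ge0.
Qed.

(* The modulus of the characteristic function is controlled by its first two
   terms p_0 + p_1 exp(i x) alone. *)
Lemma char_gap n x : (1 < n)%N -> `|x| <= pi ->
  Normc.normc (map_poly toC (\poly_(i < n) p i)).[cis x] <=
  expR (- (p 0 * p 1 / (48 * (p 0 + p 1)) * x ^+ 2)).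
Proof.
move=> n1 xpi; set c := p 0 * p 1 / (48 * (p 0 + p 1)).
apply: le_trans (expR_ge1Dx _).
have := horner_cis_poly n p x 0; rewrite cis0 mulr1 => ->.
case: n n1 => [//|[//|n]] _; rewrite !big_ord_recl addrA.
apply: le_trans (le_normcD _ _) _.
have := psum_le1 n.+2; rewrite !big_ord_recl addrA => A1.
apply: le_trans (lerD (lexx _) (normc_sum _ _ _)) _.
under [X in _ + X <= _]eq_bigr => i _ do rewrite Normc.normcM normc_cis mulr1 normc_real ger0_norm //.
set S := \sum_(i < n) _ in A1 *.
rewrite /= /bump /= !(mul0r, mulr0, addr0, subr0, add0r, mul1r, mulr1, cos0, sin0, addn0).
suff h : Num.sqrt ((p 0 + p 1 * cos x) ^+ 2 + (p 1 * sin x) ^+ 2) <= p 0 + p 1 - c * x ^+ 2.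
  by apply: le_trans (lerD h (lexx S)) _; rewrite addrAC lerD2r.
have A0 : 0 < p 0 + p 1 by rewrite addr_gt0.
have gap := cos_gap xpi.
have c1 := cos_geN1 x.
have A00 : p 0 + p 1 != 0 by rewrite gt_eqF.
(* Chosen so that (p_0 + p_1 - y)^2 exceeds the squared modulus of p_0 + p_1 exp(ix) by exactly
   y^2. *)
set y := p 0 * p 1 * (1 - cos x) / (p 0 + p 1).
have cy : c * x ^+ 2 <= y.
  rewrite /c /y (_ : _ * x ^+ 2 = p 0 * p 1 * (x ^+ 2 / 48) / (p 0 + p 1)); last by field.
  by rewrite ler_pM2r ?invr_gt0 // ler_pM2l ?mulr_gt0.
have y1 : y <= p 0 + p 1.
  rewrite /y ler_pdivrMr //.
  have : p 0 * p 1 * (1 - cos x) <= p 0 * p 1 * 2 by rewrite ler_pM2l ?mulr_gt0 //; lra.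
  have := sqr_ge0 (p 0 - p 1); have := sqr_ge0 (p 0); have := sqr_ge0 (p 1); rewrite -!expr2; lra.
apply: le_trans (lerB (lexx _) cy); rewrite -[leRHS]ger0_norm ?subr_ge0 // -sqrtr_sqr ler_wsqrtr //.
have -> : (p 0 + p 1 - y) ^+ 2 = (p 0 + p 1) ^+ 2 - 2 * (p 0 * p 1 * (1 - cos x)) + y ^+ 2.
  by rewrite /y; field.
have -> : (p 0 + p 1 * cos x) ^+ 2 + (p 1 * sin x) ^+ 2 =
    (p 0 + p 1) ^+ 2 - 2 * (p 0 * p 1 * (1 - cos x)).
  by rewrite [(p 1 * sin x) ^+ 2]exprMn sin2cos2; ring.
by rewrite lerDl sqr_ge0.
Qed.

(** With N = n+1, the N-th powers of two numbers in the unit disc differ by at most N times the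
    difference of the bases, here the centred characteristic function at t/s and exp(-s2 t^2 /
    (2N)). The six terms over s are, in order: mass lost by truncation, cubic error of cos,
    quadratic error of exp, truncated mean of k - 1, cubic error of sin, and the phase n in place of
    N. The last summand compares the truncated variance with s2. *)
Lemma pointwise_bound s2 n t s : 0 <= s2 -> s = Num.sqrt (n.+1%:R : R) ->
  `| complex.Re ((map_poly toC (\poly_(i < n.+1) p i)).[cis (t / s)] ^+ n.+1
                   * cis (- n%:R * (t / s)))
     - expR (- (s2 * t ^+ 2 / 2)) | <=
  (M + (1 + M) * `|t| ^+ 3 + (s2 * t ^+ 2 / 2) ^+ 2 + (M + M) * `|t| + (1 + M) * `|t| ^+ 3 + 2 * `|t|) / s
  + t ^+ 2 / 2 * `|B n.+1 - s2|.
Proof.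
move=> s2_ge0 sE; set N := n.+1; set x := t / s.
have N0 : 0 < N%:R :> R by rewrite ltr0n.
have s0 : 0 < s by rewrite sE sqrtr_gt0.
have sN : s ^+ 2 = N%:R by rewrite sE sqr_sqrtr // ltW.
have s1 : 1 <= s.
  by have := @ler_wsqrtr R 1 N%:R; rewrite sqrtr1 -sE ler1n; apply.
have sn0 : s != 0 by rewrite gt_eqF.
have sV : s^-1 <= 1 by rewrite invf_le1.
have sV0 : 0 <= s^-1 by rewrite invr_ge0 ltW.
set y := s2 * t ^+ 2 / 2.
have y0 : 0 <= y by rewrite /y divr_ge0 // mulr_ge0 ?sqr_ge0.
set w := toC (expR (- (y / N%:R))).
pose z := \sum_(k < N) toC (p k) * cis ((k%:R - 1) * x).
have zE : (map_poly toC (\poly_(i < N) p i)).[cis x] ^+ N * cis (- n%:R * x) = z ^+ N * cis x.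
  (* Centring all N factors takes the phase N x; one factor [cis x] remains. *)
  have -> : cis (- n%:R * x) = cis (- x) ^+ N * cis x.
    by rewrite cisX -cisD; congr cis; rewrite -natr1; ring.
  rewrite mulrA -exprMn; congr (_ ^+ _ * _).
  by rewrite horner_cis_poly; apply: eq_bigr => k _; congr (_ * cis _); ring.
have wN : w ^+ N = toC (expR (- y)).
  rewrite /w -rmorphXn /= -expRM_natl; congr (toC (expR _)).
  by field; rewrite gt_eqF.
rewrite zE (_ : expR (- y) = complex.Re (w ^+ N)); last by rewrite wN.
rewrite -Re_sub; apply: le_trans (norm_Re_le _) _.
have -> : z ^+ N * cis x - w ^+ N = (z ^+ N - w ^+ N) * cis x + w ^+ N * (cis x - 1) by ring.
apply: le_trans (le_normcD _ _) _; rewrite !Normc.normcM normc_cis mulr1 wN normc_real.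
have z1 : Normc.normc z <= 1.
  apply: le_trans (normc_sum _ _ _) _; apply: le_trans (psum_le1 N).
  by apply: ler_sum => k _; rewrite Normc.normcM normc_cis mulr1 normc_real ger0_norm.
have w1 : Normc.normc w <= 1.
  by rewrite normc_real ger0_norm ?expR_ge0 // -expR0 ler_expR oppr_le0 divr_ge0 // ltW.
have e1 : `|expR (- y)| <= 1 by rewrite ger0_norm ?expR_ge0 // -expR0 ler_expR oppr_le0.
have := normc_expB N z1 w1; rewrite wN => zw.
have x1 : `|x| = `|t| / s by rewrite /x normrM [`|s^-1|]ger0_norm.
have cx := cis_sub1 x.
have u1 : `|expR (- y)| * Normc.normc (cis x - 1) <= 2 * `|t| / s.
  rewrite -mulrA -x1; apply: le_trans cx; rewrite ler_piMl ?normc_ge0 //.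
have zw2 := normc_le (z - w).
have ReE : complex.Re (z - w) = \sum_(k < N) p k * cos ((k%:R - 1) * x) - expR (- (y / N%:R)).
  by rewrite Re_sub Re_sum; congr (_ - _); apply: eq_bigr => k _; rewrite Re_toCM.
have ImE : complex.Im (z - w) = \sum_(k < N) p k * sin ((k%:R - 1) * x).
  rewrite (_ : complex.Im (z - w) = complex.Im z); last by rewrite /w; case: (z) => a b /=; rewrite subr0.
  by rewrite Im_sum; apply: eq_bigr => k _; rewrite Im_toCM.
have third (f : R -> R) : (forall v, `|f v| <= `|v| ^+ 3) ->
    N%:R * `|\sum_(k < N) p k * f ((k%:R - 1) * x)| <= (1 + M) * `|t| ^+ 3 / s.
  move=> hf; have : `|\sum_(k < N) p k * f ((k%:R - 1) * x)| <= (1 + M) * `|x| ^+ 3.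
    apply: le_trans (ler_norm_sum _ _ _) _.
    apply: le_trans (ler_wpM2r _ (abs_third_moment N)); last by rewrite exprn_ge0.
    rewrite mulr_suml; apply: ler_sum => k _; rewrite normrM ger0_norm // -mulrA ler_wpM2l //.
    by apply: le_trans (hf _) _; rewrite normrM exprMn.
  move=> h; apply: le_trans (ler_wpM2l (ltW N0) h) _.
  rewrite x1 -sN le_eqVlt; apply/orP; left; apply/eqP; by field.
have A1 := psum_le1 N.
have t0 : N%:R * (1 - A N) <= M / s.
  have : N%:R ^+ 3 * (1 - A N) <= M by exact: psum_tail.
  have hA : 0 <= 1 - A N by rewrite subr_ge0.
  rewrite -sN => h; rewrite ler_pdivlMr //; apply: le_trans h.
  rewrite mulrAC; apply: ler_wpM2r => //.
  have -> : (s ^+ 2) ^+ 3 = s ^+ 2 * s * s ^+ 3 by ring.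
  by rewrite ler_peMr ?exprn_ege1 // mulr_ge0 ?exprn_ge0 // ltW.
have t1 : N%:R * (`|x| * `|\sum_(k < N) p k * (k%:R - 1)|) <= (M + M) * `|t| / s.
  have h1 : N%:R ^+ 2 * `|\sum_(k < N) p k * (k%:R - 1)| <= M + M.
    have -> : \sum_(k < N) p k * (k%:R - 1) = (1 - A N) - (1 - \sum_(k < N) k%:R * p k).
      transitivity (\sum_(k < N) k%:R * p k - A N); last by ring.
      by rewrite /A -sumrB; apply: eq_bigr => k _; ring.
    apply: le_trans (ler_wpM2l _ (ler_normB _ _)) _; first by rewrite exprn_ge0.
    have m1 : \sum_(k < N) k%:R * p k <= 1.
      by apply: (@psum_le R (fun k => k%:R * p k)) => // k; rewrite mulr_ge0.
    rewrite mulrDr !ger0_norm ?subr_ge0 //; apply: lerD; last exact: mean_tail.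
    have := psum_tail N; apply: le_trans; rewrite ler_wpM2r ?subr_ge0 //.
    by rewrite ler_weXn2l // ler1n.
  rewrite mulrCA x1; have N1 : 1 <= N%:R :> R by rewrite ler1n.
  have h2 : N%:R * `|\sum_(k < N) p k * (k%:R - 1)| <= M + M.
    apply: le_trans h1; rewrite ler_wpM2r // expr2 ler_peMr // ltW.
  have : `|t| / s * (N%:R * `|\sum_(k < N) p k * (k%:R - 1)|) <= `|t| / s * (M + M).
    by rewrite ler_wpM2l // divr_ge0 // ltW.
  by move=> h; apply: le_trans h _; rewrite mulrAC [`|t| * _]mulrC.
have reB : N%:R * `|complex.Re (z - w)| <=
   (M + (1 + M) * `|t| ^+ 3 + y ^+ 2) / s + t ^+ 2 / 2 * `|B N - s2|.
  have -> : complex.Re (z - w) = - (1 - A N)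
      + \sum_(k < N) p k * (cos ((k%:R - 1) * x) - 1 + ((k%:R - 1) * x) ^+ 2 / 2)
      - (expR (- (y / N%:R)) - 1 + y / N%:R) - x ^+ 2 / 2 * (B N - s2).
    rewrite ReE; have -> : \sum_(k < N) p k * (cos ((k%:R - 1) * x) - 1 + ((k%:R - 1) * x) ^+ 2 / 2)
       = \sum_(k < N) p k * cos ((k%:R - 1) * x) - A N + x ^+ 2 / 2 * B N.
      by rewrite /A /B mulr_sumr -sumrB -big_split /=; apply: eq_bigr => k _; ring.
    rewrite /y /x -sN; field; done.
  apply: le_trans (ler_wpM2l (ltW N0) (ler_normB _ _)) _.
  rewrite mulrDr; apply: lerD; last first.
    have hx : N%:R * `|x ^+ 2 / 2| = t ^+ 2 / 2.
      by rewrite ger0_norm ?divr_ge0 ?sqr_ge0 // /x -sN; field.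
    by rewrite normrM mulrA hx.
  rewrite mulrDl; apply: le_trans (ler_wpM2l (ltW N0) (ler_normB _ _)) _.
  rewrite mulrDr; apply: lerD; last first.
    apply: le_trans (ler_wpM2l (ltW N0) (expRN_taylor _)) _; first by rewrite divr_ge0 // ltW.
    rewrite -sN; have -> : s ^+ 2 * (y / s ^+ 2) ^+ 2 = y ^+ 2 / s / s by field.
    by rewrite ler_piMr // divr_ge0 ?sqr_ge0 // ltW.
  rewrite mulrDl; apply: le_trans (ler_wpM2l (ltW N0) (ler_normD _ _)) _.
  rewrite mulrDr; apply: lerD.
    by rewrite normrN ger0_norm // subr_ge0.
  by apply: (third (fun v => cos v - 1 + v ^+ 2 / 2)) => v; exact: norm_cos_taylor.
have imB : N%:R * `|complex.Im (z - w)| <= ((M + M) * `|t| + (1 + M) * `|t| ^+ 3) / s.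
  have -> : complex.Im (z - w) = x * (\sum_(k < N) p k * (k%:R - 1))
      + \sum_(k < N) p k * (sin ((k%:R - 1) * x) - (k%:R - 1) * x).
    by rewrite ImE mulr_sumr -big_split /=; apply: eq_bigr => k _; ring.
  apply: le_trans (ler_wpM2l (ltW N0) (ler_normD _ _)) _.
  rewrite mulrDr mulrDl normrM; apply: lerD => //.
  by apply: (third (fun v => sin v - v)) => v; exact: norm_sin_taylor.
have := ler_wpM2l (ltW N0) zw2; rewrite mulrDr => zw3.
have := lerD (le_trans zw (le_trans zw3 (lerD reB imB))) u1.
move/le_trans; apply; rewrite le_eqVlt; apply/orP; left; apply/eqP; by field.
Qed.

End Pointwise.

(** * Fourier inversion and the local limit *)

Section Fourier.
Variable R : realType.
Local Notation mu := (@lebesgue_measure R).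
Local Notation toC := (real_complex R).

Lemma sin_natpi n : sin (n%:R * pi) = 0 :> R.
Proof.
elim: n => [|n IH]; first by rewrite mul0r sin0.
by rewrite -natr1 mulrDl mul1r sinD IH sinpi mul0r mulr0 addr0.
Qed.

Lemma sin_subnatpi j m : sin ((j%:R - m%:R) * pi) = 0 :> R.
Proof. by rewrite mulrBl sinB !sin_natpi mul0r mulr0 subr0. Qed.

(** The real part of q(exp(ix)) exp(-imx) at x = t/s. *)
Definition trig_poly (q : {poly R}) m (s t : R) :=
  \sum_(j < size q) q`_j * cos ((j%:R - m%:R) * (t / s)).

Let anti m s (j : nat) (t : R) : R :=
  if j == m then t else sin ((j%:R - m%:R) * (t / s)) * (s / (j%:R - m%:R)).

Let anti_derive m s (j : nat) (t : R) : s != 0 ->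
  is_derive t (1 : R) (anti m s j) (cos ((j%:R - m%:R) * (t / s))).
Proof.
move=> s0; rewrite /anti; have [->|jm] := eqVneq j m.
  by rewrite subrr mul0r cos0; exact: is_derive_id.
have jm0 : j%:R - m%:R != 0 :> R by rewrite subr_eq0 eqr_nat.
set c := j%:R - m%:R in jm0 *.
have -> : (fun t0 : R => sin (c * (t0 / s)) * (s / c)) =
          (s / c) *: (@sin R \o ( *%R (c / s))).
  apply/funext => u /=; rewrite /GRing.scale /= mulrC; congr (_ * sin _).
  by rewrite mulrCA mulrC; congr (_ * _); rewrite mulrC.
have h : is_derive t (1 : R) ( *%R (c / s)) (c / s).
  by apply: is_derive_eq; rewrite /GRing.scale /= mulr1.
apply: is_derive_eq; rewrite /GRing.scale /= mulrCA (_ : s / c * (c / s) = 1); last first.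
  by field; rewrite jm0 s0.
by rewrite mulr1; congr cos; ring.
Qed.

Lemma continuous_trig_poly q m s : continuous (trig_poly q m s).
Proof.
move=> t; rewrite /trig_poly.
have -> : (fun t => \sum_(j < size q) q`_j * cos ((j%:R - m%:R) * (t / s))) =
  \sum_(j < size q) (fun t => q`_j * cos ((j%:R - m%:R) * (t / s))).
  by apply/funext => u; rewrite fct_sumE.
elim/big_ind: _ => [|f g cf cg|j _]; first exact: cst_continuous.
  exact: continuousD.
apply: cvgMr; apply: (cvg_comp (fun u : R => (j%:R - m%:R) * (u / s)) (@cos R)).
  by apply: cvgMr; apply: cvgMl; exact: cvg_id.
exact: continuous_cos.
Qed.

(** Orthogonality over a period: for j other than m the antiderivative vanishes at both ends,
    because sin((j - m) pi) = 0. *)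
Lemma integral_trig_poly q m (s : R) : 0 < s ->
  (\int[mu]_(t in `[(- (pi * s))%R, (pi * s)%R]) (trig_poly q m s t)%:E =
    (2 * pi * s * q`_m)%R%:E)%E.
Proof.
move=> s0; have sn0 : s != 0 by rewrite gt_eqF.
pose F := \sum_(j < size q) (fun t => q`_j * anti m s j t).
have dF t : is_derive t (1 : R) F (trig_poly q m s t).
  apply: is_derive_sum => j; have := anti_derive m j t sn0 => h.
  exact: (@is_deriveZ _ _ _ (anti m s j) q`_j).
have cF : continuous F.
  move=> t; apply: differentiable_continuous; apply/derivable1_diffP; exact: ex_derive.
rewrite (@continuous_FTC2 _ _ F).
- rewrite -EFinB /F !fct_sumE -sumrB; congr EFin.
  have E j : q`_j * anti m s j (pi * s) - q`_j * anti m s j (- (pi * s)) =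
      if j == m then 2 * pi * s * q`_m else 0.
    rewrite /anti; have [->|jm] := eqVneq j m; first by ring.
    have -> : pi * s / s = pi by rewrite mulfK.
    have -> : - (pi * s) / s = - pi by rewrite mulNr mulfK.
    by rewrite mulrN sinN sin_subnatpi oppr0 !mul0r mulr0 subrr.
  under eq_bigr => j _ do rewrite E.
  rewrite -big_mkcond /=; have [mq|mq] := ltnP m (size q).
    by rewrite (big_pred1 (Ordinal mq)).
  rewrite nth_default // mulr0 big_pred0 // => j.
  by apply/negbTE; rewrite neq_ltn (leq_trans (ltn_ord j) mq).
- by have : 0 < pi * s; [rewrite mulr_gt0 ?pi_gt0|lra].
- by apply: continuous_subspaceT; exact: continuous_trig_poly.
- split=> [t _||]; first exact: ex_derive.
    exact: cvg_at_right_filter (cF _).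
  exact: cvg_at_left_filter (cF _).
- by move=> t _; rewrite derive1E derive_val.
Qed.

(** The integrand is a multiple of the normal density of variance 1/(2c). *)
Lemma gauss_integral c : 0 < c ->
  mu.-integrable setT (fun t : R => (expR (- (c * t ^+ 2)))%:E) /\
  exists2 I : R, 0 < I & (\int[mu]_t (expR (- (c * t ^+ 2)))%:E = I%:E)%E.
Proof.
move=> c0; pose sg : R := Num.sqrt (2 * c)^-1.
have sg0 : sg != 0 by rewrite gt_eqF // sqrtr_gt0 invr_gt0 mulr_gt0.
have pk0 := normal_peak_gt0 sg0; have pkn0 : normal_peak sg != 0 by rewrite gt_eqF.
have E : (fun t : R => (expR (- (c * t ^+ 2)))%:E) =
         (fun t => ((normal_peak sg)^-1)%:E * (normal_pdf 0 sg t)%:E)%E.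
  apply/funext => t; rewrite normal_pdfE // -EFinM mulKf //; congr (expR _)%:E.
  rewrite subr0 sqr_sqrtr ?invr_ge0 ?mulr_ge0 // ?ltW //; field.
  by rewrite gt_eqF.
rewrite E; split; first by apply: integrableZl => //; exact: integrable_normal_pdf.
exists (normal_peak sg)^-1; first by rewrite invr_gt0.
by rewrite integralZl ?integral_normal_pdf ?mule1 //; exact: integrable_normal_pdf.
Qed.

Variables (p : R^nat) (M : R).
Hypothesis p_ge0 : forall k, 0 <= p k.
Hypothesis p_sum : (fun n => \sum_(k < n) p k) @ \oo --> (1 : R).
Hypothesis p_mean : (fun n => \sum_(k < n) k%:R * p k) @ \oo --> (1 : R).
Hypothesis p_third : forall n, \sum_(k < n) k%:R ^+ 3 * p k <= M.
Hypotheses (p0_gt0 : 0 < p 0) (p1_gt0 : 0 < p 1).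

Let P N := \poly_(i < N) p i.
(** The shift by 2 keeps p_0 and p_1 in the truncation, as [char_gap] requires. *)
Let T n := trig_poly (P n.+2 ^+ n.+2) n.+1 (Num.sqrt n.+2%:R).

Let T_Re n t : let s := Num.sqrt (n.+2%:R : R) in
  T n t = complex.Re ((map_poly toC (P n.+2)).[cis (t / s)] ^+ n.+2 * cis (- n.+1%:R * (t / s))).
Proof.
rewrite /= -horner_exp -rmorphXn /= horner_cis Re_sum /T /trig_poly; apply: eq_bigr => j _.
by rewrite Re_toCM /=; congr (_ * cos _); ring.
Qed.

(** Truncating p below n does not affect the coefficient of degree n-1. The integral over a period,
    rescaled by t = x sqrt(n), tends to a Gaussian integral I, and kappa = I / (2 pi). *)
Theorem local_limit : exists2 kappa : R, 0 < kappa &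
  (fun n => Num.sqrt n%:R * (P n ^+ n)`_n.-1) @ \oo --> kappa.
Proof.
have [s2 s2_gt0 Bs2] := variance_exists p_ge0 p_sum p_third p0_gt0.
have sr0 n : 0 < Num.sqrt (n.+2%:R : R) by rewrite sqrtr_gt0.
pose c := p 0 * p 1 / (48 * (p 0 + p 1)).
have c0 : 0 < c by rewrite divr_gt0 ?mulr_gt0 // addr_gt0.
have [gi _] := gauss_integral c0.
have s22 : 0 < s2 / 2 by rewrite divr_gt0.
have [gi2 [I I0 IE]] := gauss_integral s22.
pose D n := `[- (pi * Num.sqrt (n.+2%:R : R)), pi * Num.sqrt (n.+2%:R : R)].
pose f_ n := (EFin \o T n) \_ [set` D n].
have mD n : measurable [set` D n] by exact: measurable_itv.
have mT n : measurable_fun setT (T n).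
  by apply: continuous_measurable_fun; exact: continuous_trig_poly.
have inD n t : (t \in [set` D n]) = (`|t| <= pi * Num.sqrt (n.+2%:R : R)).
  by rewrite mem_setE in_itv /= ler_norml.
have mf n : measurable_fun setT (f_ n).
  apply/(measurable_restrictT _ (mD n)); apply/measurable_EFinP.
  exact: measurable_funS (mT n).
have f_f t : f_ ^~ t @ \oo --> (expR (- (s2 / 2 * t ^+ 2)))%:E.
  apply: cvg_EFin.
    by near=> n; rewrite /f_ patchE; case: ifP.
  pose K := M + (1 + M) * `|t| ^+ 3 + (s2 * t ^+ 2 / 2) ^+ 2 + (M + M) * `|t| +
            (1 + M) * `|t| ^+ 3 + 2 * `|t|.
  pose v n := K * (Num.sqrt (n.+2%:R : R))^-1 + t ^+ 2 / 2 *
    `|\sum_(k < n.+2) p k * (k%:R - 1) ^+ 2 - s2|.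
  (* From this index on |t| <= sqrt(n+2), so t lies in the interval of integration. *)
  apply: (@cvgn_dominated R _ v _ (Num.bound (t ^+ 2))).
    move=> n tn /=; rewrite /f_ patchE inD.
    have -> : `|t| <= pi * Num.sqrt (n.+2%:R : R).
      have : `|t| <= Num.sqrt (n.+2%:R : R).
        rewrite -sqrtr_sqr ler_wsqrtr //; apply: ltW.
        apply: lt_le_trans (archi_boundP (sqr_ge0 t)) _; by rewrite ler_nat (leq_trans tn) // -addn2 leq_addr.
      move/le_trans; apply; rewrite ler_peMl ?sqrtr_ge0 //.
      by apply: (le_trans _ (@pi_ge2 R)); rewrite ler1n.
    rewrite /= T_Re (_ : s2 / 2 * t ^+ 2 = s2 * t ^+ 2 / 2); last by ring.
    exact: (pointwise_bound p_ge0 p_sum p_mean p_third t (ltW s2_gt0) erefl).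
  rewrite (_ : 0 = K * 0 + t ^+ 2 / 2 * `|s2 - s2|); last by rewrite subrr normr0 !mulr0 addr0.
  apply: cvgD.
    apply: cvgMr; have := @cvgn_sqrtV R; rewrite -(cvg_shiftn 1) /=.
    by under eq_fun do rewrite addn1.
  apply: cvgMr; apply: cvg_norm; apply: cvgB; last exact: cvg_cst.
  have := Bs2; rewrite -(cvg_shiftn 2) /=.
  by under eq_fun do rewrite addn2.
(* At x = t / sqrt(n+2) the power n+2 turns exp(-c x^2) into exp(-c t^2), a majorant independent of
   n. *)
have f_g n t : (`|f_ n t| <= (expR (- (c * t ^+ 2)))%:E)%E.
  rewrite /f_ patchE inD; case: ifPn => [tD|_]; last by rewrite abse0 lee_fin expR_ge0.
  rewrite /= lee_fin T_Re; apply: le_trans (norm_Re_le _) _.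
  rewrite Normc.normcM normc_cis mulr1 normcX.
  have xpi : `|t / Num.sqrt (n.+2%:R : R)| <= pi.
    by rewrite normrM normfV [`|Num.sqrt _|]ger0_norm ?sqrtr_ge0 // ler_pdivrMr.
  have := char_gap p_ge0 p_sum p0_gt0 p1_gt0 (isT : (1 < n.+2)%N) xpi.
  rewrite -/c => h; have h2 := @lerXn2r R n.+2 _ _ (normc_ge0 _) (expR_ge0 _) h.
  apply: le_trans h2 _; rewrite -expRM_natl ler_expR.
  rewrite expr_div_n sqr_sqrtr ?ler0n // le_eqVlt; apply/orP; left; apply/eqP.
  have : n.+2%:R != 0 :> R by rewrite pnatr_eq0.
  by move: (n.+2%:R) => N N0; field.
have f_f' t : setT t -> f_ ^~ t @ \oo --> (expR (- (s2 / 2 * t ^+ 2)))%:E by move=> _; exact: f_f.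
have f_g' t n : setT t -> (`|f_ n t| <= (expR (- (c * t ^+ 2)))%:E)%E by move=> _; exact: f_g.
have [_ _] := @dominated_convergence _ _ R mu setT measurableT f_ _ _ mf
  (measurable_int _ gi2) (aeW mu (f_f' : forall t, setT t -> _)) gi
  (aeW mu (f_g' : forall t n, setT t -> _)).
rewrite IE => cv.
exists (I / (2 * pi)); first by rewrite divr_gt0 // mulr_gt0 // pi_gt0.
have {}cv : (fun n => 2 * pi * Num.sqrt (n.+2%:R : R) * (P n.+2 ^+ n.+2)`_n.+1) @ \oo --> I.
  rewrite (_ : (fun _ => _) = fine \o (fun n => (\int[mu]_x f_ n x)%E)); first exact: fine_cvg.
  by apply/funext => n /=; rewrite -integral_mkcond integral_trig_poly.
rewrite -(cvg_shiftn 2) /=; have pn0 : pi != 0 :> R by rewrite gt_eqF // pi_gt0.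
rewrite (_ : (fun _ => _) = (fun n => 2 * pi * Num.sqrt (n.+2%:R : R) *
    (P n.+2 ^+ n.+2)`_n.+1 * (2 * pi)^-1)); first exact: cvgMl.
apply/funext => n /=; rewrite addn2 /= -[2 * pi * _ * _]mulrA mulrAC divff ?mul1r //.
by rewrite mulf_neq0 ?pnatr_eq0.
Unshelve. all: by end_near. Qed.

End Fourier.

(** * The critical point *)

Section CoefficientOrder.
Variable R : realType.
Implicit Types (p q A B : {poly R}) (a b phi : R^nat) (x : R).

Definition coef_le p q := forall i, p`_i <= q`_i.

Lemma coef_le_refl p : coef_le p p. Proof. by move=> i. Qed.

Lemma coef_ge0M p q : coef_le 0 p -> coef_le 0 q -> coef_le 0 (p * q).
Proof.
move=> p0 q0 i; rewrite coef0 coefM; apply: sumr_ge0 => j _.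
by have := p0 j; have := q0 (i - j)%N; rewrite !coef0 => ? ?; rewrite mulr_ge0.
Qed.

Lemma coef_leM p p' q q' : coef_le 0 p -> coef_le p p' -> coef_le 0 q -> coef_le q q' ->
  coef_le (p * q) (p' * q').
Proof.
move=> p0 pp' q0 qq' i; rewrite !coefM; apply: ler_sum => j _.
have := p0 j; have := q0 (i - j)%N; rewrite !coef0 => ? ?.
by apply: ler_pM.
Qed.

Lemma coef_ge0X p n : coef_le 0 p -> coef_le 0 (p ^+ n).
Proof.
move=> p0; elim: n => [|n IH]; last by rewrite exprS; exact: coef_ge0M.
by move=> i; rewrite expr0 coef0 coef1 ler0n.
Qed.

Lemma coef_leX p q n : coef_le 0 p -> coef_le p q -> coef_le (p ^+ n) (q ^+ n).
Proof.
move=> p0 pq; elim: n => [|n IH]; first exact: coef_le_refl.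
by rewrite !exprS; apply: coef_leM => //; exact: coef_ge0X.
Qed.

Lemma coef_le_horner p q x : coef_le p q -> 0 <= x -> p.[x] <= q.[x].
Proof.
move=> pq x0; rewrite (horner_coef_wide x (leq_maxl (size p) (size q))).
rewrite (horner_coef_wide x (leq_maxr (size p) (size q))).
by apply: ler_sum => i _; rewrite ler_wpM2r ?exprn_ge0.
Qed.

Lemma coef_ge0_poly a n : (forall k, 0 <= a k) -> coef_le 0 (\poly_(i < n) a i).
Proof. by move=> a0 i; rewrite coef0 coef_poly; case: ifP. Qed.

Lemma coef_le_trunc a m n : (forall k, 0 <= a k) -> (m <= n)%N ->
  coef_le (\poly_(i < m) a i) (\poly_(i < n) a i).
Proof.
move=> a0 mn i; rewrite !coef_poly; case: ltnP => im; first by rewrite (leq_trans im mn).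
by case: ifP.
Qed.

Lemma coef_le_comp a m n A B : (forall k, 0 <= a k) -> (m <= n)%N ->
  coef_le 0 A -> coef_le A B ->
  coef_le ((\poly_(i < m) a i) \Po A) ((\poly_(i < n) a i) \Po B).
Proof.
move=> a0 mn A0 AB j; rewrite !comp_trunc_poly !coef_sum.
have B0 : coef_le 0 B by move=> i; exact: le_trans (A0 i) (AB i).
apply: (@le_trans _ _ (\sum_(i < m) (a i *: B ^+ i)`_j)).
  by apply: ler_sum => i _; rewrite !coefZ ler_wpM2l //; exact: coef_leX.
rewrite -!(big_mkord xpredT (fun i => (a i *: B ^+ i)`_j)).
rewrite [leRHS](big_cat_nat (n := m) (p := n)) //= lerDl sumr_ge0 // => i _.
by rewrite coefZ mulr_ge0 //; have := coef_ge0X i B0 j; rewrite coef0.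
Qed.

Lemma coef_ge0_comp a n A : (forall k, 0 <= a k) -> coef_le 0 A ->
  coef_le 0 ((\poly_(i < n) a i) \Po A).
Proof.
move=> a0 A0 j; rewrite comp_trunc_poly coef_sum coef0; apply: sumr_ge0 => i _.
by rewrite coefZ mulr_ge0 //; have := coef_ge0X i A0 j; rewrite coef0.
Qed.

Lemma coef_ge0XM p : coef_le 0 p -> coef_le 0 ('X * p).
Proof.
by move=> p0 [|i]; rewrite coef0 coefXM //; have := p0 i; rewrite coef0.
Qed.

Lemma coef_leXM p q : coef_le p q -> coef_le ('X * p) ('X * q).
Proof. by move=> pq [|i]; rewrite !coefXM /=. Qed.

Section FormalExp.
Variables b phi : R^nat.
Hypotheses (b_ge0 : forall k, 0 <= b k) (phi0 : phi 0%N = 1).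
Hypothesis phi_rec : forall n,
  n.+1%:R * phi n.+1 = \sum_(k < n.+1) k.+1%:R * b k.+1 * phi (n - k)%N.

Lemma formal_exp_ge0 n : 0 <= phi n.
Proof.
elim/ltn_ind: n => -[|n] IH; first by rewrite phi0.
rewrite -(pmulr_rge0 _ (ltr0Sn R n)) phi_rec; apply: sumr_ge0 => k _.
by apply: mulr_ge0; [rewrite mulr_ge0|apply: IH; rewrite ltnS leq_subr].
Qed.

(** Keeping only the term of b_1 turns the recurrence into that of exp, with an inequality. *)
Lemma formal_exp_lb n : 1 <= b 1%N -> (n`!%:R)^-1 <= phi n.
Proof.
move=> b1; elim: n => [|n IH]; first by rewrite phi0 fact0 invr1.
rewrite factS natrM invfM ler_pdivrMl ?ltr0n // phi_rec big_ord_recl /= mul1r subn0.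
rewrite -[leLHS]addr0; apply: lerD.
  by apply: le_trans IH _; rewrite ler_peMl // formal_exp_ge0.
by apply: sumr_ge0 => k _; rewrite !mulr_ge0 // formal_exp_ge0.
Qed.

(** For the truncations P of phi and B of b one has P' <= B' P coefficientwise, so P exp(-B) does
    not increase on the nonnegative axis; at 0 it is at most 1. This bounds phi by exp(B) without
    composing convergent series. *)
Lemma formal_exp_psum N x : 0 <= x ->
  \sum_(k < N) phi k * x ^+ k <= expR (\sum_(k < N) b k * x ^+ k).
Proof.
move=> x0; set P := \poly_(i < N) phi i; set B := \poly_(i < N) b i.
have PE : \sum_(k < N) phi k * x ^+ k = P.[x] by rewrite horner_poly.
have BE : \sum_(k < N) b k * x ^+ k = B.[x] by rewrite horner_poly.
have le_deriv t : 0 <= t -> P^`().[t] <= (B^`() * P).[t].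
  apply: coef_le_horner => i; rewrite coef_deriv coefM coef_poly.
  case: ltnP => [iN|_]; last first.
    rewrite mul0rn; apply: sumr_ge0 => j _; rewrite coef_deriv !coef_poly.
    by rewrite mulr_ge0 ?mulrn_wge0 //; case: ifP => // _; exact: formal_exp_ge0.
  rewrite -mulr_natl phi_rec; apply: ler_sum => j _; rewrite coef_deriv !coef_poly.
  have ji : (j <= i)%N by rewrite -ltnS.
  have -> : (j.+1 < N)%N by lia.
  have -> : (i - j < N)%N by lia.
  by rewrite mulr_natl.
have := @ge0_deriv_ge R (fun t => - (P.[t] * expR (- B.[t])))
  (fun t => - ((P^`().[t] - B^`().[t] * P.[t]) * expR (- B.[t]))) x.
rewrite PE BE => h.
have h0 : - (P.[0] * expR (- B.[0])) <= - (P.[x] * expR (- B.[x])).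
  apply: h => // t.
    have dH (p : {poly R}) : is_derive t (1 : R) (horner p) (p^`()).[t].
      by apply: DeriveDef; [exact: derivable_horner|rewrite -derive1E derivE].
    have dP := dH P; have dB := dH B.
    by apply: is_derive_eq; rewrite /GRing.scale /=; ring.
  move=> t0; rewrite oppr_ge0 pmulr_lle0 ?expR_gt0 // subr_le0.
  by have := le_deriv t t0; rewrite hornerM.
have e0 : 0 < expR (- B.[x]) by exact: expR_gt0.
have : P.[x] * expR (- B.[x]) <= 1.
  rewrite lerN2 in h0; apply: le_trans h0 _; rewrite !horner_coef0 !coef_poly.
  case: ifP => _; last by rewrite mul0r.
  by rewrite phi0 mul1r -expR0 ler_expR oppr_le0.
by rewrite expRN ler_pdivrMr ?expR_gt0 // mul1r.
Qed.

End FormalExp.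
End CoefficientOrder.

(** * The radius rho and the value tau *)

Section Critical.
Variables (R : realType) (b e phi : R^nat).
Hypotheses (b_ge0 : forall k, 0 <= b k) (b1_ge1 : 1 <= b 1%N).
Hypotheses (e_ge0 : forall k, 0 <= e k) (e0 : e 0%N = 1) (phi0 : phi 0%N = 1).
Hypothesis phi_rec : forall n,
  n.+1%:R * phi n.+1 = \sum_(k < n.+1) k.+1%:R * b k.+1 * phi (n - k)%N.
Hypothesis e_trunc : forall N, eqmodX N (\poly_(i < N) e i)
  ((\poly_(i < N) phi i) \Po ('X * \poly_(i < N) e i)).

Variables (rho tau r Bd : R).
Hypotheses (rho_ge0 : 0 <= rho) (tau_r : tau < r).
Hypothesis e_sum : (fun N => \sum_(n < N) e n * rho ^+ n.+1) @ \oo --> tau.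
Hypothesis b_bound : forall N, \sum_(k < N) b k * r ^+ k <= Bd.
Hypothesis rho_max : forall x C : R, 0 <= x ->
  (forall N, \sum_(n < N) e n * x ^+ n.+1 <= C) -> x <= rho.

Let phi_ge0 := formal_exp_ge0 b_ge0 phi0 phi_rec.

Let eterm_ge0 (x : R) n : 0 <= x -> 0 <= e n * x ^+ n.+1.
Proof. by move=> x0; rewrite mulr_ge0 // exprn_ge0. Qed.

Let psum_e N : \sum_(n < N) e n * rho ^+ n.+1 <= tau.
Proof. by apply: (@psum_le R (fun n => e n * rho ^+ n.+1)) => // k; exact: eterm_ge0. Qed.

Let tau_ge0 : 0 <= tau.
Proof. by have := psum_e 0; rewrite big_ord0. Qed.

Let r_gt0 : 0 < r. Proof. exact: le_lt_trans tau_r. Qed.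

Let phi_psum (s : R) N : 0 <= s -> s <= r -> \sum_(k < N) phi k * s ^+ k <= expR Bd.
Proof.
move=> s0 sr; apply: le_trans (formal_exp_psum b_ge0 phi0 phi_rec N s0) _.
rewrite ler_expR; apply: le_trans (b_bound N); apply: ler_sum => k _.
by rewrite ler_wpM2l // lerXn2r ?nnegrE // ltW.
Qed.

Let phiterm_ge0 (s : R) k : 0 <= s -> 0 <= phi k * s ^+ k.
Proof. by move=> s0; rewrite mulr_ge0 // exprn_ge0. Qed.

Lemma phi_cvg (s : R) : 0 <= s -> s <= r -> exists L : R, (fun N => \sum_(k < N) phi k * s ^+ k) @ \oo --> L.
Proof.
move=> s0 sr; apply: (@psum_cvg R (fun k => phi k * s ^+ k) (expR Bd)) => [k|n].
  exact: phiterm_ge0.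
exact: phi_psum.
Qed.

Let phi_lim_ge1 (s L : R) : 0 <= s -> (fun N => \sum_(k < N) phi k * s ^+ k) @ \oo --> L -> 1 <= L.
Proof.
move=> s0 sL; have := @psum_le R (fun k => phi k * s ^+ k) L 1 (fun k => phiterm_ge0 k s0) sL.
by rewrite big_ord_recl big_ord0 addr0 expr0 phi0 mulr1.
Qed.

Let horner_XE N x : ('X * \poly_(i < N) e i).[x] = \sum_(n < N) e n * x ^+ n.+1.
Proof.
rewrite hornerM hornerX horner_poly mulr_sumr; apply: eq_bigr => n _.
by rewrite exprS; ring.
Qed.

Let E_ge0 N : coef_le 0 ('X * \poly_(i < N) e i).
Proof. by apply: coef_ge0XM; exact: coef_ge0_poly. Qed.

(** The factor X gains one order: E modulo X^N determines X E modulo X^(N+1), so the coefficients up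
    to degree N agree. Beyond, the left side is zero and the right side nonnegative. *)
Let E_step N : coef_le (\poly_(i < N.+1) e i)
  ((\poly_(i < N.+1) phi i) \Po ('X * \poly_(i < N) e i)).
Proof.
have /eqmodXP h : eqmodX N.+1 (\poly_(i < N.+1) e i)
    ((\poly_(i < N.+1) phi i) \Po ('X * \poly_(i < N) e i)).
  apply: eqmodX_trans (e_trunc _) _; apply: eqmodX_compr.
  apply: eqmodX_mulX; exact: trunc_eqmodX.
move=> i; have [/h ->//|iN] := ltnP i N.+1.
rewrite coef_poly ltnNge iN /=.
by have := coef_ge0_comp N.+1 phi_ge0 (E_ge0 N) i; rewrite coef0.
Qed.

(* If x phi(s) = s, the partial sums of y at x remain below s, by induction. *)
Lemma majorant (s L : R) : 0 < s -> s <= r ->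
  (fun N => \sum_(k < N) phi k * s ^+ k) @ \oo --> L -> s <= rho * L.
Proof.
move=> s0 sr sL; have L1 := phi_lim_ge1 (ltW s0) sL.
have L0 : 0 < L by apply: lt_le_trans L1.
rewrite -ler_pdivrMr //; apply: (@rho_max _ s); first by rewrite divr_ge0 // ltW.
have x0 : 0 <= s / L by rewrite divr_ge0 // ltW.
elim=> [|N IH]; first by rewrite big_ord0 ltW.
have := coef_le_horner (E_step N) x0; rewrite horner_comp horner_XE horner_poly [X in _ <= X]horner_poly => h.
have -> : \sum_(n < N.+1) e n * (s / L) ^+ n.+1 = (s / L) * \sum_(n < N.+1) e n * (s / L) ^+ n.
  by rewrite mulr_sumr; apply: eq_bigr => n _; rewrite exprS; ring.
apply: le_trans (ler_wpM2l x0 h) _.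
have h2 : \sum_(i < N.+1) phi i * (\sum_(n < N) e n * (s / L) ^+ n.+1) ^+ i <= L.
  apply: le_trans (@psum_le R (fun k => phi k * s ^+ k) L N.+1 (fun k => phiterm_ge0 k (ltW s0)) sL).
  apply: ler_sum => i _; apply: ler_wpM2l => //; apply: lerXn2r => //; rewrite nnegrE; last exact: ltW.
  by apply: sumr_ge0 => n _; exact: eterm_ge0.
by apply: le_trans (ler_wpM2l x0 h2) _; rewrite divfK // gt_eqF.
Qed.

(** [majorant] at s = r gives r <= rho phi(r), with r > 0. *)
Lemma rho_gt0 : 0 < rho.
Proof.
have [L rL] := phi_cvg (ltW r_gt0) (lexx r).
have := majorant r_gt0 (lexx r) rL; have L1 := phi_lim_ge1 (ltW r_gt0) rL.
move=> h; rewrite lt_neqAle rho_ge0 andbT; apply/eqP => rho0.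
by move: h; rewrite -rho0 mul0r leNgt r_gt0.
Qed.

Lemma tau_gt0 : 0 < tau.
Proof.
apply: lt_le_trans (psum_e 1); rewrite big_ord_recl big_ord0 addr0 e0 mul1r expr1.
exact: rho_gt0.
Qed.

(** For fixed M and N the polynomial phi_M(X E_N) has coefficients at most those of E, so its value
    at rho is at most tau / rho; N tends to infinity with M fixed. *)
Let phi_tau_le M : \sum_(m < M) phi m * tau ^+ m <= tau / rho.
Proof.
have r0 := rho_gt0.
have bound N : \sum_(m < M) phi m * (\sum_(n < N) e n * rho ^+ n.+1) ^+ m <= tau / rho.
  set q := (\poly_(i < M) phi i) \Po ('X * \poly_(i < N) e i).
  have qE : \sum_(m < M) phi m * (\sum_(n < N) e n * rho ^+ n.+1) ^+ m = q.[rho].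
    by rewrite horner_comp horner_XE horner_poly.
  have qe i : q`_i <= e i.
    pose k := maxn (maxn M N) i.+1.
    have /eqmodXP := e_trunc k; move=> /(_ i); rewrite leq_maxr => /(_ isT) h.
    have -> : e i = (\poly_(j < k) e j)`_i by rewrite coef_poly leq_maxr.
    rewrite h; apply: coef_le_comp => //.
      by rewrite (leq_trans (leq_maxl M N)) // leq_maxl.
    apply: coef_leXM; apply: coef_le_trunc => //.
    by rewrite (leq_trans (leq_maxr M N)) // leq_maxl.
  rewrite qE horner_coef ler_pdivlMr //; apply: le_trans (psum_e (size q)).
  rewrite mulr_suml; apply: ler_sum => i _; rewrite exprSr mulrA ler_wpM2r // ler_wpM2r //.
  exact: exprn_ge0.
apply: (cvgn_le (n0 := 0%N) (u := fun N => \sum_(m < M) phi m * (\sum_(n < N) e n * rho ^+ n.+1) ^+ m)) => //.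
apply: (@cvgn_sum R (fun m N => phi m * (\sum_(n < N) e n * rho ^+ n.+1) ^+ m) (fun m => phi m * tau ^+ m)).
move=> m; apply: cvgMr; apply: (cvg_comp _ (fun x : R => x ^+ m) e_sum).
exact: exprn_continuous.
Qed.

(** One inequality is [phi_tau_le]; the other is [majorant] at s = tau, which is admissible because
    tau < r. *)
Lemma phi_tau : (fun N => \sum_(k < N) phi k * tau ^+ k) @ \oo --> tau / rho.
Proof.
have [L tL] := phi_cvg tau_ge0 (ltW tau_r).
suff -> : tau / rho = L by [].
apply/eqP; rewrite eq_le (cvgn_le (n0 := 0%N) tL) ?andbT => [|n _]; last exact: phi_tau_le.
by rewrite ler_pdivrMr ?rho_gt0 // mulrC; apply: majorant tL; [exact: tau_gt0|exact: ltW].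
Qed.

Lemma expR1_le_rhoV : expR 1 <= rho^-1.
Proof.
have t0 := tau_gt0; have r0 := rho_gt0.
have h1 : expR tau <= tau / rho.
  have : (fun N => \sum_(k < N) tau ^+ k / k`!%:R) @ \oo --> expR tau.
    have := @is_cvg_series_exp_coeff R tau; rewrite /expR /series /exp_coeff /=.
    by under [X in cvg (X @ _)]eq_fun do rewrite big_mkord;
       under [X in _ -> _ --> lim (X @ _)]eq_fun do rewrite big_mkord.
  move/(cvgn_le (n0 := 0%N)); apply=> n _; apply: le_trans (phi_tau_le n).
  apply: ler_sum => k _; rewrite mulrC ler_wpM2r ?exprn_ge0 //.
  exact: formal_exp_lb phi_rec _ _.
have h2 : tau <= expR (tau - 1) by have := expR_ge1Dx (tau - 1); rewrite addrC subrK.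
have h3 : expR 1 * expR (tau - 1) <= rho^-1 * expR (tau - 1).
  rewrite -expRD addrC subrK; apply: le_trans h1 _; rewrite mulrC ler_wpM2l //.
  by rewrite invr_ge0.
by rewrite ler_pM2r ?expR_gt0 in h3.
Qed.

End Critical.

(** * Moments of p *)

Section Moments.
Variable R : realType.

(** The cube of x <= exp(x) at x = k ln(q) / 3, hence the constant 27 / ln(q)^3. *)
Lemma cube_le_geometric (q : R) : 1 < q -> exists2 C : R, 0 <= C & forall k, k%:R ^+ 3 <= C * q ^+ k.
Proof.
move=> q1; have q0 : 0 < q by apply: lt_trans q1.
have c0 : 0 < ln q by rewrite ln_gt0.
exists (27 / ln q ^+ 3); first by rewrite divr_ge0 // exprn_ge0 // ltW.
move=> k; rewrite mulrAC ler_pdivlMr ?exprn_gt0 //.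
have -> : q ^+ k = expR (k%:R * ln q / 3) ^+ 3.
  by rewrite -expRM_natl -[q in LHS]lnK ?posrE // -expRM_natl; congr expR; field.
have -> : k%:R ^+ 3 * ln q ^+ 3 = 27 * (k%:R * ln q / 3) ^+ 3 by field.
rewrite ler_wpM2l // lerXn2r ?nnegrE ?expR_ge0 //.
  by rewrite divr_ge0 // mulr_ge0 // ltW.
apply: le_trans (expR_ge1Dx _); lra.
Qed.

Lemma expr1D_le (d : R) k : 0 <= d -> (1 + d) ^+ k <= 1 + k%:R * d + k%:R ^+ 2 * d ^+ 2 * (1 + d) ^+ k.
Proof.
move=> d0; elim: k => [|k IH]; first by rewrite expr0 expr0n /=; lra.
have d1 : 0 <= 1 + d by lra.
have := ler_wpM2l d1 IH; rewrite -exprS => h; apply: le_trans h _.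
have e1 : 1 <= (1 + d) ^+ k.+1 by rewrite exprn_ege1 //; lra.
have E : (1 + d) ^+ k.+1 = (1 + d) * (1 + d) ^+ k by rewrite exprS.
rewrite -natr1 -subr_ge0 [(1 + d) ^+ k.+1]E.
have -> : 1 + (k%:R + 1) * d + (k%:R + 1) ^+ 2 * d ^+ 2 * ((1 + d) * (1 + d) ^+ k) -
   (1 + d) * (1 + k%:R * d + k%:R ^+ 2 * d ^+ 2 * (1 + d) ^+ k) =
   k%:R * d ^+ 2 * ((1 + d) ^+ k.+1 - 1) + (k%:R + 1) * d ^+ 2 * (1 + d) ^+ k.+1.
  by rewrite E; ring.
have k0 : 0 <= k%:R :> R by [].
by rewrite addr_ge0 // mulr_ge0 ?subr_ge0 ?mulr_ge0 ?sqr_ge0 ?addr_ge0 ?exprn_ge0.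
Qed.

Lemma expr1B_le (d : R) k : 0 <= d -> d <= 1 -> (1 - d) ^+ k <= 1 - k%:R * d + k%:R ^+ 2 * d ^+ 2.
Proof.
move=> d0 d1; elim: k => [|k IH]; first by rewrite expr0 expr0n /=; lra.
have d2 : 0 <= 1 - d by lra.
have := ler_wpM2l d2 IH; rewrite -exprS => h; apply: le_trans h _.
rewrite -natr1 -subr_ge0.
have -> : 1 - (k%:R + 1) * d + (k%:R + 1) ^+ 2 * d ^+ 2 -
   (1 - d) * (1 - k%:R * d + k%:R ^+ 2 * d ^+ 2) =
   (k%:R + 1) * d ^+ 2 + k%:R ^+ 2 * d ^+ 3 by ring.
have k0 : 0 <= k%:R :> R by [].
by rewrite addr_ge0 // mulr_ge0 ?exprn_ge0 ?addr_ge0.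
Qed.

Lemma le_of_small (x y C d0 : R) : 0 < d0 -> 0 <= C ->
  (forall d, 0 < d -> d <= d0 -> x <= y + d * C) -> x <= y.
Proof.
move=> d00 C0 h; rewrite leNgt; apply/negP => yx.
have C1 : 0 < C + 1 by lra.
pose d := Num.min d0 ((x - y) / (2 * (C + 1))).
have d_gt0 : 0 < d by rewrite lt_min d00 divr_gt0 ?subr_gt0 ?mulr_gt0.
have dd0 : d <= d0 by rewrite ge_min lexx.
have := h d d_gt0 dd0.
have : d * (2 * (C + 1)) <= x - y by rewrite -ler_pdivlMr ?mulr_gt0 // ge_min lexx orbT.
have : 0 <= d * C by rewrite mulr_ge0 // ltW.
lra.
Qed.

Variables (p : R^nat) (w1 C1 : R).
Hypothesis p_ge0 : forall k, 0 <= p k.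
Hypothesis p_sum : (fun n => \sum_(k < n) p k) @ \oo --> (1 : R).
Hypothesis w1_gt1 : 1 < w1.
Hypothesis p_exp : forall n, \sum_(k < n) p k * w1 ^+ k <= C1.
(* The generating function of p lies above the diagonal, which it meets at 1. *)
Hypothesis p_tangent : forall w L : R, 0 < w -> w <= w1 ->
  (fun n => \sum_(k < n) p k * w ^+ k) @ \oo --> L -> w <= L.

Let bounded_of (h : R^nat) C : 0 <= C -> (forall k, h k <= C * w1 ^+ k) ->
  forall n, \sum_(k < n) h k * p k <= C * C1.
Proof.
move=> C0 hC n; apply: le_trans (ler_wpM2l C0 (p_exp n)); rewrite mulr_sumr.
by apply: ler_sum => k _; rewrite mulrCA mulrC ler_wpM2l.
Qed.

Lemma third_moment : exists M : R, forall n, \sum_(k < n) k%:R ^+ 3 * p k <= M.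
Proof.
have [C C0 hC] := cube_le_geometric w1_gt1.
by exists (C * C1); exact: (@bounded_of (fun k => k%:R ^+ 3)).
Qed.

Let w_cvg w : 0 < w -> w <= w1 -> exists L : R, (fun n => \sum_(k < n) p k * w ^+ k) @ \oo --> L.
Proof.
move=> w0 ww1; apply: (@psum_cvg R (fun k => p k * w ^+ k) C1) => [k|n].
  by rewrite mulr_ge0 // exprn_ge0 // ltW.
apply: le_trans (p_exp n); apply: ler_sum => k _; rewrite ler_wpM2l //.
by apply: lerXn2r => //; rewrite nnegrE; [exact: ltW|exact: le_trans (ltW w0) ww1].
Qed.

Let le_cube k : k%:R <= k%:R ^+ 3 :> R.
Proof. by rewrite -natrX ler_nat; case: k => // k; rewrite -[leqLHS]expn1 leq_pexp2l. Qed.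

Let le_cube2 k : k%:R ^+ 2 <= k%:R ^+ 3 :> R.
Proof. by rewrite -!natrX ler_nat; case: k => // k; rewrite leq_pexp2l. Qed.

(** The generating function f of p touches the diagonal at 1 from above, so its slope there is 1: up
    to second-order errors, f(1+d) >= 1+d gives mean at least 1, and f(1-d) >= 1-d gives mean at
    most 1. The former needs room beyond 1, that is [w1_gt1]. *)
Lemma mean_one : (fun n => \sum_(k < n) k%:R * p k) @ \oo --> (1 : R).
Proof.
have [M hM] := third_moment.
have [|n|m hm] := @psum_cvg R (fun k => k%:R * p k) M; first by move=> k; rewrite mulr_ge0.
  by apply: le_trans (hM n); apply: ler_sum => k _; rewrite ler_wpM2r.
suff mE : m = 1 by move: hm; rewrite mE.
have kp0 k : 0 <= k%:R * p k by rewrite mulr_ge0.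
apply/eqP; rewrite eq_le andbC; apply/andP; split.
  (* Strictly between 1 and w1, so that k^2 w0^k is at most a constant times w1^k and the remainder
     of [expr1D_le] is bounded uniformly in d. *)
  pose w0 := (1 + w1) / 2; have w01 : 1 < w0 by rewrite /w0 ltr_pdivlMr //; have := w1_gt1; lra.
  have w0w1 : w0 < w1 by rewrite /w0 ltr_pdivrMr //; have := w1_gt1; lra.
  have w00 : 0 < w0 by exact: lt_trans w01.
  have q1 : 1 < w1 / w0 by rewrite ltr_pdivlMr ?mul1r.
  have [C C0 hC] := cube_le_geometric q1.
  have b2 n : \sum_(k < n) (k%:R ^+ 2 * w0 ^+ k) * p k <= C * C1.
    apply: (@bounded_of (fun k => k%:R ^+ 2 * w0 ^+ k)) => // k.
    rewrite -ler_pdivlMr ?exprn_gt0 // -mulrA -expr_div_n.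
    exact: le_trans (le_cube2 k) (hC k).
  have CC0 : 0 <= C * C1 by have := b2 0; rewrite big_ord0.
  apply: (@le_of_small 1 m (C * C1) (w0 - 1)) => // [|d d0 dw]; first by lra.
  have wd : 0 < 1 + d by lra.
  have wd1 : 1 + d <= w1 by lra.
  have [L hL] := w_cvg wd wd1; have := p_tangent wd wd1 hL.
  have : L <= 1 + d * m + d ^+ 2 * (C * C1).
    apply: (cvgn_le (n0 := 0%N) hL) => n _.
    apply: le_trans (lerD (lerD (psum_le n p_ge0 p_sum)
       (ler_wpM2l (ltW d0) (@psum_le R (fun k => k%:R * p k) m n kp0 hm))) (ler_wpM2l (sqr_ge0 d) (b2 n))).
    rewrite !mulr_sumr -!big_split /=; apply: ler_sum => k _.
    apply: le_trans (ler_wpM2l (p_ge0 k) (expr1D_le k (ltW d0))) _.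
    have -> : p k + d * (k%:R * p k) + d ^+ 2 * (k%:R ^+ 2 * w0 ^+ k * p k) =
      p k * (1 + k%:R * d + k%:R ^+ 2 * d ^+ 2 * w0 ^+ k) by ring.
    apply: ler_wpM2l => //; rewrite lerD2l; apply: ler_wpM2l; first by rewrite mulr_ge0 ?sqr_ge0.
    by apply: lerXn2r; rewrite ?nnegrE ?(ltW wd) ?(ltW w00) // addrC -lerBrDr.
  move=> h1 h2; have : d * 1 <= d * (m + d * (C * C1)).
    rewrite mulr1 mulrDr mulrA -expr2; lra.
  by rewrite ler_pM2l.
have M0 : 0 <= M by have := hM 0; rewrite big_ord0.
apply: (@le_of_small m 1 M 1) => // d d0 d1.
(* For d = 1 the point 1 - d = 0 is outside the scope of [p_tangent]; the mean is then bounded by M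
   directly. *)
have [->|dn1] := eqVneq d 1.
  rewrite mul1r -[leLHS]add0r lerD //; apply: (cvgn_le (n0 := 0%N) hm) => n _.
  by apply: le_trans (hM n); apply: ler_sum => k _; rewrite ler_wpM2r.
have dl1 : d < 1 by rewrite lt_neqAle dn1.
have wd : 0 < 1 - d by lra.
have wd1 : 1 - d <= w1 by have := w1_gt1; lra.
have [L hL] := w_cvg wd wd1; have := p_tangent wd wd1 hL.
have : L + d * m <= 1 + d ^+ 2 * M.
  have cv : (fun n => \sum_(k < n) p k * (1 - d) ^+ k + d * \sum_(k < n) k%:R * p k) @ \oo --> L + d * m.
    by apply: cvgD => //; exact: cvgMr.
  apply: (cvgn_le (n0 := 0%N) cv) => n _.
  apply: le_trans (lerD (psum_le n p_ge0 p_sum) (ler_wpM2l (sqr_ge0 d) (hM n))).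
  rewrite !mulr_sumr -!big_split /=; apply: ler_sum => k _.
  rewrite -lerBrDr; apply: le_trans (ler_wpM2l (p_ge0 k) (expr1B_le k (ltW d0) d1)) _.
  have -> : p k + d ^+ 2 * (k%:R ^+ 3 * p k) - d * (k%:R * p k) =
      p k * (1 - k%:R * d + k%:R ^+ 3 * d ^+ 2) by ring.
  by rewrite ler_wpM2l // lerD2l ler_wpM2r ?sqr_ge0.
move=> h1 h2; have : d * m <= d * (1 + d * M).
  rewrite mulrDr mulr1 mulrA -expr2; lra.
by rewrite ler_pM2l.
Qed.

End Moments.

Lemma coef_comp_scaleX (R : comNzRingType) (q : {poly R}) c j :
  (q \Po (c *: 'X))`_j = c ^+ j * q`_j.
Proof.
rewrite comp_polyE coef_sum; have [jq|jq] := ltnP j (size q).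
  rewrite (bigD1 (Ordinal jq)) //= big1 ?addr0 => [|i ij].
    by rewrite exprZn !coefZ coefXn eqxx mulr1 mulrC.
  by rewrite exprZn !coefZ coefXn (_ : (j == i) = false) ?mulr0 // eq_sym; apply/negbTE.
rewrite nth_default // mulr0 big1 // => i _.
by rewrite exprZn !coefZ coefXn gtn_eqF ?mulr0 // (leq_trans _ jq).
Qed.

(** * From connected to arbitrary graphs *)

Section Transfer.
Variable R : realType.

(** Dominated convergence for sums whose length grows with n: finitely many terms converge, and the
    tails of f and l are both at most a tail of h. *)
Lemma tannery (f : nat -> R^nat) (h l : R^nat) (H L : R) :
  (forall n j, `|f n j| <= h j) -> (forall n, \sum_(j < n) h j <= H) ->
  (forall j, f ^~ j @ \oo --> l j) -> (fun n => \sum_(j < n) l j) @ \oo --> L ->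
  (fun n => \sum_(j < n) f n j) @ \oo --> L.
Proof.
move=> fh hH fl lL.
have h0 j : 0 <= h j by apply: le_trans (fh 0%N j).
have lh j : `|l j| <= h j.
  apply: (@cvgn_le R (fun n => `|f n j|) _ _ 0%N) => [|n _]; last exact: fh.
  exact: cvg_norm (fl j).
have [Hs hHs] := psum_cvg h0 hH.
suff : (fun n => \sum_(j < n) f n j - \sum_(j < n) l j) @ \oo --> (0 : R).
  by move=> d0; apply: cvg_sub0 lL.
apply/cvgr0Pnorm_le => e e0.
have e4 : 0 < e / 4 by rewrite divr_gt0.
have [J _ HJ] : \forall n \near \oo, `|Hs - \sum_(j < n) h j| <= e / 4.
  by move/cvgrPdist_le : hHs => /(_ _ e4).
have tail n : (J <= n)%N -> \sum_(J <= j < n) h j <= e / 4.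
  move=> Jn; have hn := psum_le n h0 hHs.
  have := HJ J (leqnn J); rewrite ger0_norm ?subr_ge0 ?psum_le //.
  apply: le_trans; rewrite lerBrDr; apply: le_trans hn.
  by rewrite -!(big_mkord xpredT) [leRHS](big_cat_nat (n := J)) //= addrC.
have fin : (fun n => \sum_(j < J) `|f n j - l j|) @ \oo --> (0 : R).
  have := @cvgn_sum R (fun j n => `|f n j - l j|) (fun _ => 0) J.
  rewrite big1 //; apply=> j; rewrite -(normr0 R) -(subrr (l j)).
  by apply: cvg_norm; apply: cvgB; [exact: fl|exact: cvg_cst].
have e2 : 0 < e / 2 by rewrite divr_gt0.
have [N0 _ HN] : \forall n \near \oo, `|\sum_(j < J) `|f n j - l j| | <= e / 2.
  by move/cvgr0Pnorm_le : fin => /(_ _ e2).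
near=> n; have Jn : (J <= n)%N by near: n; exact: nbhs_infty_ge.
rewrite -sumrB; apply: le_trans (ler_norm_sum _ _ _) _.
rewrite -(big_mkord xpredT (fun j => `|f n j - l j|)) (big_cat_nat (n := J)) //= big_mkord.
have -> : e = e / 2 + (e / 4 + e / 4) by field.
apply: lerD.
  by apply: le_trans (ler_norm _) _; apply: HN; near: n; exact: nbhs_infty_ge.
apply: le_trans (lerD (tail n Jn) (tail n Jn)); rewrite -big_split /=.
by apply: ler_sum => j _; apply: le_trans (ler_normB _ _) _; exact: lerD.
Unshelve. all: by end_near. Qed.

(** [w n] is n^(3/2), and [v n] below is n^(5/2). The factors 4 and 8 in what follows are crude
    bounds for 2^(3/2) and 2^(5/2). *)
Let w n : R := n%:R * Num.sqrt n%:R.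
Let w_ge0 n : 0 <= w n. Proof. by rewrite mulr_ge0 ?sqrtr_ge0. Qed.

Let w_mono m n : (m <= n)%N -> w m <= w n.
Proof. by move=> mn; rewrite ler_pM ?sqrtr_ge0 ?ler_nat // ler_wsqrtr // ler_nat. Qed.

Let w_double n : w n.*2 <= 4 * w n.
Proof.
rewrite /w -muln2 !natrM sqrtrM // mulrACA mulrC; rewrite ler_wpM2r ?mulr_ge0 ?sqrtr_ge0 //.
have : Num.sqrt (2 : R) <= 2.
  by rewrite -[leRHS]ger0_norm // -sqrtr_sqr ler_wsqrtr // expr2; lra.
lra.
Qed.

Lemma cvg_w_shift j : (fun n => w (n.+1 + j) / w n.+1) @ \oo --> (1 : R).
Proof.
pose r (n : nat) : R := 1 + j%:R * n.+1%:R^-1.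
have rE n : (n.+1 + j)%:R = r n * n.+1%:R :> R.
  by rewrite /r mulrDl mul1r -mulrA mulVf ?pnatr_eq0 // mulr1 natrD.
have r1 : r @ \oo --> (1 : R).
  have -> : (1 : R) = 1 + j%:R * 0 by rewrite mulr0 addr0.
  by apply: cvgD; [exact: cvg_cst|apply: cvgMr; exact: cvg_harmonic].
have r0 n : 0 <= r n by rewrite /r addr_ge0 // mulr_ge0 // invr_ge0.
have : (fun n => r n * Num.sqrt (r n)) @ \oo --> (1 * Num.sqrt 1 : R).
  by apply: cvgM => //; exact: (cvg_comp _ _ r1 (@sqrt_continuous R 1)).
rewrite sqrtr1 mulr1; apply: (@eq_cvgn _ _ _ _ 0%N) => n _.
rewrite /w !rE sqrtrM // mulrACA mulfK //.
Qed.

Variables (a g : R^nat) (K A Gs : R).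
Hypotheses (a_ge0 : forall n, 0 <= a n) (g_ge0 : forall n, 0 <= g n).
Hypothesis g_rec : forall n, n.+1%:R * g n.+1 = \sum_(k < n.+1) a k.+1 * g (n - k)%N.
Hypothesis a_sum : forall n, \sum_(k < n) a k <= A.
Hypothesis g_sum : (fun n => \sum_(k < n) g k) @ \oo --> Gs.
Hypothesis a_asym : (fun n => n%:R * Num.sqrt n%:R * a n) @ \oo --> K.

Let A_ge0 : 0 <= A. Proof. by have := a_sum 0; rewrite big_ord0. Qed.
Let Gs_ge0 : 0 <= Gs.
Proof. by have := psum_le 0 g_ge0 g_sum; rewrite big_ord0. Qed.

Let v n : R := n%:R * w n.
Let v_ge0 n : 0 <= v n. Proof. by rewrite mulr_ge0. Qed.

Let g_conv n : v n.+1 * g n.+1 = \sum_(j < n.+1) w n.+1 * a (n.+1 - j)%N * g j.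
Proof.
rewrite /v mulrAC mulrC g_rec mulr_sumr (reindex_inj rev_ord_inj) /=.
apply: eq_bigr => j _; have jn : (j <= n)%N by rewrite -ltnS.
by rewrite subSS subKn // subSn // mulrA.
Qed.

Let a_bound : exists2 M, 0 <= M & forall n, w n * a n <= M.
Proof.
have [M [_ HM]] := cvg_seq_bounded (cvgP _ a_asym).
exists (Num.max 0 (M + 1)); first by rewrite le_max lexx.
move=> n; rewrite le_max; apply/orP; right.
have := HM (M + 1); rewrite ltrDl ltr01 => /(_ isT n I) /=.
by apply: le_trans; exact: ler_norm.
Qed.

(** For j <= n/2 the index n - j is at least n/2, and doubling costs a factor 4. *)
Let near_part M n : (forall k, w k * a k <= M) -> forall j, (j.*2 <= n)%N ->
  w n * a (n - j)%N <= 4 * M.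
Proof.
move=> hM j jn; have : w n <= 4 * w (n - j)%N.
  by apply: le_trans (w_mono _) (w_double _); lia.
move/(ler_wpM2r (a_ge0 (n - j)%N))/le_trans; apply.
by rewrite -mulrA ler_wpM2l.
Qed.

(** For j > (n+1)/2 the bound on [v j * g j] makes [w n.+1 * g j] of order 1/n, and the sum of the
    a_k is at most A. The bound H is assumed only below n+1, so that the estimate can serve in an
    induction. *)
Let far_part H n : 0 <= H -> (forall m, (m < n.+1)%N -> v m * g m <= H) ->
  \sum_(j < n.+1 | ~~ (j.*2 <= n.+1)%N) w n.+1 * a (n.+1 - j)%N * g j <= 8 * A * H / n.+1%:R.
Proof.
move=> H0 hH.
have n0 : 0 < n.+1%:R :> R by rewrite ltr0n.
have term (j : 'I_n.+1) : ~~ (j.*2 <= n.+1)%N ->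
    w n.+1 * a (n.+1 - j)%N * g j <= a (n.+1 - j)%N * (8 * H / n.+1%:R).
  move=> jn; rewrite mulrAC mulrC ler_wpM2l // ler_pdivlMr // mulrC mulrA -/(v n.+1).
  have : v n.+1 <= 8 * v j.
    rewrite /v; have : w n.+1 <= 4 * w j by apply: le_trans (w_mono _) (w_double _); lia.
    have h2 : n.+1%:R <= 2 * j%:R :> R by rewrite -natrM ler_nat; lia.
    move=> h1; apply: le_trans (ler_pM _ _ h2 h1) _ => //; lra.
  move/(ler_wpM2r (g_ge0 j))/le_trans; apply; rewrite -mulrA ler_wpM2l //.
  exact: hH.
apply: le_trans (ler_sum _ term) _; rewrite -mulr_suml.
have -> : 8 * A * H / n.+1%:R = A * (8 * H / n.+1%:R) by ring.
rewrite ler_wpM2r ?divr_ge0 ?mulr_ge0 //.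
apply: le_trans (a_sum n.+2); rewrite big_ord_recl /=.
apply: le_trans (_ : \sum_(j < n.+1) a (n.+1 - j)%N <= _).
  by rewrite [leRHS](bigID (fun j : 'I_n.+1 => ~~ (j.*2 <= n.+1)%N)) /= lerDl sumr_ge0.
rewrite (reindex_inj rev_ord_inj) /= (eq_bigr (fun i : 'I_n.+1 => a (bump 0 i))).
  by rewrite lerDr.
by move=> i _; rewrite subKn // /bump leq0n.
Qed.

(** Strong induction: the near half contributes at most 4 M Gs, the far half at most 8 A H / n. The
    term 8 M Gs in H makes the former at most H/2, n > n1 >= 16 A does so for the latter, and the
    finite sum in H covers the indices up to n1. *)
Let g_bound : exists2 H, 0 <= H & forall n, v n * g n <= H.
Proof.
have [M M0 hM] := a_bound.
pose n1 := Num.bound (16 * A).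
pose H := 8 * M * Gs + \sum_(m < n1.+1) v m * g m.
have H1 : 0 <= \sum_(m < n1.+1) v m * g m by apply: sumr_ge0 => m _; rewrite mulr_ge0.
have MG : 0 <= 8 * M * Gs by rewrite !mulr_ge0.
have H0 : 0 <= H by rewrite addr_ge0.
exists H => // n; elim/ltn_ind: n => n IH.
have [nn1|n1n] := leqP n n1.
  rewrite /H (bigD1 (Ordinal (nn1 : (n < n1.+1)%N))) //=.
  have : 0 <= \sum_(i < n1.+1 | i != Ordinal (nn1 : (n < n1.+1)%N)) v i * g i.
    by apply: sumr_ge0 => m _; rewrite mulr_ge0.
  lra.
case: n n1n IH => [//|n] n1n IH; rewrite g_conv.
rewrite (bigID (fun j : 'I_n.+1 => (j.*2 <= n.+1)%N)) /=.
have far := far_part H0 IH.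
have near : \sum_(j < n.+1 | (j.*2 <= n.+1)%N) w n.+1 * a (n.+1 - j)%N * g j <= 4 * M * Gs.
  apply: le_trans (ler_wpM2l _ (psum_le n.+1 g_ge0 g_sum)); last by rewrite mulr_ge0.
  rewrite mulr_sumr [leRHS](bigID (fun j : 'I_n.+1 => (j.*2 <= n.+1)%N)) /= -[leLHS]addr0.
  apply: lerD; last by apply: sumr_ge0 => j _; rewrite !mulr_ge0.
  by apply: ler_sum => j jn; rewrite ler_wpM2r //; exact: near_part.
have n0 : 0 < n.+1%:R :> R by rewrite ltr0n.
have : 8 * A * H / n.+1%:R <= H / 2.
  rewrite ler_pdivrMr //; have : 16 * A <= n.+1%:R.
    have A16 : 0 <= 16 * A by rewrite mulr_ge0.
    apply: ltW; apply: lt_le_trans (archi_boundP A16) _; rewrite ler_nat; exact: ltnW.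
  by move/(ler_wpM2r H0); lra.
have h1 : 4 * M * Gs <= H / 2 by rewrite /H; lra.
move=> h2; apply: le_trans (lerD near far) _; apply: le_trans (lerD h1 h2) _.
by rewrite -splitr.
Qed.

(** One large index carries the weight of n^(5/2) g_n = sum_j n^(3/2) a_(n-j) g_j: for fixed j the
    factor n^(3/2) a_(n-j) tends to K, [tannery] sums K g_j over j <= n/2, and the far half is of
    order 1/n. *)
Theorem transfer : (fun n => n%:R ^+ 2 * Num.sqrt n%:R * g n) @ \oo --> K * Gs.
Proof.
have [M M0 hM] := a_bound; have [H H0 hH] := g_bound.
pose f n j : R := if (j.*2 <= n)%N then w n * a (n - j)%N * g j else 0.
have fK : (fun n => \sum_(j < n) f n j) @ \oo --> K * Gs.
  apply: (@tannery f (fun j => 4 * M * g j) (fun j => K * g j) (4 * M * Gs)).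
  - move=> n j; rewrite /f; case: ifP => jn; last by rewrite normr0 !mulr_ge0.
    by rewrite ger0_norm ?mulr_ge0 // ler_wpM2r //; exact: near_part.
  - move=> n; rewrite -mulr_sumr; apply: ler_wpM2l; first by rewrite mulr_ge0.
    exact: psum_le.
  - move=> j; have aj : (fun n => w (n.+1 + j) / w n.+1 * (w n.+1 * a n.+1) * g j) @ \oo --> 1 * K * g j.
      apply: cvgMl; apply: cvgM; first exact: cvg_w_shift.
      by have := a_asym; rewrite -(cvg_shiftn 1) /=; under eq_fun do rewrite addn1.
    rewrite mul1r in aj; rewrite -(cvg_shiftn j.+1) /=.
    apply: (eq_cvgn (n0 := j)) aj => n jn.
    rewrite /f (_ : (j.*2 <= n + j.+1)%N); last first.
      by rewrite -addnn; lia.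
    have -> : (n + j.+1 = n.+1 + j)%N by lia.
    rewrite addnK.
    congr (_ * _); rewrite mulrA divfK //.
    by rewrite mulf_neq0 ?pnatr_eq0 // gt_eqF // sqrtr_gt0.
  - under eq_fun do rewrite -mulr_sumr; exact: cvgMr.
rewrite -(cvg_shiftn 1) /=; have fK1 := fK; rewrite -(cvg_shiftn 1) /= in fK1.
suff d0 : (fun n => (n + 1)%:R ^+ 2 * Num.sqrt (n + 1)%:R * g (n + 1)%N - \sum_(j < n + 1) f (n + 1)%N j) @ \oo --> (0 : R).
  exact: cvg_sub0 fK1.
apply: (@cvgn_dominated R _ (fun n => 8 * A * H * n.+1%:R^-1) _ 0); last first.
  have -> : (0 : R) = 8 * A * H * 0 by rewrite mulr0.
  by apply: cvgMr; exact: cvg_harmonic.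
move=> n _; rewrite subr0 addn1.
have -> : n.+1%:R ^+ 2 * Num.sqrt n.+1%:R * g n.+1 = v n.+1 * g n.+1 by rewrite /v /w; ring.
rewrite g_conv (bigID (fun j : 'I_n.+1 => (j.*2 <= n.+1)%N)) /=.
rewrite [X in _ - X](_ : _ = \sum_(j < n.+1 | (j.*2 <= n.+1)%N) w n.+1 * a (n.+1 - j)%N * g j).
  rewrite addrAC subrr add0r ger0_norm; first by apply: far_part => // m _; exact: hH.
  by apply: sumr_ge0 => j _; rewrite !mulr_ge0.
by rewrite /f [RHS]big_mkcond.
Qed.

End Transfer.

(** * From subcriticality to the asymptotic estimate *)

(** Translates the inequality between extended reals into real data: rho is the radius of Y, tau the
    value there, and r a point strictly between tau and the radius of b. *)
Lemma subcritical_data (R : realType) (Y b : R^nat) :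
  (forall n, 0 <= Y n) -> 0 < Y 1%N -> (forall n, 0 <= b n) ->
  (epseries Y (cvg_radius Y) < cvg_radius b)%E ->
  exists rho tau r Bd : R, [/\ 0 <= rho,
    (fun N => \sum_(n < N) Y n * rho ^+ n) @ \oo --> tau, tau < r,
    (forall N, \sum_(k < N) b k * r ^+ k <= Bd) &
    forall x C : R, 0 <= x -> (forall N, \sum_(n < N) Y n * x ^+ n <= C) -> x <= rho].
Proof.
move=> Y0 Y1 b0 sub.
have term0 (a : R^nat) x n : (forall n, 0 <= a n) -> 0 <= x -> 0 <= a n * x ^+ n.
  by move=> a0 x0; rewrite mulr_ge0 // exprn_ge0.
have pseriesE (a : R^nat) x : pseries a x = fun N => \sum_(n < N) a n * x ^+ n.
  by apply/funext => N; rewrite /pseries /series /= big_mkord.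
have in_disk (x C : R) : 0 <= x -> (forall N, \sum_(n < N) Y n * x ^+ n <= C) ->
    (x%:E <= cvg_radius Y)%E.
  move=> x0 hC; apply: ereal_sup_ubound; exists x; last by rewrite ger0_norm.
  rewrite /= pseriesE; apply/cvg_ex.
  exact: (@psum_cvg R (fun n => Y n * x ^+ n) C (fun n => term0 _ _ _ Y0 x0) hC).
have rad0 : (0%:E <= cvg_radius Y)%E.
  apply: (in_disk 0 (Y 0%N)) => // -[|N]; first by rewrite big_ord0.
  rewrite big_ord_recl expr0 mulr1 big1 ?addr0 // => i _.
  by rewrite expr0n mulr0.
case E : (cvg_radius Y) rad0 => [rho| |] //; last first.
  move=> _; move: sub; rewrite E ltNge; apply: contraNP => _.
  rewrite (le_trans (leey _)) //.
  (* At +oo the term of index 1 is already +oo because Y_1 > 0; hence the radius of Y is finite. *)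
  have /= := @nneseries_lim_ge R (fun n => (Y n)%:E * +oo ^+ n)%E xpredT 0 2.
  rewrite big_nat_recr //= big_nat1 gt0_muley ?lte_fin //.
  rewrite ?expe0 ?mule1 addey // => h; apply: h => n _ _.
  by rewrite mule_ge0 ?lee_fin // expe_ge0.
rewrite lee_fin => rho0.
have sub' : (\sum_(0 <= n <oo) (Y n * rho ^+ n)%:E < cvg_radius b)%E.
  move: sub; rewrite E /epseries; congr (_ < _)%E.
  by apply: eq_eseriesr => n _; rewrite EFinM EFin_expe.
have tE n : (0 <= (Y n * rho ^+ n)%:E)%E by rewrite lee_fin term0.
have fin : (\sum_(0 <= n <oo) (Y n * rho ^+ n)%:E)%E \is a fin_num.
  rewrite ge0_fin_numE; last by apply: nneseries_ge0 => n _ _.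
  exact: lt_le_trans sub' (leey _).
pose tau1 := fine (\sum_(0 <= n <oo) (Y n * rho ^+ n)%:E)%E.
have bnd N : \sum_(n < N) Y n * rho ^+ n <= tau1.
  rewrite -lee_fin fineK // -(big_mkord xpredT (fun n => Y n * rho ^+ n)) -sumEFin.
  by apply: nneseries_lim_ge => n _ _.
have [tau htau] := @psum_cvg R (fun n => Y n * rho ^+ n) tau1 (fun n => term0 _ _ _ Y0 rho0) bnd.
have tau_le : tau <= tau1 by apply: (cvgn_le (n0 := 0%N) htau) => N _; exact: bnd.
have : (tau%:E < cvg_radius b)%E.
  by apply: le_lt_trans sub'; rewrite -(fineK fin) lee_fin.
move/ereal_sup_gt => [_ [x /= cx <-]]; rewrite lte_fin => taux.
have tau0 : 0 <= tau by have := psum_le 0 (fun n => term0 _ _ n Y0 rho0) htau; rewrite big_ord0.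
(* x is a point of convergence of b, of either sign, with tau < |x|; the midpoint lies strictly
   inside the disc, where convergence is absolute. *)
pose r := (tau + `|x|) / 2.
have taur : tau < r by rewrite /r ltr_pdivlMr //; lra.
have rx : r < `|x| by rewrite /r ltr_pdivrMr //; lra.
have r0 : 0 <= r by apply: le_trans (ltW taur).
have := @is_cvg_pseries_inside_norm R b x r cx; rewrite (ger0_norm r0) => /(_ rx).
rewrite pseriesE => /cvg_ex[Bd hBd].
exists rho, tau, r, Bd; split=> //.
  move=> N; have -> : \sum_(k < N) b k * r ^+ k = \sum_(k < N) `|b k| * r ^+ k.
    by apply: eq_bigr => k _; rewrite ger0_norm.
  by apply: (psum_le (a := fun k => `|b k| * r ^+ k) N _ hBd) => k; rewrite mulr_ge0 ?exprn_ge0.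
by move=> y C y0 hC; have := in_disk y C y0 hC; rewrite E lee_fin.
Qed.

Theorem theorem8 (R : realType) (G : graph_family)
    (G_class : graph_class G) (G_stable : block_stable G)
    (G_subcritical : subcritical R G)
    (C_pos : exists n0 : nat, forall n : nat, (n0 <= n)%N ->
       0 < egf_pointed R (connected_subclass G) n) :
  exists gamma c : R, [/\ expR 1 <= gamma, 0 < c &
    exists2 eps : R^nat, eps @ \oo --> (0 : R) &
      forall n : nat, (0 < n)%N ->
        egf R G n = c * n%:R `^ (- (5 / 2)) * gamma ^+ n * (1 + eps n)].
Proof.
pose e := conn_coef R G; pose b := block_coef R G; pose g := egf R G.
have e_ge0 : forall n, 0 <= e n := conn_coef_ge0 R G.
have b_ge0 : forall n, 0 <= b n := block_coef_ge0 R G.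
have e0 : e 0%N = 1 := conn_coef0 R G_class G_stable.
have b1 : 1 <= b 1%N := block_coef1 R G_stable.
have [phi phi0 phi_rec] := formal_exp_exists b.
have e_trunc := trunc_comp e0 phi0 phi_rec (conn_coef_rec R G_class G_stable).
have lagr := lagrange_coef e0 phi0 phi_rec (conn_coef_rec R G_class G_stable).
have phi_ge0 := formal_exp_ge0 b_ge0 phi0 phi_rec.
pose Y := egf_pointed R (connected_subclass G).
have Y0 : Y 0%N = 0 := egf_pointed0 R G.
have YS n : Y n.+1 = e n := egf_pointed_connected R G n.
have Yb : pseries_diffs (egf R (two_connected_subclass G)) = b.
  by apply/funext => n; exact: pseries_diffs_blocks.
have Ysum (x : R) N : \sum_(n < N.+1) Y n * x ^+ n = \sum_(n < N) e n * x ^+ n.+1.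
  by rewrite big_ord_recl Y0 mul0r add0r; apply: eq_bigr => i _; rewrite YS.
have Y_ge0 n : 0 <= Y n by case: n => [|n]; rewrite ?Y0 ?YS.
have Y1 : 0 < Y 1%N by rewrite YS e0.
have sub : (epseries Y (cvg_radius Y) < cvg_radius b)%E.
  by have := G_subcritical; rewrite /subcritical Yb.
have [rho [tau [r [Bd [rho0 rtau taur bBd rmax]]]]] := subcritical_data Y_ge0 Y1 b_ge0 sub.
have e_sum : (fun N => \sum_(n < N) e n * rho ^+ n.+1) @ \oo --> tau.
  have := rtau; rewrite -(cvg_shiftn 1) /=.
  by under eq_fun do rewrite addn1 Ysum.
have {}rmax (x C : R) : 0 <= x -> (forall N, \sum_(n < N) e n * x ^+ n.+1 <= C) -> x <= rho.
  move=> x0 hC; apply: (rmax x C x0) => -[|N]; last by rewrite Ysum.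
  by have := hC 0%N; rewrite !big_ord0.
have rho_gt0 : 0 < rho := rho_gt0 b_ge0 e_ge0 phi0 phi_rec e_trunc rho0 taur e_sum bBd rmax.
have tau_gt0 : 0 < tau := tau_gt0 b_ge0 e_ge0 e0 phi0 phi_rec e_trunc rho0 taur e_sum bBd rmax.
have phi_t := phi_tau b_ge0 e_ge0 e0 phi0 phi_rec e_trunc rho0 taur e_sum bBd rmax.
have r_gt0 : 0 < r by apply: lt_trans taur.
have rn0 : rho != 0 by rewrite gt_eqF.
have tn0 : tau != 0 by rewrite gt_eqF.
have rt0 : 0 < rho / tau by rewrite divr_gt0.
(* The factor rho / tau is 1 / phi(tau) by [phi_t]. *)
pose p k := phi k * tau ^+ k * (rho / tau).
have p_ge0 k : 0 <= p k by rewrite !mulr_ge0 ?exprn_ge0 // ltW // invr_gt0.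
have p_sum : (fun n => \sum_(k < n) p k) @ \oo --> (1 : R).
  rewrite (_ : (1 : R) = tau / rho * (rho / tau)); last by field; rewrite rn0 tn0.
  under eq_fun do rewrite -mulr_suml.
  exact: cvgMl.
have pw w : \sum_(k < w.2) p k * w.1 ^+ k = (\sum_(k < w.2) phi k * (tau * w.1) ^+ k) * (rho / tau).
  by rewrite mulr_suml; apply: eq_bigr => k _; rewrite /p exprMn; ring.
have w1_gt1 : 1 < r / tau by rewrite ltr_pdivlMr ?mul1r.
have p_exp n : \sum_(k < n) p k * (r / tau) ^+ k <= expR Bd * (rho / tau).
  rewrite (pw (_, n)) /= ler_pM2r // [tau * _]mulrC divfK //.
  apply: le_trans (formal_exp_psum b_ge0 phi0 phi_rec n (ltW r_gt0)) _.
  by rewrite ler_expR.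
(* [majorant] at s = tau w reads tau w <= rho phi(tau w), where phi(tau w) = L tau / rho. *)
have p_tan (w L : R) : 0 < w -> w <= r / tau -> (fun n => \sum_(k < n) p k * w ^+ k) @ \oo --> L -> w <= L.
  move=> w0 wr wL.
  have sL : (fun n => \sum_(k < n) phi k * (tau * w) ^+ k) @ \oo --> L * (tau / rho).
    have : (fun n => (\sum_(k < n) p k * w ^+ k) * (tau / rho)) @ \oo --> L * (tau / rho) by exact: cvgMl.
    apply: (eq_cvgn (n0 := 0%N)) => n _.
    by rewrite (pw (w, n)) /= -mulrA (_ : rho / tau * (tau / rho) = 1) ?mulr1 //; field; rewrite rn0 tn0.
  have sr : tau * w <= r by rewrite mulrC -ler_pdivlMr.
  have := majorant b_ge0 e_ge0 phi0 phi_rec e_trunc rmax (mulr_gt0 tau_gt0 w0) sr sL.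
  rewrite (_ : rho * (L * (tau / rho)) = tau * L); last by field.
  by rewrite ler_pM2l.
have [M p_third] := third_moment p_ge0 w1_gt1 p_exp.
have p_mean := mean_one p_ge0 p_sum w1_gt1 p_exp p_tan.
have p0_gt0 : 0 < p 0%N by rewrite /p phi0 expr0 !mul1r.
(* phi_1 >= 1 stems from the link-graph through b_1 >= 1. *)
have p1_gt0 : 0 < p 1%N.
  rewrite /p expr1 !mulr_gt0 // ?invr_gt0 //; apply: lt_le_trans (formal_exp_lb b_ge0 phi0 phi_rec 1 b1).
  by rewrite invr_gt0 ltr0n.
have [kappa kappa0 lim_kappa] := local_limit p_ge0 p_sum p_mean p_third p0_gt0 p1_gt0.
(* Replacing u by tau u multiplies the coefficient of u^n by tau^n, so Lagrange inversion for phi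
   carries over to p with the factor rho^(n+1) / tau. *)
have coefP n : ((\poly_(i < n.+1) p i) ^+ n.+1)`_n = rho ^+ n.+1 / tau * (n.+1%:R * e n).
  have -> : \poly_(i < n.+1) p i = (rho / tau) *: ((\poly_(i < n.+1) phi i) \Po (tau *: 'X)).
    apply/polyP => i; rewrite coefZ coef_comp_scaleX !coef_poly /p.
    by case: ifP => _; [ring|rewrite !mulr0].
  rewrite exprZn coefZ exp_comp_poly coef_comp_scaleX.
  have := lagr n.+1 isT; rewrite /= => <-.
  by rewrite exprMn exprVn [tau ^+ n.+1]exprS; field; rewrite tn0 expf_neq0.
pose a n := Y n * rho ^+ n.
have a_asym : (fun n => n%:R * Num.sqrt n%:R * a n) @ \oo --> tau * kappa.
  have : (fun n => tau * (Num.sqrt n%:R * ((\poly_(i < n) p i) ^+ n)`_n.-1)) @ \oo --> tau * kappa.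
    exact: cvgMr.
  apply: (eq_cvgn (n0 := 1%N)) => -[//|n] _ /=.
  by rewrite coefP /a YS; field.
have a_ge0 n : 0 <= a n by rewrite mulr_ge0 // exprn_ge0.
have g_ge0 n : 0 <= g n * rho ^+ n by rewrite mulr_ge0 ?exprn_ge0 // egf_ge0.
have g_rec n : n.+1%:R * (g n.+1 * rho ^+ n.+1) =
    \sum_(k < n.+1) a k.+1 * (g (n - k)%N * rho ^+ (n - k)).
  rewrite mulrA egf_family_rec // mulr_suml; apply: eq_bigr => k _.
  have kn : (k <= n)%N by rewrite -ltnS.
  have rE : rho ^+ n.+1 = rho ^+ k.+1 * rho ^+ (n - k) by rewrite -exprD addSn subnKC.
  rewrite rE /a (YS k) /e /g; ring.
have a_sum n : \sum_(k < n) a k <= tau by apply: psum_le.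
(* Coefficients of C. They exhibit g as a formal exponential, so G(rho) <= exp(C(rho)), and C <= C^.
   termwise bounds this by exp(tau). *)
pose cc n := if n is m.+1 then e m / n%:R else 0.
have cc_ge0 n : 0 <= cc n by case: n => [|n] //=; rewrite divr_ge0.
have g_exp n : n.+1%:R * g n.+1 = \sum_(k < n.+1) k.+1%:R * cc k.+1 * g (n - k)%N.
  rewrite egf_family_rec //; apply: eq_bigr => k _.
  have -> : k.+1%:R * cc k.+1 = e k by rewrite /cc mulrC divfK ?pnatr_eq0.
  by [].
have [Gs hGs] : exists Gs : R, (fun n => \sum_(k < n) g k * rho ^+ k) @ \oo --> Gs.
  apply: (@psum_cvg R (fun k => g k * rho ^+ k) (expR tau)) => // n.
  apply: le_trans (formal_exp_psum cc_ge0 (egf_family0 R G_class G_stable) g_exp n rho0) _.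
  rewrite ler_expR; apply: le_trans (a_sum n); apply: ler_sum => -[[|k] _] _ /=.
    by rewrite mul0r.
  rewrite /a YS ler_wpM2r ?exprn_ge0 // ler_pdivrMr ?ltr0n // ler_peMr // ler1n //.
have Gs1 : 1 <= Gs.
  have := psum_le 1 g_ge0 hGs; rewrite big_ord_recl big_ord0 addr0 expr0 mulr1.
  by rewrite /g egf_family0.
have := transfer a_ge0 g_ge0 g_rec a_sum hGs a_asym; set c := tau * kappa * Gs => lim_c.
have c_gt0 : 0 < c by rewrite !mulr_gt0 // (lt_le_trans ltr01).
exists rho^-1, c; split=> //.
  exact: (expR1_le_rhoV b_ge0 b1 e_ge0 e0 phi0 phi_rec e_trunc rho0 taur e_sum bBd rmax).
(* The ratio of n^(5/2) g_n rho^n to its limit, minus 1, so that the formula is exact for every n >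
   0. *)
exists (fun n => n%:R ^+ 2 * Num.sqrt n%:R * (g n * rho ^+ n) / c - 1).
  have : (fun n => n%:R ^+ 2 * Num.sqrt n%:R * (g n * rho ^+ n) / c) @ \oo --> c / c.
    exact: cvgMl.
  rewrite divff ?gt_eqF // => h; apply/subr_cvg0; exact: h.
move=> n n0; have nR : 0 < n%:R :> R by rewrite ltr0n.
have s0 : 0 < Num.sqrt n%:R :> R by rewrite sqrtr_gt0.
have -> : n%:R `^ (- (5 / 2)) = (n%:R ^+ 2 * Num.sqrt n%:R)^-1 :> R.
  rewrite powRN (_ : 5 / 2 = 2%:R + 2^-1 :> R); last by field.
  rewrite powRD ?powR_mulrn ?powR12_sqrt ?ltW //.
  by apply/implyP => _; rewrite gt_eqF.
rewrite -/(g n) addrC subrK exprVn; field.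
by rewrite !gt_eqF // ?exprn_gt0.
Qed.
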